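(* Let $u$ be the solution to $$\begin{cases}\Delta u=\mathbf a\cdot\nabla\delta_{\mathbf o} & \text{in }\mathbb R^2\setminus\overline{\Omega_1\cup\Omega_2},\\ u=c_j & \text{on }\partial\Omega_j,\ j=1,2,\\ \int_{\partial\Omega_j}\partial_\nu u\,ds=0, & j=1,2,\\ u(X)=O(|X|^{-1}) & \text{as }|X|\to\infty,\end{cases}$$ with $\mathbf a=(0,1)$ and $\mathbf o=(0,0)$, where the constants $c_1,c_2$ are unknowns determined by the problem. Then, for all sufficiently small $\epsilon$, $$|\nabla u(X)|\lesssim\frac1{|X|^2}$$ for all $X\in B_1\setminus(\overline{\Omega_1\cup\Omega_2}\cup\{\mathbf o\})$.
   Context: $B_r(P)$ is the open disk of radius $r$ centered at $P\in\mathbb R^2$, and $B_r:=B_r((0,0))$. Fix $\alpha\in(0,\pi)$. Let $S_1=(-1/2,0)$, $S_2=(1/2,0)$ and, for $j=1,2$, $\Gamma_j=\{(y_1,y_2): |y_2|<(-1)^j\tan(\alpha/2)\,(y_1-(-1)^j\tfrac12)\}$, the open cone with vertex $S_j$ and aperture angle $\alpha$. Fix $\mu>1$. For each small $\epsilon>0$, $\Omega_1,\Omega_2\subset\mathbb R^2$ are bounded simply connected open sets (inclusions) with $\mathrm{dist}(\Omega_1,\Omega_2)=\epsilon$ such that $\Omega_1\cap B_\mu=(\Gamma_1+((1-\epsilon)/2,0))\cap B_\mu$ and $\Omega_2\cap B_\mu=(\Gamma_2+((\epsilon-1)/2,0))\cap B_\mu$; equivalently $\epsilon(\Gamma_1\cup\Gamma_2)\cap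 B_\mu=(\Omega_1\cup\Omega_2)\cap B_\mu$. Their boundaries are smooth except at the vertices $V_1=(-\epsilon/2,0)\in\partial\Omega_1$ and $V_2=(\epsilon/2,0)\in\partial\Omega_2$; the configuration is symmetric with respect to both coordinate axes (each $\Omega_j$ is symmetric in the $x_1$-axis, and $\Omega_2$ is the mirror image of $\Omega_1$ in the $x_2$-axis); the shapes of $\Omega_1,\Omega_2$ do not depend on $\epsilon$ (as $\epsilon$ varies they are only translated along the $x_1$-axis). $\nu$ is the unit normal on $\partial(\Omega_1\cup\Omega_2)$ pointing into $\Omega_1\cup\Omega_2$. $\delta_P$ is the Dirac mass at $P$; with $\mathcal N_P(X)=\frac1{2\pi}\log|X-P|$ one has $\Delta(\mathbf a\cdot\nabla\mathcal N_P)=\mathbf a\cdot\nabla\delta_P$. $A\lesssim B$ means $A\le CB$ for a constant $C>0$ independent of $\epsilon$ and $X$ (it may depend on the fixed data $\alpha$, $\mu$ and the shapes). *)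

(* Defs.v *)
From HB Require Import structures.
From mathcomp Require Import all_boot all_order all_algebra.
From mathcomp Require Import all_classical all_reals all_analysis.

Set Implicit Arguments.
Unset Strict Implicit.
Unset Printing Implicit Defensive.

Import Order.TTheory GRing.Theory Num.Theory.
Import numFieldNormedType.Exports.

Local Open Scope classical_set_scope.
Local Open Scope ring_scope.

(* The library norm on [R * R] is the max norm: it induces the right topology,
   but metric notions (disks, distances, |X|) must go through [enorm]. *)
Notation plane R := (R * R)%type (only parsing).

Section plane_geometry.
Context {R : realType}.
Implicit Types (A B : set (plane R)) (X Y a : plane R).

Definition dotp X Y : R := X.1 * Y.1 + X.2 * Y.2.

Definition enorm X : R := Num.sqrt (dotp X X).

Definition disk (r : R) (P : plane R) : set (plane R) :=
  [set X | enorm (X - P) < r].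

Definition origin : plane R := (0, 0).

Definition translate A a : set (plane R) := [set X + a | X in A].

Definition set_dist A B : R :=
  inf [set d | exists X Y, [/\ A X, B Y & d = enorm (X - Y)]].

Definition bdry A : set (plane R) := closure A `\` A°.

(* Gamma_j, for j = 1, 2 *)
Definition cone (alpha : R) (j : nat) : set (plane R) :=
  [set y | `|y.2| < (-1) ^+ j * tan (alpha / 2) * (y.1 - (-1) ^+ j * (1 / 2))].

Definition path_connected A : Prop :=
  forall X Y, A X -> A Y -> exists p : R -> plane R,
    [/\ {within `[0, 1], continuous p}, p 0 = X, p 1 = Y
      & forall t, t \in `[0, 1] -> A (p t)].

Definition simply_connected A : Prop :=
  path_connected A /\
  forall p : R -> plane R,
    {within `[0, 1], continuous p} -> p 0 = p 1 ->
    (forall t, t \in `[0, 1] -> A (p t)) ->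
    exists H : R * R -> plane R,
      [/\ {within `[0, 1] `*` `[0, 1], continuous H},
          forall s t, s \in `[0, 1] -> t \in `[0, 1] -> A (H (s, t)),
          forall t, t \in `[0, 1] -> H (0, t) = p t,
          forall t, t \in `[0, 1] -> H (1, t) = p 0
        & forall s, s \in `[0, 1] -> H (s, 0) = p 0 /\ H (s, 1) = p 0].

Definition velocity (gamma : R -> plane R) (t : R) : plane R :=
  (derive1 (fun s => (gamma s).1) t, derive1 (fun s => (gamma s).2) t).

(* [gamma], on [0, 1], runs once around the boundary of [A], from [V] to [V];
   it is smooth and regular on the open interval, i.e. off [V]. *)
Definition boundary_param A (V : plane R) (gamma : R -> plane R) : Prop :=
  [/\ {within `[0, 1], continuous gamma},
      gamma 0 = V /\ gamma 1 = V,
      {in `[0, 1[ &, injective gamma},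
      gamma @` `[0, 1] = bdry A
    & forall t, t \in `]0, 1[ ->
        (forall n, derivable (derive1n n (fun s => (gamma s).1)) t 1 /\
                   derivable (derive1n n (fun s => (gamma s).2)) t 1) /\
        velocity gamma t <> origin].

Definition smooth_boundary_except A (V : plane R) : Prop :=
  exists gamma, boundary_param A V gamma.

Definition unit_normal_into A (gamma : R -> plane R)
    (nu : plane R -> plane R) : Prop :=
  forall t, t \in `]0, 1[ ->
    [/\ enorm (nu (gamma t)) = 1,
        dotp (nu (gamma t)) (velocity gamma t) = 0
      & \forall s \near 0^'+, A (gamma t + s *: nu (gamma t))].

End plane_geometry.

Section inclusions.
Context {R : realType}.

Definition vertex1 (eps : R) : plane R := (- eps / 2, 0).
Definition vertex2 (eps : R) : plane R := (eps / 2, 0).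

Record inclusions (alpha mu eps : R) (Om1 Om2 : set (plane R)) : Prop := {
  inc_open : open Om1 /\ open Om2 ;
  inc_bounded : bounded_set Om1 /\ bounded_set Om2 ;
  inc_simply_connected : simply_connected Om1 /\ simply_connected Om2 ;
  inc_dist : set_dist Om1 Om2 = eps ;
  inc_cone1 : Om1 `&` disk mu origin =
    translate (cone alpha 1) ((1 - eps) / 2, 0) `&` disk mu origin ;
  inc_cone2 : Om2 `&` disk mu origin =
    translate (cone alpha 2) ((eps - 1) / 2, 0) `&` disk mu origin ;
  inc_smooth1 : smooth_boundary_except Om1 (vertex1 eps) ;
  inc_smooth2 : smooth_boundary_except Om2 (vertex2 eps) ;
  inc_sym1 : forall x y, Om1 (x, - y) <-> Om1 (x, y) ;
  inc_sym2 : forall x y, Om2 (x, - y) <-> Om2 (x, y) ;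
  inc_mirror : forall x y, Om2 (x, y) <-> Om1 (- x, y) }.

(* The configurations for 0 < eps < eps0; the shapes do not depend on eps. *)
Record inclusion_family (alpha mu eps0 : R) (Om1 Om2 : R -> set (plane R))
    : Prop := {
  fam_inclusions : forall eps, 0 < eps < eps0 ->
    inclusions alpha mu eps (Om1 eps) (Om2 eps) ;
  fam_translate1 : forall eps eps', 0 < eps < eps0 -> 0 < eps' < eps0 ->
    Om1 eps' = translate (Om1 eps) ((eps - eps') / 2, 0) ;
  fam_translate2 : forall eps eps', 0 < eps < eps0 -> 0 < eps' < eps0 ->
    Om2 eps' = translate (Om2 eps) ((eps' - eps) / 2, 0) }.

Definition exterior (Om1 Om2 : set (plane R)) : set (plane R) :=
  ~` closure (Om1 `|` Om2).

End inclusions.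

Section calculus.
Context {R : realType}.
Implicit Types (U : set (plane R)) (f u : plane R -> R) (P a X : plane R).

Definition e1 : plane R := (1, 0).
Definition e2 : plane R := (0, 1).

Definition grad f X : plane R := ('D_e1 f X, 'D_e2 f X).

Definition laplacian f X : R := 'D_e1 ('D_e1 f) X + 'D_e2 ('D_e2 f) X.

Fixpoint pderiv (s : seq bool) f : plane R -> R :=
  if s is b :: s' then 'D_(if b then e2 else e1) (pderiv s' f) else f.

Definition Ck_on U (k : nat) f : Prop :=
  forall s, (size s <= k)%N -> forall X, U X ->
    {for X, continuous (pderiv s f)} /\
    ((size s < k)%N -> derivable (pderiv s f) X e1 /\ derivable (pderiv s f) X e2).

Definition smooth_on U f : Prop := forall k, Ck_on U k f.

Definition lebesgue2 := (@lebesgue_measure R \x @lebesgue_measure R)%E.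

(* Distributions on an open set are represented by their action on test
   functions. *)
Definition test_function U (phi : plane R -> R) : Prop :=
  [/\ smooth_on setT phi, compact (closure [set X | phi X != 0])
    & closure [set X | phi X != 0] `<=` U].

Definition distribution := (plane R -> R) -> R.

Definition locally_integrable2 U u : Prop :=
  forall K, compact K -> K `<=` U -> lebesgue2.-integrable K (EFin \o u).

Definition distr_of U u : distribution :=
  fun phi => \int[lebesgue2]_(X in U) (u X * phi X).

Definition dirac_distr P : distribution := fun phi => phi P.

Definition distr_laplacian (T : distribution) : distribution :=
  fun phi => T (laplacian phi).

Definition distr_dgrad a (T : distribution) : distribution :=
  fun phi => - T (fun X => dotp a (grad phi X)).

Definition laplacian_eq U u (T : distribution) : Prop :=
  locally_integrable2 U u /\
  forall phi, test_function U phi -> distr_laplacian (distr_of U u) phi = T phi.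

(* [nu] points into the inclusion, so the normal derivative at a boundary point
   only uses the values of [u] at [X - s nu], outside the inclusion. *)
Definition normal_quotient u (nu : plane R -> plane R) X (s : R) : R :=
  (u X - u (X - s *: nu X)) / s.

Definition normal_derivative u (nu : plane R -> plane R) X : R :=
  lim (normal_quotient u nu X s @[s --> 0^'+]).

(* Zero flux through the boundary of [A], whose only non-smooth point is [V];
   the arc-length integral is computed in a regular parametrization. *)
Definition zero_flux (A : set (plane R)) (V : plane R) u : Prop :=
  forall gamma nu, boundary_param A V gamma -> unit_normal_into A gamma nu ->
    let flux_density t :=
      normal_derivative u nu (gamma t) * enorm (velocity gamma t) in
    [/\ forall t, t \in `]0, 1[ ->
          cvg (normal_quotient u nu (gamma t) s @[s --> 0^'+]),
        lebesgue_measure.-integrable `]0, 1[ (EFin \o flux_density)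
      & \int[lebesgue_measure]_(t in `]0, 1[) flux_density t = 0].

(* Only the values of [u] on the closure of the exterior domain matter. *)
Record dipole_solution (a o : plane R) (eps : R) (Om1 Om2 : set (plane R)) u
    : Prop := {
  sol_regular : Ck_on (exterior Om1 Om2 `\ o) 2 u ;
  sol_continuous :
    {within (exterior Om1 Om2 `|` bdry Om1 `|` bdry Om2) `\ o, continuous u} ;
  sol_eq : laplacian_eq (exterior Om1 Om2) u (distr_dgrad a (dirac_distr o)) ;
  sol_const1 : exists c1, forall X, bdry Om1 X -> u X = c1 ;
  sol_const2 : exists c2, forall X, bdry Om2 X -> u X = c2 ;
  sol_flux1 : zero_flux Om1 (vertex1 eps) u ;
  sol_flux2 : zero_flux Om2 (vertex2 eps) u ;
  sol_decay : exists M r, forall X, r < enorm X -> `|u X| <= M / enorm X }.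

End calculus.

(* Main.v *)
Require Import Defs.
From HB Require Import structures.
From mathcomp Require Import all_boot all_order all_algebra.
From mathcomp Require Import all_classical all_reals all_analysis.
From mathcomp Require Import ring lra.

Set Implicit Arguments.
Unset Strict Implicit.
Unset Printing Implicit Defensive.

Import Order.TTheory GRing.Theory Num.Theory.
Import numFieldNormedType.Exports.
Local Open Scope classical_set_scope.
Local Open Scope ring_scope.

(** The dipole points along the axis of symmetry [x1 = 0] that separates the two
inclusions, so the potential [u] should be odd in [x2]. An odd potential
vanishes on the axis [x2 = 0] and on both inclusions, and the gap then carries
no concentration: [u] is dominated by the field of the free dipole, with
constants that do not see the width [eps] of the gap.

Near the origin, [u] differs from [kappa * x2 / |X|^2] by a bounded function
([dipole_asymptotics]). This is extracted from the distributional equation by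
testing it on radial functions that are, up to affine changes, a logarithm in
between two scales.

Hence the even part [h(x1, x2) = u(x1, x2) + u(x1, - x2)] is harmonic and
bounded near the origin, and a maximum principle for exterior domains
([exterior_max_principle]) bounds it by the largest of [0], [2 c_1] and [2 c_2].
If that bound were [2 c_j > 0], the normal derivative of [h] would have a sign
along the boundary of the j-th inclusion, and by Hopf's lemma it would be
nonzero along the straight sides near the vertex; the flux through this boundary
would not vanish ([flux_contradiction]). Applied to [u] and to [- u], this gives
[c_1 = c_2 = 0], and [u] is odd ([conducting_odd]). Comparison with the
free dipole in the upper half plane then yields [|u| <= kappa * |x2| / |X|^2]
([dipole_bound]).

It remains to pass from [u] to its gradient at a point [X] of the unit disk. When
the distance from [X] to the straight sides is comparable to [|X|], the interior
estimate [3 sup |u| / r] for partial derivatives ([gradient_bound]) suffices,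
since [|u| <= kappa / |X|]. When
[X] is close to a side, [u] vanishes on that side and is compared with an
explicit quadratic barrier in a half disk whose radius is comparable to the
distance to the vertex; this bounds [u] near [X] by the height above the side
over [|X|^2] ([side_growth]), and the interior estimate divides by that height
([wedge_gradient]).

Everything about harmonic functions is derived from the maximum principle, which
is itself reduced to the second-derivative test at an interior maximum; neither
mean values nor Poisson kernels are involved. The inclusions enter only through
the cones that they fill near the gap, the half planes that contain them, their
symmetry, and a smooth boundary curve with a normal pointing inwards whose
opposite points outwards ([outward_normal]). *)

(** * Second-order derivatives at a point *)

Section SecondDerivative.
Context {R : realType}.
Implicit Types f g : R -> R.

(** Two derivatives at [x], with the first one existing around [x]: exactly what
the second-derivative test requires. *)
Definition jet2 f (x a b : R) := exists f' : R -> R,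
  [/\ \forall t \near x, is_derive (t : R) 1 (f : R -> R) (f' t), f' x = a & is_derive x 1 f' b].

Lemma jet2_eq f x a b a' b' : jet2 f x a b -> a = a' -> b = b' -> jet2 f x a' b'.
Proof. by move=> h <- <-. Qed.

Lemma jet2_cst c x : jet2 (fun=> c) x 0 0.
Proof.
exists (fun=> 0); split => //; last exact: is_derive_cst.
by near=> t; exact: is_derive_cst.
Unshelve. all: by end_near. Qed.

Lemma jet2_id x : jet2 id x 1 0.
Proof.
exists (fun=> 1); split => //; last exact: is_derive_cst.
by near=> t; exact: is_derive_id.
Unshelve. all: by end_near. Qed.

Lemma jet2D f g x a b c d : jet2 f x a b -> jet2 g x c d ->
  jet2 (fun t => f t + g t) x (a + c) (b + d).
Proof.
move=> [f' [hf <- f'x]] [g' [hg <- g'x]].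
exists (fun t => f' t + g' t); split => //; last exact: (is_deriveD f'x g'x).
near=> t.
have ft : is_derive (t : R) 1 f (f' t) by near: t.
have gt : is_derive (t : R) 1 g (g' t) by near: t.
exact: (is_deriveD ft gt).
Unshelve. all: by end_near. Qed.

Lemma jet2M f g x a b c d : jet2 f x a b -> jet2 g x c d ->
  jet2 (fun t => f t * g t) x (f x * c + g x * a)
       (f x * d + g x * b + 2 * a * c).
Proof.
move=> [f' [hf <- f'x]] [g' [hg <- g'x]].
exists (fun t => f t * g' t + g t * f' t); split => //.
  near=> t.
  have ft : is_derive (t : R) 1 f (f' t) by near: t.
  have gt : is_derive (t : R) 1 g (g' t) by near: t.
  exact: (is_deriveM ft gt).
have fx : is_derive x 1 f (f' x) by exact: nbhs_singleton hf.
have gx : is_derive x 1 g (g' x) by exact: nbhs_singleton hg.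
apply: (is_derive_eq (is_deriveD (is_deriveM fx g'x) (is_deriveM gx f'x))).
rewrite /GRing.scale/=; ring.
Unshelve. all: by end_near. Qed.

Lemma jet2Z f k x a b : jet2 f x a b -> jet2 (fun t => k * f t) x (k * a) (k * b).
Proof.
move=> h; apply: (jet2_eq (jet2M (jet2_cst k x) h)); ring.
Qed.

Lemma jet2N f x a b : jet2 f x a b -> jet2 (fun t => - f t) x (- a) (- b).
Proof.
move=> /(jet2Z (-1)) h; rewrite !mulN1r in h.
by under eq_fun do rewrite -mulN1r.
Qed.

Lemma jet2B f g x a b c d : jet2 f x a b -> jet2 g x c d ->
  jet2 (fun t => f t - g t) x (a - c) (b - d).
Proof. by move=> hf hg; exact: (jet2D hf (jet2N hg)). Qed.

Lemma jet2_continuous f x a b : jet2 f x a b -> {for x, continuous f}.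
Proof.
move=> [f' [/nbhs_singleton hf _ _]].
by apply: differentiable_continuous; apply/derivable1_diffP; exact: ex_derive.
Qed.

Lemma jet2_comp h f x a b c d : jet2 f x a b -> jet2 h (f x) c d ->
  jet2 (fun t => h (f t)) x (c * a) (d * a ^+ 2 + c * b).
Proof.
move=> jf; have cf := jet2_continuous jf.
move: jf => [f' [hf <- f'x]] [h' [hh <- hh']].
exists (fun t => h' (f t) * f' t); split => //.
  near=> t.
  have ft : is_derive (t : R) 1 f (f' t) by near: t.
  have ht : is_derive (f t) 1 h (h' (f t)).
    by near: t; exact: (cf _ hh).
  exact: (is_derive1_comp ht ft).
have fx : is_derive x 1 f (f' x) by exact: nbhs_singleton hf.
have hx : is_derive x 1 (h' \o f) (d * f' x).
  exact: (is_derive1_comp hh' fx).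
apply: (is_derive_eq (is_deriveM hx f'x)).
rewrite /GRing.scale/=; ring.
Unshelve. all: by end_near. Qed.

(** If [b > 0], the first derivative, which vanishes at the maximum, is positive
just to the right of it, and the mean value theorem exceeds the maximum. *)
Lemma jet2_max f x a b : jet2 f x a b -> (\forall t \near x, f t <= f x) -> b <= 0.
Proof.
move=> [f' [hf fa f'x]] mx; rewrite leNgt; apply/negP => b0.
have [e /= e0 He] : \forall t \near x, is_derive (t : R) 1 f (f' t) /\ f t <= f x.
  by near=> t; split; near: t.
have dfx : is_derive x 1 f a by rewrite -fa; exact: (nbhs_singleton hf).
have a0 : a = 0.
  have : is_derive x 1 f 0.
    apply: (@derive1_at_max _ _ (x - e) (x + e)) => //.
    - lra.
    - move=> t; rewrite in_itv/= => /andP[t1 t2].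
      have [] := He t _; last by move=> [].
      by rewrite /ball_/= ltr_distlC; lra.
    - by rewrite in_itv/=; lra.
    - move=> t; rewrite in_itv/= => /andP[t1 t2].
      by have [] := He t _; rewrite /ball_/= ?ltr_distlC; lra.
  by move=> [_ d0]; case: dfx => _ <-.
have /is_derive1_caratheodory[h [hE hc hx]] := f'x.
have [d /= d0 Hd] : \forall t \near x, 0 < h t.
  by apply: (cvgr_gt (h x) hc); rewrite hx.
pose r := Num.min d e / 2.
have r0 : 0 < r by rewrite divr_gt0// lt_min d0 e0.
have [md me] : Num.min d e <= d /\ Num.min d e <= e.
  by rewrite !ge_min !lexx orbT.
have rd : r < d by rewrite /r; lra.
have re : r < e by rewrite /r; lra.
have [|t||c] := @MVT _ f f' x (x + r).
- by rewrite ltrDl.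
- rewrite in_itv/= => /andP[t1 t2]; have [] // := He t.
  by rewrite /ball_/= ltr_distlC; lra.
- apply: derivable_within_continuous => t; rewrite in_itv/= => /andP[t1 t2].
  have [] // := He t.
  by rewrite /ball_/= ltr_distlC; lra.
- rewrite in_itv/= => /andP[c1 c2] fE.
  have [] := He (x + r); first by rewrite /ball_/= ltr_distlC; lra.
  move=> _; rewrite leNgt => /negP; apply.
  rewrite -subr_gt0 fE addrAC subrr add0r mulr_gt0//.
  have := hE c; rewrite fa a0 subr0 => ->.
  rewrite mulr_gt0 ?subr_gt0//; apply: Hd.
  by rewrite /ball_/= ltr_distlC; lra.
Unshelve. all: by end_near. Qed.

End SecondDerivative.

Section PlaneJets.
Context {R : realType}.
Implicit Types (f g : plane R -> R) (X Y P : plane R).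

(** [a] and [c] are the partial derivatives and [l] is the Laplacian. Mixed
derivatives never occur, so two derivatives along each axis are enough. *)
Definition jet f X (a c l : R) := {for X, continuous f} /\
  exists b d, [/\ jet2 (fun t => f (t, X.2)) X.1 a b,
                  jet2 (fun t => f (X.1, t)) X.2 c d & l = b + d].

Lemma jet_eq f X a c l a' c' l' :
  jet f X a c l -> a = a' -> c = c' -> l = l' -> jet f X a' c' l'.
Proof. by move=> h <- <- <-. Qed.

Lemma jet_cst (k : R) X : jet (fun=> k) X 0 0 0.
Proof.
split; first exact: cst_continuous.
by exists 0, 0; split; [exact: jet2_cst|exact: jet2_cst|rewrite addr0].
Qed.

Lemma fst_cont X : {for X, continuous (@fst R R)}.
Proof. exact: cvg_fst. Qed.

Lemma snd_cont X : {for X, continuous (@snd R R)}.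
Proof. exact: cvg_snd. Qed.

Lemma jet_fst X : jet fst X 1 0 0.
Proof.
split; first exact: fst_cont.
by exists 0, 0; split; [exact: jet2_id|exact: jet2_cst|rewrite addr0].
Qed.

Lemma jet_snd X : jet snd X 0 1 0.
Proof.
split; first exact: snd_cont.
by exists 0, 0; split; [exact: jet2_cst|exact: jet2_id|rewrite addr0].
Qed.

Lemma jetD f g X a c l a' c' l' : jet f X a c l -> jet g X a' c' l' ->
  jet (fun Y => f Y + g Y) X (a + a') (c + c') (l + l').
Proof.
move=> [cf [b [d [f1 f2 ->]]]] [cg [b' [d' [g1 g2 ->]]]].
split; first exact: continuousD.
exists (b + b'), (d + d'); split; [exact: jet2D|exact: jet2D|].
by rewrite addrACA.
Qed.

Lemma jetM f g X a c l a' c' l' : jet f X a c l -> jet g X a' c' l' ->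
  jet (fun Y => f Y * g Y) X (f X * a' + g X * a) (f X * c' + g X * c)
    (f X * l' + g X * l + 2 * (a * a' + c * c')).
Proof.
case: X => x y.
move=> [cf [b [d [f1 f2 ->]]]] [cg [b' [d' [g1 g2 ->]]]].
split; first exact: continuousM.
do 2 eexists; split; [exact: jet2M f1 g1|exact: jet2M f2 g2|].
by rewrite /=; ring.
Qed.

Lemma jetZ f X a c l k : jet f X a c l ->
  jet (fun Y => k * f Y) X (k * a) (k * c) (k * l).
Proof. by move=> h; apply: (jet_eq (jetM (jet_cst k X) h)); ring. Qed.

Lemma jetN f X a c l : jet f X a c l -> jet (fun Y => - f Y) X (- a) (- c) (- l).
Proof.
move=> /(jetZ (-1)) h; rewrite !mulN1r in h.
by under eq_fun do rewrite -mulN1r.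
Qed.

Lemma jetB f g X a c l a' c' l' : jet f X a c l -> jet g X a' c' l' ->
  jet (fun Y => f Y - g Y) X (a - a') (c - c') (l - l').
Proof. by move=> hf hg; exact: jetD hf (jetN hg). Qed.

Lemma jet_comp h f X a c l p q : jet f X a c l -> jet2 h (f X) p q ->
  jet (fun Y => h (f Y)) X (p * a) (p * c) (q * (a ^+ 2 + c ^+ 2) + p * l).
Proof.
case: X => x y.
move=> [cf [b [d [f1 f2 ->]]]] jh.
split; first by apply: (continuous_comp cf); exact: jet2_continuous jh.
do 2 eexists; split; [exact: (jet2_comp f1 jh)|exact: (jet2_comp f2 jh)|].
by ring.
Qed.

Lemma continuous_pair (T : topologicalType) (f g : T -> R) (x : T) :
  {for x, continuous f} -> {for x, continuous g} ->
  {for x, continuous (fun t => (f t, g t))}.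
Proof.
move=> cf cg.
exact: (@cvg_pair _ _ _ (nbhs x) (nbhs (f x)) (nbhs (g x)) _ _ _ f g cf cg).
Qed.

Lemma near_slice1 X (P : plane R -> Prop) : (\forall Y \near X, P Y) ->
  \forall t \near X.1, P (t, X.2).
Proof.
case: X => x y /= h.
have c : {for x, continuous (fun t : R => (t, y))}.
  by apply: continuous_pair; [exact: cvg_id|exact: cvg_cst].
exact: c h.
Qed.

Lemma near_slice2 X (P : plane R -> Prop) : (\forall Y \near X, P Y) ->
  \forall t \near X.2, P (X.1, t).
Proof.
case: X => x y /= h.
have c : {for y, continuous (fun t : R => (x, t))}.
  by apply: continuous_pair; [exact: cvg_cst|exact: cvg_id].
exact: c h.
Qed.

Lemma jet2_reflect (f : R -> R) m x a b : jet2 f (m - x) a b ->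
  jet2 (fun t => f (m - t)) x (- a) b.
Proof.
move=> h.
have h1 : jet2 (fun t : R => m - t) x (-1) 0.
  by apply: jet2_eq; [exact: jet2B (jet2_cst m x) (jet2_id x)| |]; ring.
by apply: (jet2_eq (jet2_comp h1 h)); ring.
Qed.

Lemma jet_reflect2 f m X a c l : jet f (X.1, m - X.2) a c l ->
  jet (fun Y => f (Y.1, m - Y.2)) X a (- c) l.
Proof.
case: X => x y [cf [b [d /= [f1 f2 ->]]]]; split.
  apply: (@continuous_comp _ _ _ (fun Y : plane R => (Y.1, m - Y.2)) f) => //.
  apply: continuous_pair; first exact: fst_cont.
  exact: (jetB (jet_cst m _) (jet_snd _)).1.
exists b, d; split => //=; exact: (jet2_reflect f2).
Qed.

Definition sqd P X : R := (X.1 - P.1) ^+ 2 + (X.2 - P.2) ^+ 2.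

Lemma jet_fstB (p : R) X : jet (fun Y => Y.1 - p) X 1 0 0.
Proof. by apply: (jet_eq (jetB (jet_fst X) (jet_cst p X))); ring. Qed.

Lemma jet_sndB (p : R) X : jet (fun Y => Y.2 - p) X 0 1 0.
Proof. by apply: (jet_eq (jetB (jet_snd X) (jet_cst p X))); ring. Qed.

Lemma jet_sqd P X : jet (sqd P) X (2 * (X.1 - P.1)) (2 * (X.2 - P.2)) 4.
Proof.
have h1 := jet_fstB P.1 X; have h2 := jet_sndB P.2 X.
by apply: (jet_eq (jetD (jetM h1 h1) (jetM h2 h2))); rewrite /=; ring.
Qed.

(** Radial functions are written as functions of the squared distance, which is
polynomial; their Laplacian at [s = |X - P|^2] is [4 (s h'' + h')]. *)
Lemma jet_radial h P X p q : jet2 h (sqd P X) p q ->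
  jet (fun Y => h (sqd P Y)) X (p * (2 * (X.1 - P.1))) (p * (2 * (X.2 - P.2)))
     (4 * (q * sqd P X + p)).
Proof. by move=> jh; apply: (jet_eq (jet_comp (jet_sqd P X) jh)) => //; rewrite /sqd; ring. Qed.

Lemma jet2_expR (x : R) : jet2 expR x (expR x) (expR x).
Proof.
exists expR; split => //; last exact: is_derive_expR.
by apply: filterE => t; exact: is_derive_expR.
Qed.

Lemma jet2_inv (x : R) : x != 0 -> jet2 (fun t => t^-1) x (- x ^- 2) (2 * x ^- 3).
Proof.
move=> x0; exists (fun t => - t ^- 2); split => //.
  near=> t.
  have t0 : t != 0 by near: t; exact: (cvgr_neq0 x cvg_id x0).
  have := @is_deriveV R id t 1 1 t0 (is_derive_id _ _).
  by move/is_derive_eq; apply; rewrite /GRing.scale/= mulr1.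
have h1 : is_derive x 1 (fun t : R => t ^+ 2) (2 * x).
  apply: is_derive_eq.
  by rewrite /GRing.scale/=; ring.
have x20 : x ^+ 2 != 0 by rewrite expf_neq0.
apply: (is_derive_eq (is_deriveN (@is_deriveV R (fun t => t ^+ 2) x _ 1 x20 h1))).
by rewrite /GRing.scale/=; field.
Unshelve. all: by end_near. Qed.

Lemma jet2_ln (x : R) : 0 < x -> jet2 (@ln R) x x^-1 (- x ^- 2).
Proof.
move=> x0; exists (fun t => t^-1); split => //.
  have h : \forall t \near x, 0 < t.
  exact: (cvgr_gt x cvg_id).
  near=> t; apply: is_derive1_ln.
  by near: t.
have x0' : x != 0 by rewrite gt_eqF.
have := @is_deriveV R id x 1 1 x0' (is_derive_id _ _).
by move/is_derive_eq; apply; rewrite /GRing.scale/= mulr1.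
Unshelve. all: by end_near. Qed.

End PlaneJets.

(** * The maximum principle *)

Section MaximumPrinciple.
Context {R : realType}.
Implicit Types (f g w : plane R -> R) (X Y P : plane R) (U : set (plane R)).

Lemma jet_local_max w X a c l : jet w X a c l ->
  (\forall Y \near X, w Y <= w X) -> l <= 0.
Proof.
case: X => x y [_ [b [d [j1 j2 ->]]]] mx.
have := jet2_max j1 (near_slice1 mx); have := jet2_max j2 (near_slice2 mx); lra.
Qed.

Definition subharmonic_on U w := forall X, U X ->
  exists a c l, jet w X a c l /\ 0 <= l.

Definition harmonic_on U w := forall X, U X -> exists a c, jet w X a c 0.

Lemma sqd_ge0 P X : 0 <= sqd P X.
Proof. by rewrite addr_ge0// sqr_ge0. Qed.

(** The perturbation [w + de |X|^2] has positive Laplacian, hence no interior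
maximum. As [w] has no values on the boundary, the perturbation is truncated
below at a level above the boundary bound: the truncation extends continuously
to the plane and attains its maximum on a compact square. *)
Lemma max_principle U w (m rho : R) : open U ->
  (forall X, U X -> sqd (0, 0) X <= rho) ->
  subharmonic_on U w ->
  (forall Z, ~ U Z -> forall e, 0 < e -> \forall Y \near Z, U Y -> w Y <= m + e) ->
  forall X, U X -> w X <= m.
Proof.
move=> oU bU sw bw X0 UX0; rewrite leNgt; apply/negP => mX0.
have rho0 : 0 <= rho by apply: le_trans (bU _ UX0); exact: sqd_ge0.
pose e := (w X0 - m) / 4; have e0 : 0 < e by rewrite divr_gt0// subr_gt0.
pose de := e / (rho + 1).
have de0 : 0 < de by rewrite divr_gt0//; lra.
have der : de * rho <= e.
  by rewrite /de mulrAC ler_pdivrMr; [rewrite ler_pM2l//; lra|lra].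
pose w' Y := w Y + de * sqd (0, 0) Y.
have ww' Y : U Y -> w Y <= w' Y <= w Y + e.
  move=> UY; have := sqd_ge0 (0, 0) Y; have := bU _ UY => h1 h2.
  rewrite /w' lerDl mulr_ge0 ?(ltW de0)//= lerD2l (le_trans _ der)//.
  by rewrite ler_pM2l.
(* on the boundary [w' <= m + 2 e], and [w' X0 >= m + 4 e] *)
pose M := m + 2 * e.
pose f Y := if `[<U Y>] then Num.max (w' Y) M else M.
have cf : continuous f.
  move=> Y; have [UY|nUY] := pselect (U Y).
    have [a [c [l [jw _]]]] := sw _ UY.
    have cw' : {for Y, continuous w'}.
      by case: (jetD jw (jetZ de (jet_sqd (0, 0) Y))).
    have near_f : \forall Z \near Y, Num.max (w' Z) M = f Z.
      near=> Z; rewrite /f asboolT//; near: Z.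
      exact: open_nbhs_nbhs.
    rewrite /continuous_at -(nbhs_singleton near_f).
    apply: cvg_trans (near_eq_cvg near_f) _.
    by apply: (@continuous_max _ _ w' (fun=> M) Y) => //; exact: cst_continuous.
  have near_f : \forall Z \near Y, M = f Z.
    have := bw _ nUY e e0; apply: filterS => Z h.
    rewrite /f; case: asboolP => // UZ.
    have := h UZ; have /andP[_] := ww' _ UZ => h1 h2.
    by apply/esym/max_idPr; rewrite /M; lra.
  rewrite /continuous_at -(nbhs_singleton near_f).
  by apply: cvg_trans (near_eq_cvg near_f) _; exact: cvg_cst.
pose s := rho + 1.
pose K : set (plane R) := `[- s, s] `*` `[- s, s].
have UK Y : U Y -> K Y.
  case: Y => y1 y2 /bU; rewrite /sqd/= !subr0 => h.
  rewrite /K/=; rewrite !in_itv/=; suff : forall a : R, a ^+ 2 <= rho -> - s <= a <= s.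
    move=> H; split; apply: H; apply: le_trans h.
      by rewrite lerDl sqr_ge0.
    by rewrite lerDr sqr_ge0.
  by move=> a h2; rewrite /s; nra.
have cK : compact K by apply: compact_setX; exact: segment_compact.
have [||Xm] := @compact_EVT_max _ R f K _ cK; first by exists X0; exact: UK.
  exact: continuous_subspaceT.
rewrite inE => KXm Hm.
have fX0 : M < f X0.
  rewrite /f asboolT// lt_max; apply/orP; left.
  have /andP[h _] := ww' _ UX0; apply: lt_le_trans h; rewrite /M /e; lra.
have fXm := Hm _ (mem_set (UK _ UX0)).
have [UXm fE] : U Xm /\ f Xm = w' Xm.
  move: (lt_le_trans fX0 fXm); rewrite /f; case: asboolP => [UXm|_]; last by rewrite ltxx.
  by rewrite lt_max ltxx orbF => h; split=> //; apply/max_idPl/ltW.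
have [a [c [l [jw l0]]]] := sw _ UXm.
have := jet_local_max (jetD jw (jetZ de (jet_sqd (0, 0) Xm))).
have -> : (l + de * 4 <= 0) = false by apply/negbTE; rewrite -ltNge; lra.
suff H : \forall Y \near Xm, w' Y <= w' Xm by move=> /(_ H).
have : \forall Y \near Xm, U Y by exact: open_nbhs_nbhs.
apply: filterS => Y UY; rewrite -fE.
apply: le_trans (Hm _ (mem_set (UK _ UY))).
by rewrite /f asboolT// le_max lexx.
Unshelve. all: by end_near. Qed.

End MaximumPrinciple.

(** * Growth at a flat boundary and interior gradient estimates *)

Section Barriers.
Context {R : realType}.
Implicit Types (f g w : plane R -> R) (X Y P Q Z : plane R) (U : set (plane R)).

Lemma near_lt f Z (k : R) : {for Z, continuous f} -> f Z < k ->
  \forall Y \near Z, f Y < k.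
Proof. by move=> cf fk; exact: (cvgr_lt (f Z) cf). Qed.

Lemma near_gt f Z (k : R) : {for Z, continuous f} -> k < f Z ->
  \forall Y \near Z, k < f Y.
Proof. by move=> cf fk; exact: (cvgr_gt (f Z) cf). Qed.

(** The height of [Y] above the line through [Q] with normal [n]. *)
Definition tilt (n : plane R) Q Y : R := n.1 * (Y.1 - Q.1) + n.2 * (Y.2 - Q.2).

Lemma jet_tilt n Q X : jet (tilt n Q) X n.1 n.2 0.
Proof.
by apply: (jet_eq (jetD (jetZ n.1 (jet_fstB Q.1 X)) (jetZ n.2 (jet_sndB Q.2 X)))); ring.
Qed.

Definition half_disk (n : plane R) (r : R) Q : set (plane R) :=
  [set Y | sqd Q Y < r ^+ 2 /\ 0 < tilt n Q Y].

Lemma sqd_cont P X : {for X, continuous (sqd P)}.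
Proof. by case: (jet_sqd P X). Qed.

Lemma tilt_cont n P X : {for X, continuous (tilt n P)}.
Proof. by case: (jet_tilt n P X). Qed.

Lemma openP (U : set (plane R)) : (forall X, U X -> \forall Y \near X, U Y) -> open U.
Proof. by rewrite openE. Qed.

Lemma open_half_disk n r Q : open (half_disk n r Q).
Proof.
apply: openP => X [h1 h2].
by near=> Y; split; near: Y; [exact: near_lt (@sqd_cont _ _) _|exact: near_gt (@tilt_cont _ _ _) _].
Unshelve. all: by end_near. Qed.

Lemma sqd_origin_le Q Y (r2 : R) : sqd Q Y <= r2 ->
  sqd (0, 0) Y <= 2 * (r2 + sqd (0, 0) Q).
Proof.
rewrite /sqd/= !subr0; case: Q => q1 q2; case: Y => y1 y2 /=.
have := sqr_ge0 (y1 - 2 * q1); have := sqr_ge0 (y2 - 2 * q2); nra.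
Qed.

(** With [t] the height, the barrier [M / r^2 (|Y - Q|^2 - 3 t^2 + 3 r t)] is
superharmonic because its Laplacian is [(4 - 6) M / r^2], nonnegative on the flat
side, and at least [M] on the arc because [3 t (r - t) >= 0] there. *)
Lemma boundary_growth n r Q f (M : R) : n.1 ^+ 2 + n.2 ^+ 2 = 1 -> 0 < r ->
  0 <= M ->
  harmonic_on (half_disk n r Q) f ->
  (forall Y, half_disk n r Q Y -> f Y <= M) ->
  (forall Z, sqd Q Z < r ^+ 2 -> tilt n Q Z = 0 -> forall e, 0 < e ->
     \forall Y \near Z, half_disk n r Q Y -> f Y <= e) ->
  forall s, 0 < s < r -> f (Q.1 + s * n.1, Q.2 + s * n.2) <= 3 * M * s / r.
Proof.
move=> n1 r0 M0 hf fM fz s /andP[s0 sr].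
pose b Y := M / r ^+ 2 * (sqd Q Y - 3 * tilt n Q Y * tilt n Q Y + 3 * r * tilt n Q Y).
have jb X : exists a c, jet b X a c (M / r ^+ 2 * (-2)).
  have jt := jet_tilt n Q X.
  do 2 eexists; apply: (jet_eq (jetZ (M / r ^+ 2)
    (jetD (jetB (jet_sqd Q X) (jetM (jetZ 3 jt) jt)) (jetZ (3 * r) jt)))) => //.
  congr (_ * _); transitivity (4 - 6 * (n.1 ^+ 2 + n.2 ^+ 2)); first by ring.
  by rewrite n1; ring.
have cb X : {for X, continuous b} by have [a [c []]] := jb X.
have r2 : 0 < r ^+ 2 by rewrite exprn_gt0.
have Mr0 : 0 <= M / r ^+ 2 by rewrite divr_ge0// ltW.
have CS Z : tilt n Q Z ^+ 2 <= sqd Q Z.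
  rewrite /tilt /sqd; have := sqr_ge0 (n.1 * (Z.2 - Q.2) - n.2 * (Z.1 - Q.1)).
  move=> h; rewrite -subr_ge0; apply: le_trans h _.
  rewrite le_eqVlt; apply/orP; left; apply/eqP.
  rewrite -[in RHS](mul1r (_ + _)) -[in RHS]n1; ring.
have : f (Q.1 + s * n.1, Q.2 + s * n.2) - b (Q.1 + s * n.1, Q.2 + s * n.2) <= 0.
  apply: (@max_principle _ (half_disk n r Q) (fun Y => f Y - b Y) 0
    (2 * (r ^+ 2 + sqd (0, 0) Q))).
  - exact: open_half_disk.
  - by move=> X [h _]; apply: sqd_origin_le; exact: ltW.
  - move=> X hX; have [a [c jf]] := hf _ hX; have [a' [c' jb']] := jb X.
    do 3 eexists; split; first exact: jetB jf jb'.
    by rewrite sub0r mulrN opprK mulr_ge0.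
  - move=> Z nZ e e0; rewrite add0r.
    have cbe : \forall Y \near Z, b Z - e / 2 < b Y.
      by apply: (near_gt (cb Z)); lra.
    have [tZ|tZ|tZ] := ltgtP (tilt n Q Z) 0.
    + have := near_lt (@tilt_cont n Q Z) tZ; apply: filterS => Y h [_ h'].
      by move: (lt_trans h h'); rewrite ltxx.
    + have [h|h] := ltP (sqd Q Z) (r ^+ 2); first by exfalso; exact: nZ.
      have [h'|h'] := ltP (r ^+ 2) (sqd Q Z).
        have := near_gt (@sqd_cont Q Z) h'; apply: filterS => Y k [k' _].
        by move: (lt_trans k k'); rewrite ltxx.
      have {h h'} hZ : sqd Q Z = r ^+ 2 by apply/le_anti; rewrite h h'.
      have bZ : M <= b Z.
        have := CS Z; rewrite hZ => h2.
        have tr : tilt n Q Z <= r by rewrite -(ler_pXn2r (n:=2))// nnegrE ltW.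
        rewrite /b hZ -[leLHS](@mulfVK _ (r ^+ 2) _ M) ?gt_eqF// ler_wpM2l//.
        by have : 0 <= 3 * tilt n Q Z * (r - tilt n Q Z); [rewrite !mulr_ge0 ?subr_ge0// ltW|lra].
      by apply: filterS cbe => Y h hY; have := fM _ hY; lra.
    + have [h|h] := ltP (sqd Q Z) (r ^+ 2); last first.
        have bZ : M <= b Z.
          rewrite /b tZ !mulr0 subr0 addr0 -[leLHS](@mulfVK _ (r ^+ 2) _ M) ?gt_eqF//.
          by rewrite ler_wpM2l.
        by apply: filterS cbe => Y k hY; have := fM _ hY; lra.
      have bZ : 0 <= b Z.
        by rewrite /b tZ !mulr0 subr0 addr0 mulr_ge0// sqd_ge0.
      have e20 : 0 < e / 2 by rewrite divr_gt0.
      have := fz Z h tZ (e / 2) e20.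
      by apply: filterS2 cbe => Y k1 k2 hY; have := k2 hY; lra.
  - split; rewrite /sqd /tilt /=.
      rewrite [ltLHS](_ : _ = s ^+ 2 * (n.1 ^+ 2 + n.2 ^+ 2)); last by ring.
      by rewrite n1 mulr1 ltr_pXn2r// nnegrE ltW// (lt_trans s0).
    rewrite [ltRHS](_ : _ = s * (n.1 ^+ 2 + n.2 ^+ 2)); last by ring.
    by rewrite n1 mulr1.
rewrite subr_le0 => /le_trans; apply.
rewrite /b /sqd /tilt/=.
rewrite [X in _ * X](_ : _ = s ^+ 2 * (n.1 ^+ 2 + n.2 ^+ 2) -
  3 * s ^+ 2 * (n.1 ^+ 2 + n.2 ^+ 2) ^+ 2 + 3 * r * s * (n.1 ^+ 2 + n.2 ^+ 2)); last by ring.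
rewrite n1 [leRHS](_ : _ = M / r ^+ 2 * (3 * r * s)); last by field; rewrite gt_eqF.
by rewrite ler_wpM2l//; have := sqr_ge0 s; lra.
Unshelve. all: by end_near. Qed.

Lemma is_derive_le0 (h : R -> R) (d r : R) : 0 < r -> is_derive (0 : R) 1 h d ->
  (forall s, 0 < s < r -> h s <= h 0) -> d <= 0.
Proof.
move=> r0 /is_derive1_caratheodory[g [gE cg <-]] hs; rewrite leNgt; apply/negP => g0.
have [e /= e0 He] : \forall t \near (0 : R), 0 < g t by exact: (cvgr_gt _ cg).
pose s := Num.min e r / 2.
have [me mr] : Num.min e r <= e /\ Num.min e r <= r.
  by rewrite !ge_min !lexx orbT.
have m0 : 0 < Num.min e r by rewrite lt_min e0.
have s0 : 0 < s by rewrite /s; lra.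
have gs : 0 < g s.
  by apply: He => /=; rewrite sub0r normrN gtr0_norm// /s; lra.
have := gE s; rewrite subr0 => hE.
have : 0 < g s * s by rewrite mulr_gt0.
have : h s <= h 0 by apply: hs; rewrite s0/=; rewrite /s; lra.
lra.
Qed.

Lemma symmetric_diff_deriv (h : R -> R) (x a r K : R) : 0 < r -> is_derive x 1 h a ->
  (forall s, 0 < s < r -> h (x + s) - h (x - s) <= 2 * K * s) -> a <= K.
Proof.
move=> r0 dh hs.
have d1 : is_derive (0 : R) 1 (fun s : R => x + s) 1.
  have := is_deriveD (is_derive_cst x (0 : R) (1 : R)) (is_derive_id (0 : R) (1 : R)).
  by move/is_derive_eq; apply; rewrite add0r.
have d2 : is_derive (0 : R) 1 (fun s : R => x - s) (-1).
  have := is_deriveB (is_derive_cst x (0 : R) (1 : R)) (is_derive_id (0 : R) (1 : R)).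
  by move/is_derive_eq; apply; rewrite sub0r.
have dh' : is_derive (x - 0) 1 h a by rewrite subr0.
have {}dh : is_derive (x + 0) 1 h a by rewrite addr0.
have h1 := @is_derive1_comp R h (fun s => x + s) 0 a 1 dh d1.
have h2 := @is_derive1_comp R h (fun s => x - s) 0 a (-1) dh' d2.
have h3 : is_derive (0 : R) 1 (fun s : R => 2 * K * s) (2 * K).
  have := @is_deriveZ _ _ _ id (2 * K) (0 : R) 1 1 (is_derive_id _ _).
  by move/is_derive_eq; apply; rewrite /GRing.scale/= mulr1.
have := is_derive_le0 r0 (is_deriveB (is_deriveB h1 h2) h3).
have H : (forall s : R, 0 < s < r ->
 ((h \o (fun s0 => x + s0)) - (h \o (fun s0 => x - s0)) - (fun s0 => 2 * K * s0)) s <=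
 ((h \o (fun s0 => x + s0)) - (h \o (fun s0 => x - s0)) - (fun s0 => 2 * K * s0)) 0).
  move=> s /hs; rewrite !fctE /= addr0 subr0 subrr mulr0 subr0; lra.
by move=> /(_ H); lra.
Qed.

Lemma jet2_deriv (h : R -> R) (x a b : R) : jet2 h x a b -> is_derive x 1 h a.
Proof. by move=> [h' [hh <- _]]; exact: (nbhs_singleton hh). Qed.

Lemma harmonicN U f : harmonic_on U f -> harmonic_on U (fun Y => - f Y).
Proof.
move=> hf X /hf[a [c j]]; exists (- a), (- c).
by apply: (jet_eq (jetN j)); rewrite ?oppr0.
Qed.

Lemma harmonicB U f g : harmonic_on U f -> harmonic_on U g ->
  harmonic_on U (fun Y => f Y - g Y).
Proof.
move=> hf hg X UX; have [a [c j]] := hf _ UX; have [a' [c' j']] := hg _ UX.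
by do 2 eexists; apply: (jet_eq (jetB j j')) => //; rewrite subr0.
Qed.

Definition rdisk (r : R) P : set (plane R) := [set Y | sqd P Y < r ^+ 2].

(** The difference of [f] and of its reflection in the horizontal line through [X]
vanishes on that line; its growth away from the line bounds the symmetric
differences of [f] at [X]. *)
Lemma gradient_le2 f X r M a c l : 0 < r -> jet f X a c l ->
  harmonic_on (rdisk r X) f -> (forall Y, rdisk r X Y -> `|f Y| <= M) ->
  c <= 3 * M / r.
Proof.
case: X => x y r0 [_ [b [d [_ /= /jet2_deriv j2 _]]]] hf fM.
have M0 : 0 <= M.
  apply: le_trans (fM (x, y) _); first exact: normr_ge0.
  by rewrite /rdisk /sqd/= !subrr expr0n/= addr0 exprn_gt0.
apply: (symmetric_diff_deriv r0 j2) => s s0r.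
(* twice the part of [f] that is odd across the line *)
pose g Y := f Y - f (Y.1, 2 * y - Y.2).
have rf Y : rdisk r (x, y) Y -> rdisk r (x, y) (Y.1, 2 * y - Y.2).
  rewrite /rdisk /sqd/=; suff -> : (2 * y - Y.2 - y) ^+ 2 = (Y.2 - y) ^+ 2 by [].
  by ring.
have hg : harmonic_on (rdisk r (x, y)) g.
  apply: harmonicB => // X /rf /hf [a' [c' j]].
  by do 2 eexists; exact: jet_reflect2 j.
have := @boundary_growth (0, 1) r (x, y) g (2 * M).
rewrite /= => B.
have E : y - s = 2 * y - (y + s) by ring.
rewrite E -[leLHS]/(g (x, y + s)).
rewrite [leRHS](_ : _ = 3 * (2 * M) * s / r); last by field; rewrite gt_eqF.
have -> : (x, y + s) = (x + s * 0, y + s * 1) by rewrite mulr0 addr0 mulr1.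
apply: B => //.
- by ring.
- lra.
- by move=> X [hX _]; exact: hg.
- move=> Y [hY _]; have := fM _ hY; have := fM _ (rf _ hY).
  rewrite !ler_norml /g => /andP[h1 h2] /andP[h3 h4]; lra.
- move=> Z hZ; rewrite /tilt/= mul0r add0r mul1r => /eqP; rewrite subr_eq0 => /eqP Zy e e0.
  have [a' [c' [cg _]]] := hg Z hZ.
  have gZ : g Z < e.
    rewrite /g [X in f X - _]surjective_pairing -Zy.
    suff -> : 2 * Z.2 - Z.2 = Z.2 by rewrite subrr.
    by ring.
  by have := near_lt cg gZ; apply: filterS => Y /ltW.
Qed.

Lemma jet_swap f X a c l : jet f (X.2, X.1) a c l ->
  jet (fun Y => f (Y.2, Y.1)) X c a l.
Proof.
case: X => x y [cf [b [d /= [f1 f2 ->]]]]; split.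
  apply: (@continuous_comp _ _ _ (fun Y : plane R => (Y.2, Y.1)) f) => //.
  by apply: continuous_pair; [exact: snd_cont|exact: fst_cont].
by exists d, b; split => //=; rewrite addrC.
Qed.

Lemma sqd_swap P Y : sqd P (Y.2, Y.1) = sqd (P.2, P.1) Y.
Proof. by rewrite /sqd/= addrC. Qed.

Lemma gradient_le1 f X r M a c l : 0 < r -> jet f X a c l ->
  harmonic_on (rdisk r X) f -> (forall Y, rdisk r X Y -> `|f Y| <= M) ->
  a <= 3 * M / r.
Proof.
case: X => x y r0 jf hf fM.
have jf' : jet (fun Y => f (Y.2, Y.1)) (y, x) c a l by exact: jet_swap.
apply: (gradient_le2 r0 jf').
  move=> X; rewrite /rdisk/= => hX.
  have /hf [a' [c' j]] : rdisk r (x, y) (X.2, X.1).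
    by rewrite /rdisk/= sqd_swap.
  by do 2 eexists; exact: jet_swap j.
by move=> Y hY; apply: fM; rewrite /rdisk/= sqd_swap.
Qed.

Lemma gradient_bound f X r M a c l : 0 < r -> jet f X a c l ->
  harmonic_on (rdisk r X) f -> (forall Y, rdisk r X Y -> `|f Y| <= M) ->
  `|a| <= 3 * M / r /\ `|c| <= 3 * M / r.
Proof.
move=> r0 jf hf fM.
have fMN Y : rdisk r X Y -> `|- f Y| <= M by rewrite normrN; exact: fM.
split; rewrite ler_norml lerNl; apply/andP; split.
- exact: (gradient_le1 r0 (jetN jf) (harmonicN hf) fMN).
- exact: (gradient_le1 r0 jf hf fM).
- exact: (gradient_le2 r0 (jetN jf) (harmonicN hf) fMN).
- exact: (gradient_le2 r0 jf hf fM).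
Qed.

End Barriers.

(** * Hopf's lemma and propagation of positivity *)

Section StrongMaximum.
Context {R : realType}.
Implicit Types (f g w : plane R -> R) (X Y P Q Z : plane R) (U : set (plane R)).

Lemma near_rdisk P (A : set (plane R)) : (\forall Y \near P, A Y) ->
  exists2 r, 0 < r & rdisk r P `<=` A.
Proof.
case: P => p1 p2 [[A1 A2] /= [[e1 /= e10 H1] [e2 /= e20 H2]] H].
exists (Num.min e1 e2) => [|[y1 y2]]; first by rewrite lt_min e10.
have me1 : Num.min e1 e2 <= e1 by rewrite ge_min lexx.
have me2 : Num.min e1 e2 <= e2 by rewrite ge_min lexx orbT.
have m0 : 0 < Num.min e1 e2 by rewrite lt_min e10.
rewrite /rdisk/= /sqd/= => h; apply: H; split => /=.
  apply: H1 => /=; rewrite distrC; apply: lt_le_trans me1.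
  rewrite -(ltr_pXn2r (n:=2))// ?nnegrE ?normr_ge0 ?(ltW m0)//.
  by rewrite real_normK ?num_real//; apply: le_lt_trans h; rewrite lerDl sqr_ge0.
apply: H2 => /=; rewrite distrC; apply: lt_le_trans me2.
rewrite -(ltr_pXn2r (n:=2))// ?nnegrE ?normr_ge0 ?(ltW m0)//.
by rewrite real_normK ?num_real//; apply: le_lt_trans h; rewrite lerDr sqr_ge0.
Qed.

Lemma rdisk_center r P : 0 < r -> rdisk r P P.
Proof. by move=> r0; rewrite /rdisk/= /sqd !subrr expr0n/= addr0 exprn_gt0. Qed.

Lemma open_rdisk r P : open (rdisk r P).
Proof. by apply: openP => X h; exact: near_lt (@sqd_cont _ _ _) h. Qed.

Lemma near_in_rdisk r P X : rdisk r P X -> \forall Y \near X, rdisk r P Y.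
Proof. by move=> h; apply: open_nbhs_nbhs; split => //; exact: open_rdisk. Qed.

(** The function [exp (- a |Y - P|^2) - exp (- a rho^2)] vanishes on the circle and
is subharmonic where [a |Y - P|^2 >= 1]. A multiple of it stays below [f] on a
small disk around [P] by continuity, hence on the remaining annulus by the
maximum principle, and it is bounded below by convexity of the exponential. *)
Lemma hopf_ball f P (rho : R) : 0 < rho -> harmonic_on (rdisk rho P) f ->
  (forall X, rdisk rho P X -> 0 <= f X) -> 0 < f P ->
  exists2 c, 0 < c & forall X, rdisk rho P X -> c * (rho ^+ 2 - sqd P X) <= f X.
Proof.
move=> rho0 hf f0 fP; pose m := f P / 2.
have m0 : 0 < m by rewrite divr_gt0.
have mP : m < f P by rewrite /m; lra.
have [|d d0 Hd] := @near_rdisk P (fun Y => m < f Y /\ rdisk rho P Y).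
  near=> Y; split; near: Y; last first.
    exact: near_in_rdisk (rdisk_center P rho0).
  have [a [c [cf _]]] := hf _ (rdisk_center P rho0).
  exact: near_gt cf mP.
pose d2 := d ^+ 2 / 2.
have d20 : 0 < d2 by rewrite divr_gt0// exprn_gt0.
have d2d : d2 < d ^+ 2 by rewrite /d2; have : 0 < d ^+ 2 by [rewrite exprn_gt0|]; lra.
(* outside the small disk, [a |Y - P|^2 >= 1], which makes the barrier subharmonic *)
pose a := d2^-1.
have a0 : 0 < a by rewrite invr_gt0.
pose b q := expR (- a * q) - expR (- a * rho ^+ 2).
have jb (q : R) : jet2 b q (expR (- a * q) * - a) (expR (- a * q) * a ^+ 2).
  have := jet2_comp (jet2Z (- a) (jet2_id q)) (jet2_expR _) => h.
  by apply: (jet2_eq (jet2B h (jet2_cst (expR (- a * rho ^+ 2)) q))); ring.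
have cb (q : R) : {for q, continuous b} by exact: jet2_continuous (jb q).
have b1 q : 0 <= q -> b q <= 1.
  move=> q0; rewrite /b; have := expR_ge0 (- a * rho ^+ 2).
  have : expR (- a * q) <= 1 by rewrite -expR0 ler_expR mulNr oppr_le0 mulr_ge0// ltW.
  lra.
have bb q : a * expR (- a * rho ^+ 2) * (rho ^+ 2 - q) <= b q.
  rewrite /b.
  have -> : expR (- a * q) = expR (- a * rho ^+ 2) * expR (a * (rho ^+ 2 - q)).
    by rewrite -expRD; congr expR; ring.
  have := expR_ge1Dx (a * (rho ^+ 2 - q)).
  have := expR_gt0 (- a * rho ^+ 2); set E := expR (- a * _); set F := expR _.
  by move=> E0 h; have := ler_wpM2l (ltW E0) h; lra.
exists (m * (a * expR (- a * rho ^+ 2))).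
  by rewrite !mulr_gt0// expR_gt0.
move=> X hX.
apply: (@le_trans _ _ (m * b (sqd P X))); first by rewrite -mulrA ler_pM2l.
have [h|h] := leP (sqd P X) d2.
  apply: (@le_trans _ _ m).
    by rewrite -[leRHS]mulr1 ler_pM2l// b1// sqd_ge0.
  apply/ltW; have [] // := Hd X.
  by rewrite /rdisk/=; apply: le_lt_trans d2d.
pose U := [set Y | d2 < sqd P Y /\ rdisk rho P Y].
rewrite -subr_le0.
apply: (@max_principle _ U (fun Y => m * b (sqd P Y) - f Y) 0
  (2 * (rho ^+ 2 + sqd (0, 0) P))) => //.
- apply: openP => Y [h1 h2]; near=> Z; split; near: Z; first exact: near_gt (@sqd_cont _ _ _) _.
  exact: near_in_rdisk.
- by move=> Y [_ h2]; apply: sqd_origin_le; exact: ltW.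
- move=> Y [h1 h2]; have [ax [ay jf]] := hf _ h2.
  do 3 eexists; split; first exact: jetB (jetZ m (jet_radial (jb (sqd P Y)))) jf.
  rewrite subr0 mulr_ge0 ?(ltW m0)// mulr_ge0//.
  rewrite (_ : _ + _ = expR (- a * sqd P Y) * (a * (a * sqd P Y - 1))); last by ring.
  rewrite mulr_ge0 ?expR_ge0// mulr_ge0 ?(ltW a0)// subr_ge0 /a mulrC.
  by rewrite ler_pdivlMr// mul1r ltW.
- move=> Z nZ e e0; rewrite add0r.
  have cbs : {for Z, continuous (fun Y => m * b (sqd P Y))}.
    by case: (jetZ m (jet_radial (jb (sqd P Z)))).
  have [k|k] := ltP (sqd P Z) d2.
    by have := near_lt (@sqd_cont _ P Z) k; apply: filterS => Y k1 [k2]; lra.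
  have [k'|k'] := ltP (sqd P Z) (rho ^+ 2).
    have Zd : rdisk d P Z.
      move: k nZ; rewrite le_eqVlt => /orP[/eqP k _|k nZ]; first by rewrite /rdisk/= -k.
      by exfalso; apply: nZ.
    have [mfZ rZ] := Hd _ Zd.
    have [ax [ay jf]] := hf _ rZ.
    have [cw _] := jetB (jetZ m (jet_radial (jb (sqd P Z)))) jf.
    have wZ : m * b (sqd P Z) - f Z < e.
      have := b1 _ (sqd_ge0 P Z); rewrite -(ler_pM2l m0) mulr1; lra.
    by have := near_lt cw wZ; apply: filterS => Y /ltW.
  have [k''|k''] := ltP (rho ^+ 2) (sqd P Z).
    have := near_gt (@sqd_cont _ P Z) k''; apply: filterS => Y k1 [_].
    by rewrite /rdisk/= => k2; lra.
  have sZ : sqd P Z = rho ^+ 2 by apply/le_anti; rewrite k' k''.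
  have wZ : m * b (sqd P Z) < e by rewrite sZ /b subrr mulr0.
  have := near_lt cbs wZ; apply: filterS => Y k1 [_ k2].
  by have := f0 _ k2; lra.
Unshelve. all: by end_near. Qed.

(** By [hopf_ball], positivity at the centre of a disk extends to the whole disk,
in particular to the next centre. *)
Lemma positive_chain U f (rho : R) (p : nat -> plane R) n : 0 < rho ->
  harmonic_on U f -> (forall X, U X -> 0 <= f X) ->
  (forall i, (i <= n)%N -> rdisk rho (p i) `<=` U) ->
  (forall i, (i < n)%N -> rdisk rho (p i) (p i.+1)) ->
  0 < f (p 0%N) -> 0 < f (p n).
Proof.
move=> rho0 hf f0; elim: n => [//|n IH] pU pp fp.
have fpn : 0 < f (p n).
  by apply: IH => // i ni; [apply: pU; exact: leqW|apply: pp; exact: ltnW].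
have rU : rdisk rho (p n) `<=` U by apply: pU.
have [|X /rU/f0 //|c c0 H] := hopf_ball rho0 _ _ fpn.
  by move=> X /rU /hf.
have hn := pp n (ltnSn n); apply: lt_le_trans (H _ hn).
by rewrite mulr_gt0// subr_gt0.
Qed.

Lemma positive_segment U f (rho : R) Q0 Q1 : 0 < rho ->
  harmonic_on U f -> (forall X, U X -> 0 <= f X) ->
  (forall t : R, 0 <= t <= 1 ->
    rdisk rho (Q0.1 + t * (Q1.1 - Q0.1), Q0.2 + t * (Q1.2 - Q0.2)) `<=` U) ->
  0 < f Q0 -> 0 < f Q1.
Proof.
move=> rho0 hf f0 seg fQ0.
pose n := (Num.truncn (sqd Q0 Q1 / rho ^+ 2)).+1.
have n0 : (0 : R) < n%:R by rewrite ltr0n.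
have nn0 : n%:R != 0 :> R by rewrite gt_eqF.
have r20 : 0 < rho ^+ 2 by rewrite exprn_gt0.
have nq : sqd Q0 Q1 < n%:R * rho ^+ 2 by rewrite -ltr_pdivrMr// truncnS_gt.
pose p (i : nat) : plane R := (Q0.1 + i%:R / n%:R * (Q1.1 - Q0.1), Q0.2 + i%:R / n%:R * (Q1.2 - Q0.2)).
have : 0 < f (p n).
  apply: (@positive_chain U f rho p n) => //.
  - move=> i ni; apply: seg; rewrite divr_ge0//= ler_pdivrMr// mul1r ler_nat//.
  - move=> i ni; rewrite /rdisk/= [ltLHS](_ : _ = sqd Q0 Q1 / n%:R ^+ 2); last first.
      by rewrite /sqd/= -natr1; field.
    rewrite ltr_pdivrMr ?exprn_gt0//; apply: lt_le_trans nq _.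
    rewrite mulrC ler_pM2l// expr2.
    by apply: ler_peMl; [exact: ltW|rewrite ler1n].
  - by rewrite /p !mul0r !addr0 -surjective_pairing.
by rewrite /p divff// !mul1r !(addrC _ (_ - _)) !subrK -surjective_pairing.
Qed.

End StrongMaximum.

(** * Euclidean distance *)

Section Distance.
Context {R : realType}.
Implicit Types (X Y P Q Z n : plane R).

Definition dist P X : R := Num.sqrt (sqd P X).

Lemma dist_ge0 P X : 0 <= dist P X. Proof. exact: sqrtr_ge0. Qed.

Lemma dist_sqr P X : dist P X ^+ 2 = sqd P X.
Proof. by rewrite sqr_sqrtr// sqd_ge0. Qed.

Lemma distC P X : dist P X = dist X P.
Proof. by rewrite /dist /sqd -(opprB X.1) -(opprB X.2) !sqrrN. Qed.

Lemma dist_leP P X r : 0 <= r -> (dist P X <= r) = (sqd P X <= r ^+ 2).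
Proof. by move=> r0; rewrite -dist_sqr ler_pXn2r// nnegrE dist_ge0. Qed.

Lemma dist_ltP P X r : 0 <= r -> (dist P X < r) = (sqd P X < r ^+ 2).
Proof. by move=> r0; rewrite -dist_sqr ltr_pXn2r// nnegrE dist_ge0. Qed.

Lemma tilt_le_dist n P X : n.1 ^+ 2 + n.2 ^+ 2 = 1 -> `|tilt n P X| <= dist P X.
Proof.
move=> n1; rewrite -(ler_pXn2r (n:=2))// ?nnegrE// ?dist_ge0//.
rewrite dist_sqr real_normK ?num_real// -subr_ge0.
have -> : sqd P X - tilt n P X ^+ 2 =
    (n.1 ^+ 2 + n.2 ^+ 2) * sqd P X - tilt n P X ^+ 2 by rewrite n1 mul1r.
rewrite [leRHS](_ : _ = (n.1 * (X.2 - P.2) - n.2 * (X.1 - P.1)) ^+ 2).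
  exact: sqr_ge0.
by rewrite /sqd /tilt; ring.
Qed.

Lemma tiltB n P X Y : tilt n P Y - tilt n P X = tilt n X Y.
Proof. by rewrite /tilt; ring. Qed.

Lemma fst_le_dist P X : `|X.1 - P.1| <= dist P X.
Proof.
have <- : tilt (1, 0) P X = X.1 - P.1 by rewrite /tilt/=; ring.
by apply: tilt_le_dist; rewrite /=; ring.
Qed.

Lemma snd_le_dist P X : `|X.2 - P.2| <= dist P X.
Proof.
have <- : tilt (0, 1) P X = X.2 - P.2 by rewrite /tilt/=; ring.
by apply: tilt_le_dist; rewrite /=; ring.
Qed.

Lemma dist_triangle P Q X : dist P X <= dist P Q + dist Q X.
Proof.
rewrite dist_leP ?addr_ge0 ?dist_ge0// sqrrD !dist_sqr.
pose a := (Q.1 - P.1) * (X.1 - Q.1) + (Q.2 - P.2) * (X.2 - Q.2).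
have -> : sqd P X = sqd P Q + a *+ 2 + sqd Q X by rewrite /sqd /a; ring.
rewrite lerD2r lerD2l ler_pMn2r//.
apply: le_trans (ler_norm _) _.
rewrite -(ler_pXn2r (n:=2))// ?nnegrE// ?mulr_ge0 ?dist_ge0//.
rewrite real_normK ?num_real// exprMn !dist_sqr -subr_ge0.
rewrite [leRHS](_ : _ = ((Q.1 - P.1) * (X.2 - Q.2) - (Q.2 - P.2) * (X.1 - Q.1)) ^+ 2).
  exact: sqr_ge0.
by rewrite /sqd /a; ring.
Qed.

Lemma enormE X : enorm X = dist (0, 0) X.
Proof. by rewrite /enorm /dist /sqd /dotp/= !subr0. Qed.

Lemma sqd_o_gt0 X : X <> (0, 0) -> 0 < sqd (0, 0) X.
Proof.
move=> Xo; rewrite lt_neqAle sqd_ge0 andbT eq_sym; apply/eqP => oX.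
apply: Xo; move: oX; rewrite /sqd/= !subr0 => /eqP.
rewrite paddr_eq0 ?sqr_ge0// !sqrf_eq0 => /andP[/eqP a /eqP b].
by rewrite [LHS]surjective_pairing a b.
Qed.

Lemma ge_minlr (a b : R) : Num.min a b <= a /\ Num.min a b <= b.
Proof. by rewrite !ge_min !lexx orbT. Qed.

End Distance.

(** * Gradient estimate between two straight sides *)

Section Wedge.
Context {R : realType}.
Implicit Types (X Y P Q Z n : plane R) (f : plane R -> R).
Variables (eps mu cs sn : R).
Hypotheses (eps0 : 0 < eps) (eps1 : eps <= 1) (mu1 : 1 < mu).
Hypotheses (cs0 : 0 < cs) (sn0 : 0 < sn) (cs_sn : cs ^+ 2 + sn ^+ 2 = 1).

Let o : plane R := (0, 0).

Definition side_vertex (s : R) : plane R := (s * (eps / 2), 0).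
(** The parameter [s = 1] or [-1] selects the right or left inclusion, [t = 1] or
[-1] its upper or lower side; [(cs, sn)] are the cosine and sine of half the
aperture. The height above the line carrying the side is positive outside. *)
Definition side_normal (s t : R) : plane R := (- (s * sn), t * cs).
Definition side_height s t X := tilt (side_normal s t) (side_vertex s) X.

(** The part of the disk of radius [mu] that is on the outer side of both upper
sides ([t = 1]) or of both lower sides ([t = -1]). *)
Definition wedge t : set (plane R) :=
  [set X | [/\ dist o X < mu, 0 < side_height 1 t X & 0 < side_height (-1) t X]].

(** A margin that fits between the unit disk and the circle of radius [mu]. *)
Definition eta := Num.min ((mu - 1) / 2) 1.
(** A disk centred on a side at distance [q] from the vertex, with radius
[slope * q], stays clear of the other sides and of the circle of radius [mu]. *)
Definition slope := Num.min (cs * sn) (eta / 12).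

Lemma eta_gt0 : 0 < eta.
Proof. by rewrite /eta lt_min ltr01 andbT divr_gt0// subr_gt0. Qed.

Lemma slope_gt0 : 0 < slope.
Proof. by rewrite /slope lt_min mulr_gt0//= divr_gt0// eta_gt0. Qed.

Lemma eta_le : eta <= 1 /\ 1 + eta < mu.
Proof.
have h1 : eta <= 1 by rewrite ge_min lexx orbT.
have h2 : eta <= (mu - 1) / 2 by rewrite ge_min lexx.
by split => //; have := mu1; lra.
Qed.

Lemma slope_le : slope <= cs * sn /\ 12 * slope <= eta.
Proof.
have h1 : slope <= cs * sn by rewrite ge_min lexx.
have h2 : slope <= eta / 12 by rewrite ge_min lexx orbT.
by split => //; lra.
Qed.

(** In the coordinates [q] along the side and [h] above it, [q * b + h * a] is the
ordinate. Near the vertex, where [h] dominates [q], it is controlled by [h]. *)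
Lemma narrow_sector (c q h a b r : R) : 0 < c -> c <= 1 -> 0 < h -> 0 < a -> a <= 1 ->
  0 < b -> b <= 1 -> 0 < r -> c * q <= h -> h <= 5 * r -> q * b + h * a <= 270 * (r / c).
Proof.
move=> c0 c1 h0 a0 a1 b0 b1 r0 hc hr.
have cr : r <= r / c by rewrite ler_pdivlMr// ler_piMr// ltW.
have qc : q <= h / c by rewrite ler_pdivlMr// mulrC.
have hrc : h / c <= 5 * (r / c) by rewrite mulrA ler_pM2r ?invr_gt0.
have hc0 : 0 < h / c by rewrite divr_gt0.
have ha : h * a <= h by rewrite ler_piMr// ltW.
have qb : q * b <= h / c.
  have [q0|q0] := leP 0 q; first by apply: le_trans qc; rewrite ler_piMr.
  by apply: le_trans (ltW hc0); rewrite pmulr_lle0// ltW.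
lra.
Qed.

Lemma foot_distance (x z : R) : 11 * x <= 12 * z -> 0 < x -> x + x <= 3 * z.
Proof. lra. Qed.

Lemma unit_le1 (a b : R) : a ^+ 2 + b ^+ 2 = 1 -> 0 <= a -> a <= 1.
Proof.
move=> h a0; rewrite -(ler_pXn2r (n:=2)) ?nnegrE// expr1n -h lerDl; exact: sqr_ge0.
Qed.

Lemma sqd_le_dist (k : R) P Q : 0 <= k -> dist o P <= k * dist o Q -> sqd o P <= k ^+ 2 * sqd o Q.
Proof.
by move=> k0 h; rewrite -!dist_sqr -exprMn ler_pXn2r ?nnegrE ?dist_ge0// mulr_ge0// dist_ge0.
Qed.

Lemma weighted_bound (F a b k y q : R) : 0 <= F -> 0 <= k -> a <= 9 * b -> F * b <= k * y -> y <= 2 * q ->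
  F * a <= 18 * k * q.
Proof.
move=> F0 k0 ab Fb yq; have h1 := ler_wpM2l F0 ab; have h2 := ler_wpM2l k0 yq; lra.
Qed.

(** The point of the side at distance [q] from the vertex. *)
Definition flat_foot (s t q : R) : plane R := (s * (eps / 2) + q * (s * cs), q * (t * sn)).

(** The radius [slope * q] is a small fraction both of [q], which bounds from below
the distance of the centre to the origin, and of the gap to the other side. *)
Lemma flat_neighbourhood s t q Z : s ^+ 2 = 1 -> t ^+ 2 = 1 -> 0 < q -> q <= 3 ->
  q <= dist o (flat_foot s t q) -> dist o (flat_foot s t q) <= 1 + eta / 2 ->
  dist (flat_foot s t q) Z < slope * q ->
  [/\ dist o Z < mu, 0 < side_height (- s) t Z, 11 * dist o (flat_foot s t q) <= 12 * dist o Z,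
      eps / 2 <= s * Z.1 & `|Z.2| <= 2 * q].
Proof.
move=> s2 t2 q0 q3 qQ oQ QZ.
have [c0 [e0 [[e1 emu] [ccs ce]]]] := (slope_gt0, (eta_gt0, (eta_le, slope_le))).
have csle : cs <= 1 by exact: unit_le1 cs_sn (ltW cs0).
have snle : sn <= 1 by apply: (@unit_le1 sn cs); [rewrite addrC|exact: ltW].
have s1 : `|s| = 1 by apply/eqP; rewrite -(eqrXn2 (n:=2))// ?real_normK ?num_real// s2 expr1n.
have t1 : `|t| = 1 by apply/eqP; rewrite -(eqrXn2 (n:=2))// ?real_normK ?num_real// t2 expr1n.
set Q := flat_foot s t q in qQ oQ QZ *.
have ccs' : slope <= cs by apply: le_trans ccs _; rewrite ler_piMr// ltW.
have cq : slope * q <= q / 12.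
  by rewrite mulrC ler_pM2l//; lra.
have cq3 : slope * q <= slope * 3 by rewrite ler_pM2l.
split.
- by have := dist_triangle o Q Z; lra.
- have nn1 : (side_normal (- s) t).1 ^+ 2 + (side_normal (- s) t).2 ^+ 2 = 1.
    by rewrite /= sqrrN !exprMn sqrrN s2 t2 !mul1r addrC.
  have := tilt_le_dist Q Z nn1; rewrite -(tiltB _ (side_vertex (- s))) ler_norml.
  rewrite -/(side_height _ _ _) -/(side_height _ _ _) => /andP[h1 _].
  have E : side_height (- s) t Q = 2 * q * (cs * sn) + eps * sn.
    rewrite [RHS](_ : _ = t ^+ 2 * q * cs * sn + s ^+ 2 * q * cs * sn + s ^+ 2 * eps * sn); last first.
      by rewrite s2 t2; ring.
    by rewrite /side_height /tilt /Q /side_vertex/side_normal/=; field.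
  have p1 : 0 < eps * sn by rewrite mulr_gt0.
  have p2 : 0 <= q * (cs * sn - slope) by rewrite mulr_ge0 ?(ltW q0)// subr_ge0.
  have p3 : 0 < q * (cs * sn) by rewrite !mulr_gt0.
  lra.
- by have := dist_triangle o Z Q; rewrite (distC Z Q); lra.
- have h1 := fst_le_dist Q Z.
  have : `|s * (Z.1 - Q.1)| <= dist Q Z by rewrite normrM s1 mul1r.
  rewrite mulrBr ler_norml => /andP[h2 _].
  have E : s * Q.1 = eps / 2 + q * cs.
    rewrite [RHS](_ : _ = s ^+ 2 * (eps / 2) + s ^+ 2 * q * cs); last by rewrite s2; ring.
    by rewrite /Q /=; ring.
  have p1 : 0 <= q * (cs - slope) by rewrite mulr_ge0 ?(ltW q0)// subr_ge0.
  lra.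
- have h1 := snd_le_dist Q Z.
  have Q2 : `|Q.2| <= q.
    by rewrite /Q /= !normrM t1 mul1r !gtr0_norm// ler_piMr// ltW.
  have := ler_normD (Z.2 - Q.2) Q.2; rewrite subrK.
  lra.
Qed.

(** Let [q] be the abscissa of [Y] along the side, measured from the vertex, and [h]
its height. If [h >= slope * q], the ordinate of [Y] is itself of the order of
[h] and the assumed bound is sufficient. Otherwise, on the half disk of radius
[slope * q] around the foot of [Y], [f] is at most [18 kappa q / |Y|^2], and
vanishing on the side gains the factor [3 h / (slope * q)]. *)
Lemma side_growth f (kappa s t r : R) Y : s ^+ 2 = 1 -> t ^+ 2 = 1 -> 0 <= kappa -> 0 < r ->
  harmonic_on (wedge t `\ o) f ->
  (forall X, wedge t X -> X <> o -> `|f X| * sqd o X <= kappa * `|X.2|) ->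
  (forall Z, dist o Z < mu -> side_height s t Z = 0 -> eps / 2 <= s * Z.1 ->
     forall e, 0 < e -> \forall Y \near Z, wedge t Y -> Y <> o -> `|f Y| <= e) ->
  wedge t Y -> Y <> o -> dist o Y <= 1 + eta / 4 -> side_height s t Y <= 5 * r ->
  - r <= t * Y.2 ->
  `|f Y| * sqd o Y <= kappa * (270 / slope * r).
Proof.
move=> s2 t2 k0 r0 hf fk fz wY Yo Y1 Yr Y2.
have [c0 [e0 [[e1 emu] [ccs ce]]]] := (slope_gt0, (eta_gt0, (eta_le, slope_le))).
set c := slope in c0 ccs ce *.
have [mu1' [eps0' [eps1' [cs0' [sn0' cssn']]]]] :=
  (mu1, (eps0, (eps1, (cs0, (sn0, cs_sn))))).
have cs1 : cs <= 1 by exact: unit_le1 cs_sn (ltW cs0).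
have sn1 : sn <= 1 by apply: (@unit_le1 sn cs); [rewrite addrC|exact: ltW].
have c1 : c <= 1 by lra.
have s1 : `|s| = 1 by apply/eqP; rewrite -(eqrXn2 (n:=2))// ?real_normK ?num_real// s2 expr1n.
have t1 : `|t| = 1 by apply/eqP; rewrite -(eqrXn2 (n:=2))// ?real_normK ?num_real// t2 expr1n.
pose h := side_height s t Y.
have h0 : 0 < h.
  case: wY => _; have /eqP : s ^+ 2 = 1 ^+ 2 by rewrite s2 expr1n.
  by rewrite eqf_sqr /h => /orP[] /eqP ->.
pose d : plane R := (s * cs, t * sn).
pose n := side_normal s t.
have n1 : n.1 ^+ 2 + n.2 ^+ 2 = 1.
  by rewrite /= sqrrN !exprMn s2 t2 !mul1r addrC.
have d1 : d.1 ^+ 2 + d.2 ^+ 2 = 1 by rewrite /= !exprMn s2 t2 !mul1r.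
pose V := side_vertex s.
pose q := tilt d V Y.
have YE : Y = (V.1 + q * d.1 + h * n.1, V.2 + q * d.2 + h * n.2).
  rewrite [LHS]surjective_pairing; congr pair.
    rewrite [RHS](_ : _ = V.1 + s ^+ 2 * (cs ^+ 2 + sn ^+ 2) * (Y.1 - V.1)).
      by rewrite s2 cs_sn; ring.
    by rewrite /q /h /side_height /tilt /V /d /n /side_vertex/side_normal/=; ring.
  rewrite [RHS](_ : _ = V.2 + t ^+ 2 * (cs ^+ 2 + sn ^+ 2) * (Y.2 - V.2)).
    by rewrite t2 cs_sn; ring.
  by rewrite /q /h /side_height /tilt /V /d /n /side_vertex/side_normal/=; ring.
have tY2 : t * Y.2 = q * sn + h * cs.
  rewrite [in LHS]YE /= add0r.
  rewrite [LHS](_ : _ = t ^+ 2 * (q * sn + h * cs)); last by ring.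
  by rewrite t2 mul1r.
have aY2 : `|Y.2| = `|t * Y.2| by rewrite normrM t1 mul1r.
have [hc|hc] := leP (c * q) h.
  apply: le_trans (fk _ wY Yo) _; apply: ler_wpM2l => //.
  have := narrow_sector c0 c1 h0 cs0 cs1 sn0 sn1 r0 hc Yr.
  have cr : r <= r / c by rewrite ler_pdivlMr// ler_piMr// ltW.
  have rc0 : 0 < r / c by rewrite divr_gt0.
  rewrite -tY2 aY2 ler_norml (_ : 270 / c * r = 270 * (r / c)); last by ring.
  move=> ->; rewrite andbT; apply: le_trans Y2; rewrite lerN2; apply: le_trans cr _.
  by rewrite ler_pMl// ler1n.
have q0 : 0 < q by rewrite -(pmulr_rgt0 _ c0); exact: lt_trans h0 hc.
pose Q : plane R := flat_foot s t q.
have QY : dist Q Y = h.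
  rewrite /dist (_ : sqd Q Y = h ^+ 2 * (n.1 ^+ 2 + n.2 ^+ 2)); last first.
    by rewrite YE /Q /flat_foot /sqd/=; ring.
  by rewrite n1 mulr1 sqrtr_sqr gtr0_norm.
have qQ : q <= dist o Q.
  rewrite leNgt dist_ltP ?(ltW q0)// -leNgt /sqd /Q /= !subr0.
  rewrite [leRHS](_ : _ = s ^+ 2 * (eps / 2) ^+ 2 + s ^+ 2 * eps * q * cs + q ^+ 2 * (s ^+ 2 * cs ^+ 2 + t ^+ 2 * sn ^+ 2)); last by field.
  rewrite s2 t2 !mul1r cs_sn mulr1 lerDr addr_ge0 ?sqr_ge0//.
  by rewrite !mulr_ge0// ltW.
have VY : q <= 3.
  apply: le_trans (ler_norm _) _; apply: le_trans (tilt_le_dist V Y d1) _.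
  apply: le_trans (dist_triangle V o Y) _.
  have Y2' : dist o Y <= 2 by apply: le_trans Y1 _; lra.
  suff V1 : dist V o <= 1 by apply: le_trans (lerD V1 Y2') _; lra.
  rewrite dist_leP// /sqd /= !sub0r !sqrrN expr0n/= addr0 exprMn s2 mul1r.
  have e20 : 0 <= eps / 2 by rewrite divr_ge0// ltW.
  by rewrite expr1n expr_le1// ler_pdivrMr// mul1r (le_trans eps1)// ler1n.
have cq : 0 < c * q by rewrite mulr_gt0.
have cq3 : c * q <= eta / 4.
  by apply: le_trans (ler_wpM2l (ltW c0) VY) _; lra.
have oQ : dist o Q <= 1 + eta / 2.
  have tr := dist_triangle o Y Q; rewrite (distC Y) QY in tr.
  apply: le_trans tr _; apply: le_trans (lerD Y1 (le_trans (ltW hc) cq3)) _; lra.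
have heightQ Z : side_height s t Z = tilt n Q Z.
  transitivity (tilt n Q Z + q * cs * sn * (t ^+ 2 - s ^+ 2)).
    by rewrite /side_height /tilt /Q /V /d /n /side_vertex /side_normal/=; ring.
  by rewrite t2 s2 subrr mulr0 addr0.
have half Z : dist Q Z < c * q ->
   [/\ dist o Z < mu /\ 0 < side_height (- s) t Z, dist o Y <= 3 * dist o Z,
     Z <> o, eps / 2 <= s * Z.1 & `|Z.2| <= 2 * q].
  move=> QZ; have [a1 a2 a3 a4 a5] := flat_neighbourhood s2 t2 q0 VY qQ oQ QZ.
  have oQ0 : 0 < dist o Q := lt_le_trans q0 qQ.
  split => //.
    apply: le_trans (dist_triangle o Q Y) _; rewrite QY.
    have hQ : h <= dist o Q.
      by apply: le_trans (ltW hc) (le_trans _ qQ); rewrite ler_piMl// ltW.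
    rewrite -/Q in a3; apply: le_trans (lerD (lexx _) hQ) _; exact: (foot_distance a3 oQ0).
  move=> Zo; rewrite -/Q Zo {2}/dist /sqd subrr expr0n/= addr0 sqrtr0 mulr0 in a3.
  by have := lt_le_trans (mulr_gt0 (ltr0n R 11 : 0 < 11) oQ0) a3; rewrite ltxx.
have wZ Z : half_disk n (c * q) Q Z -> wedge t Z /\ Z <> o.
  move=> [QZ tZ]; have {}QZ : dist Q Z < c * q by rewrite dist_ltP// ltW.
  have [[Zmu hZ'] _ Zo _ _] := half _ QZ; split => //.
  have hZ : 0 < side_height s t Z by rewrite heightQ.
  move: hZ hZ'; have /eqP : s ^+ 2 = 1 ^+ 2 by rewrite s2 expr1n.
  by rewrite eqf_sqr /h => /orP[] /eqP -> hZ; rewrite ?opprK => hZ'; split.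
have oY0 : 0 < sqd o Y := sqd_o_gt0 Yo.
pose M := 18 * kappa * q / sqd o Y.
have M0 : 0 <= M by rewrite /M divr_ge0 ?sqd_ge0// !mulr_ge0// ltW.
have fM Z : half_disk n (c * q) Q Z -> `|f Z| <= M.
  move=> hZ; have [WZ Zo] := wZ _ hZ.
  have QZ : dist Q Z < c * q by rewrite dist_ltP ?ltW//; case: hZ.
  have [_ YZ _ _ Z2] := half _ QZ.
  have YZ' : sqd o Y <= 9 * sqd o Z.
    by rewrite (_ : 9 = 3 ^+ 2); [exact: sqd_le_dist|rewrite expr2 -natrM].
  by rewrite /M ler_pdivlMr//; exact: (weighted_bound (normr_ge0 _) k0 YZ' (fk _ WZ Zo) Z2).
have hfN : harmonic_on (half_disk n (c * q) Q) f.
  by move=> Z /wZ [WZ Zo]; exact: hf.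
have Qh : (Q.1 + h * n.1, Q.2 + h * n.2) = Y by rewrite [RHS]YE /= add0r.
have bnd (g : plane R -> R) : (forall Y, `|g Y| = `|f Y|) -> harmonic_on (half_disk n (c * q) Q) g ->
    g Y <= 3 * M * h / (c * q).
  move=> gf hg; rewrite -[in g _]Qh; apply: boundary_growth => //.
  - by move=> Z /fM; rewrite -gf; exact: le_trans (ler_norm _).
  - move=> Z QZ tZ e e00; have {}QZ : dist Q Z < c * q by rewrite dist_ltP// ltW.
    have [[Zmu _] _ _ Z1 _] := half _ QZ.
    have hZ : side_height s t Z = 0 by rewrite heightQ.
    have := fz Z Zmu hZ Z1 e e00; apply: filterS => W fW /wZ[w1 w2].
    by apply: le_trans (ler_norm _) _; rewrite gf; exact: fW.
  - by rewrite h0.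
have : `|f Y| <= 3 * M * h / (c * q).
  have b1 := bnd f (fun=> erefl) hfN.
  have b2 := bnd (fun Y => - f Y) (fun=> normrN _) (harmonicN hfN).
  by rewrite ler_norml lerNl b1 b2.
rewrite (_ : 3 * M * h / (c * q) = (54 * kappa * h / c) / sqd o Y); last first.
  by rewrite /M; field; rewrite !gt_eqF.
rewrite ler_pdivlMr// => /le_trans; apply.
rewrite [leRHS](_ : _ = 54 * kappa / c * (5 * r)); last by ring.
rewrite [leLHS](_ : _ = 54 * kappa / c * h); last by ring.
by rewrite ler_wpM2l// divr_ge0 ?(ltW c0)// mulr_ge0.
Qed.

End Wedge.

Section WedgeGradient.
Context {R : realType}.
Implicit Types (X Y P Q Z n : plane R) (f : plane R -> R).
Variables (eps mu cs sn : R).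
Hypotheses (eps0 : 0 < eps) (eps1 : eps <= 1) (mu1 : 1 < mu).
Hypotheses (cs0 : 0 < cs) (sn0 : 0 < sn) (cs_sn : cs ^+ 2 + sn ^+ 2 = 1).

Let o : plane R := (0, 0).
Local Notation side_height := (side_height eps cs sn).
Local Notation wedge := (wedge eps mu cs sn).
Local Notation slope := (slope mu cs sn).
Local Notation eta := (eta mu).

Lemma sqrt_sum_le (a c B : R) : `|a| <= B -> `|c| <= B -> Num.sqrt (a ^+ 2 + c ^+ 2) <= 2 * B.
Proof.
move=> a1 c1; have B0 : 0 <= B := le_trans (normr_ge0 a) a1.
have a2 : a ^+ 2 <= B ^+ 2 by rewrite -real_normK ?num_real// ler_pXn2r// nnegrE.
have c2 : c ^+ 2 <= B ^+ 2 by rewrite -real_normK ?num_real// ler_pXn2r// nnegrE.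
have h : a ^+ 2 + c ^+ 2 <= (2 * B) ^+ 2.
  by rewrite exprMn; have := sqr_ge0 B; lra.
have B2 : 0 <= 2 * B by rewrite mulr_ge0.
by rewrite -(ger0_norm B2) -sqrtr_sqr ler_wsqrtr.
Qed.

(** Let [m] be the least of the heights above the two sides, of [|X|] and of [eta].
On the disk of radius [m / 4], [f] is of order [m / |X|^2]: by [side_growth] when
[m] is a height, and because [|x2| <= |X|] otherwise. The interior estimate
divides by [m]. *)
Lemma wedge_gradient f (kappa t a c l : R) X : t ^+ 2 = 1 -> 0 <= kappa ->
  harmonic_on (wedge t `\ o) f ->
  (forall X, wedge t X -> X <> o -> `|f X| * sqd o X <= kappa * `|X.2|) ->
  (forall s, s ^+ 2 = 1 -> forall Z, dist o Z < mu -> side_height s t Z = 0 -> eps / 2 <= s * Z.1 ->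
     forall e, 0 < e -> \forall Y \near Z, wedge t Y -> Y <> o -> `|f Y| <= e) ->
  wedge t X -> X <> o -> dist o X < 1 -> 0 <= t * X.2 -> jet f X a c l ->
  Num.sqrt (a ^+ 2 + c ^+ 2) <= kappa * (3240 / slope) / sqd o X.
Proof.
move=> t2 k0 hf fk fz wX Xo X1 tX jf.
have [mu1' [eps0' eps1']] := (mu1, (eps0, eps1)).
have [c0 [e0 [[e1 emu] [ccs ce]]]] := (slope_gt0 mu1 cs0 sn0, (eta_gt0 mu1, (eta_le mu1, slope_le mu cs sn))).
have t1 : `|t| = 1 by apply/eqP; rewrite -(eqrXn2 (n:=2))// ?real_normK ?num_real// t2 expr1n.
have sX0 : 0 < sqd o X := sqd_o_gt0 Xo.
have dX0 : 0 < dist o X by rewrite sqrtr_gt0.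
have [Xmu h1 h2] := wX.
pose m := Num.min (Num.min (side_height 1 t X) (side_height (-1) t X)) (Num.min (dist o X) eta).
have m0 : 0 < m by rewrite lt_min lt_min h1 h2 lt_min dX0 e0.
have [[m1 m2] [m3 m4]] : (m <= side_height 1 t X /\ m <= side_height (-1) t X) /\ (m <= dist o X /\ m <= eta).
  have [k1 k2] := ge_minlr (Num.min (side_height 1 t X) (side_height (-1) t X))
    (Num.min (dist o X) eta).
  have [k3 k4] := ge_minlr (side_height 1 t X) (side_height (-1) t X).
  have [k5 k6] := ge_minlr (dist o X) eta.
  by split; split; [exact: le_trans k1 k3|exact: le_trans k1 k4|exact: le_trans k2 k5|exact: le_trans k2 k6].
have mE : [\/ side_height 1 t X = m, side_height (-1) t X = m, dist o X = m | eta = m].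
  have min_or (p q : R) : Num.min p q = p \/ Num.min p q = q.
    by rewrite /Num.min; case: ifP; [left|right].
  rewrite /m; have [->|->] := min_or (Num.min (side_height 1 t X) (side_height (-1) t X))
    (Num.min (dist o X) eta).
    have [->|->] := min_or (side_height 1 t X) (side_height (-1) t X).
      exact: Or41.
    exact: Or42.
  have [->|->] := min_or (dist o X) eta; first exact: Or43.
  exact: Or44.
pose r := m / 4.
have r0 : 0 < r by rewrite divr_gt0.
have heightB s Y : s ^+ 2 = 1 -> `|side_height s t Y - side_height s t X| <= dist X Y.
  move=> s2; rewrite tiltB tilt_le_dist// /= sqrrN !exprMn s2 t2 !mul1r addrC//.
have ball Y : rdisk r X Y -> [/\ wedge t Y, Y <> o, 3 * dist o X <= 4 * dist o Y /\ dist o Y <= 1 + eta / 4,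
   - r <= t * Y.2 & forall s, s ^+ 2 = 1 -> side_height s t Y <= side_height s t X + r].
  rewrite /rdisk/= -dist_ltP ?(ltW r0)// => XY.
  have oY : 3 * dist o X <= 4 * dist o Y.
    by have := dist_triangle o Y X; rewrite (distC Y); rewrite /r in XY; lra.
  have oY2 := dist_triangle o X Y.
  have rE : r <= eta / 4 by rewrite /r; lra.
  split => //.
  - have hh1 := heightB 1 Y; have hh2 := heightB (-1) Y.
    have {}hh1 := hh1 (expr1n _ _); have {}hh2 : `|side_height (- 1) t Y - side_height (- 1) t X| <= dist X Y.
      by apply: hh2; rewrite sqrrN expr1n.
    move: hh1 hh2; rewrite !ler_norml => /andP[hh1 _] /andP[hh2 _].
    by split; [lra| rewrite /r in XY; lra | rewrite /r in XY; lra].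
  - move=> Yo; have := dX0; have := oY; rewrite Yo {2}/dist /sqd subrr expr0n/= addr0 sqrtr0; lra.
  - lra.
  - have := snd_le_dist X Y => hh.
    have : `|t * (Y.2 - X.2)| <= dist X Y by rewrite normrM t1 mul1r.
    by rewrite mulrBr ler_norml => /andP[hh1 _]; lra.
  - by move=> s s2; have := heightB s Y s2; rewrite ler_norml => /andP[_ hh]; lra.
pose M := kappa * (540 / slope * r) / sqd o X.
have fM Y : rdisk r X Y -> `|f Y| <= M.
  move=> /[dup] XY /ball[wY Yo [YX Y1] Y2 hY].
  have YX2 : sqd o X <= 2 * sqd o Y.
    by rewrite -!dist_sqr; have := dist_ge0 o X; have := dist_ge0 o Y; nra.
  suff H : `|f Y| * sqd o Y <= kappa * (270 / slope * r).
    rewrite /M ler_pdivlMr//; have := ler_wpM2l (normr_ge0 (f Y)) YX2; lra.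
  have side s : s ^+ 2 = 1 -> side_height s t X = m -> `|f Y| * sqd o Y <= kappa * (270 / slope * r).
    move=> s2 sm; apply: (side_growth eps0 eps1 mu1 cs0 sn0 cs_sn s2 t2 k0 r0 hf fk (fz _ s2) wY Yo Y1) => //.
    by apply: le_trans (hY _ s2) _; rewrite sm /r; lra.
  have yY : `|Y.2| <= dist o Y by have := snd_le_dist o Y; rewrite subr0.
  have sl1 : slope * 12 <= 1 by lra.
  have fYY : `|f Y| * sqd o Y <= kappa * dist o Y.
    by apply: le_trans (fk _ wY Yo) _; rewrite ler_wpM2l.
  have oY2 : dist o Y <= dist o X + r.
    apply: le_trans (dist_triangle o X Y) _; rewrite lerD2l ltW//.
    by rewrite dist_ltP// ltW.
  have rs : r <= r / slope by rewrite ler_pdivlMr// ler_piMr//; lra.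
  have rE : 270 / slope * r = 270 * (r / slope) by ring.
  case: mE => mE.
  - by apply: (side 1) => //; rewrite expr1n.
  - by apply: (side (-1)) => //; rewrite sqrrN expr1n.
  - apply: le_trans fYY _; rewrite ler_wpM2l// rE.
    by move: oY2; rewrite mE /r; rewrite /r in rs; lra.
  - apply: le_trans fYY _; rewrite ler_wpM2l// rE.
    have : eta / slope >= 12 by rewrite ler_pdivlMr// mulrC.
    rewrite mE => h.
    have : r / slope = (m / slope) / 4 by rewrite /r; field; rewrite gt_eqF.
    move=> ->; lra.
have hfX : harmonic_on (rdisk r X) f.
  by move=> Y /ball[wY Yo _ _ _]; exact: hf.
have [a1 c1] := gradient_bound r0 jf hfX fM.
have E : 3 * M / r = kappa * (1620 / slope) / sqd o X.
  by rewrite /M; field; rewrite !gt_eqF.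
rewrite E in a1 c1.
set B := kappa * (1620 / slope) / sqd o X in a1 c1.
rewrite [leRHS](_ : _ = 2 * B); last by rewrite /B; field; rewrite !gt_eqF.
exact: sqrt_sum_le.
Qed.

End WedgeGradient.

(** * Smooth bump functions on the line *)

Section Smooth1.
Context {R : realType}.
Implicit Types f g : R -> R.

(** A class closed under derivation by [smooth1_derive], so that infinite
differentiability is proved by exhibiting how a function is built. The last rule
is division by the variable, harmless for functions that vanish around [0] and
on the left of it. *)
Inductive smooth1 : (R -> R) -> Prop :=
| Smooth_tower (D : nat -> R -> R) of
    (forall n (x : R), is_derive x 1 (D n) (D n.+1 x)) : smooth1 (D 0%N)
| Smooth_primitive f f' of smooth1 f' &
    (forall x : R, is_derive x 1 f (f' x)) : smooth1 f
| Smooth_add f g of smooth1 f & smooth1 g : smooth1 (fun x => f x + g x)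
| Smooth_mul f g of smooth1 f & smooth1 g : smooth1 (fun x => f x * g x)
| Smooth_comp f g of smooth1 f & smooth1 g : smooth1 (fun x => f (g x))
| Smooth_div f (a : R) of smooth1 f & 0 < a & (forall x, x < a -> f x = 0) :
    smooth1 (fun x => f x * x^-1).

Lemma smooth1_cst (c : R) : smooth1 (fun=> c).
Proof.
have s0 : smooth1 (fun=> 0).
  by apply: (@Smooth_tower (fun _ _ => 0)) => n x; exact: is_derive_cst.
exact: (Smooth_primitive s0 (fun x => is_derive_cst c x 1)).
Qed.

Lemma smooth1_id : smooth1 id.
Proof.
exact: (Smooth_primitive (smooth1_cst 1) (fun x => is_derive_id x 1)).
Qed.

Lemma derivative_near0 f (x d : R) : (\forall t \near x, f t = 0) ->
  is_derive x 1 f d -> d = 0.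
Proof.
move=> f0 [_ <-]; rewrite (near_eq_derive (g:=fun=> 0) _ f0).
exact: derive_cst.
Qed.

Lemma smooth1_derive f : smooth1 f ->
  exists2 f', smooth1 f' & forall x : R, is_derive x 1 f (f' x).
Proof.
elim=> [D HD|{}f f' sf' _ ff'|{}f g sf [f' sf' ff'] sg [g' sg' gg']
  |{}f g sf [f' sf' ff'] sg [g' sg' gg']|{}f g sf [f' sf' ff'] sg [g' sg' gg']
  |{}f a sf [f' sf' ff'] a0 f0].
- exists (D 1%N); last exact: HD.
  by apply: (@Smooth_tower (fun n => D n.+1)) => n x.
- by exists f'.
- exists (fun x => f' x + g' x); first exact: Smooth_add.
  by move=> x; exact: (is_deriveD (ff' x) (gg' x)).
- exists (fun x => f x * g' x + g x * f' x).
    by apply: Smooth_add; exact: Smooth_mul.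
  by move=> x; exact: (is_deriveM (ff' x) (gg' x)).
- exists (fun x => f' (g x) * g' x).
    by apply: Smooth_mul => //; exact: Smooth_comp.
  by move=> x; exact: (is_derive1_comp (ff' (g x)) (gg' x)).
- have f'0 x : x < a -> f' x = 0.
    move=> xa; apply: (derivative_near0 _ (ff' x)).
    have : \forall t \near x, t < a by exact: lt_nbhsl.
    by apply: filterS => t; exact: f0.
  have sd : smooth1 (fun x => f x * x^-1) by exact: (Smooth_div sf a0).
  exists (fun x => f' x * x^-1 + (-1) * ((f x * x^-1) * x^-1)).
    apply: Smooth_add; first exact: (Smooth_div sf' a0).
    apply: Smooth_mul; first exact: smooth1_cst.
    by apply: (@Smooth_div _ a) => // x xa; rewrite f0// mul0r.
  move=> x; have [xa|ax] := ltP x a.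
    rewrite f0// f'0// !mul0r mulr0 addr0.
    apply: (near_eq_is_derive _ (is_derive_cst 0 x 1)).
    have : \forall t \near x, t < a by exact: lt_nbhsl.
    by apply: filterS => t ta; rewrite f0// mul0r.
  have x0 : x != 0 by rewrite gt_eqF//; exact: lt_le_trans ax.
  have := is_deriveM (ff' x) (@is_deriveV R id x _ 1 x0 (is_derive_id _ _)).
  move/is_derive_eq; apply; rewrite /GRing.scale/=; field.
  exact: x0.
Qed.

Lemma smooth1_jet2 f : smooth1 f -> exists f' f'', [/\ smooth1 f', smooth1 f'',
  forall x : R, is_derive x 1 f (f' x), forall x : R, is_derive x 1 f' (f'' x) &
  forall x, jet2 f x (f' x) (f'' x)].
Proof.
move=> /smooth1_derive[f' sf' ff']; have [f'' sf'' ff''] := smooth1_derive sf'.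
by exists f', f''; split => // x; exists f'; split => //; exact: filterE.
Qed.

Lemma is_derive_continuous f (x d : R) : is_derive x 1 f d -> {for x, continuous f}.
Proof.
by move=> fd; apply: differentiable_continuous; apply/derivable1_diffP; exact: ex_derive.
Qed.

Lemma smooth1_continuous f : smooth1 f -> continuous f.
Proof. by move=> /smooth1_derive[f' _ ff'] x; exact: is_derive_continuous (ff' x). Qed.

Lemma powexp_bound n (y : R) : 0 <= y -> y ^+ n <= n%:R ^+ n * expR y.
Proof.
move=> y0; case: n => [|n]; first by rewrite !expr0 mul1r -expR0 ler_expR.
have n0 : (0 : R) < n.+1%:R by rewrite ltr0n.
have -> : expR y = expR (y / n.+1%:R) ^+ n.+1.
  by rewrite -expRM_natr; congr expR; field; rewrite gt_eqF.
rewrite -exprMn ler_pXn2r ?nnegrE ?mulr_ge0 ?expR_ge0 ?(ltW n0)//.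
have := ler_wpM2l (ltW n0) (expR_ge1Dx (y / n.+1%:R)).
rewrite mulrDr mulr1 mulrCA divff ?gt_eqF// mulr1; lra.
Qed.

Lemma polyexp_bound (p : {poly R}) : exists C, 0 <= C /\
  forall y, 0 <= y -> `|p.[y]| <= C * expR y.
Proof.
exists (\sum_(i < size p) `|p`_i| * i%:R ^+ i); split.
  by apply: sumr_ge0 => i _; rewrite mulr_ge0// exprn_ge0.
move=> y y0; rewrite horner_coef mulr_suml.
apply: le_trans (ler_norm_sum _ _ _) _.
apply: ler_sum => i _; rewrite normrM -mulrA ler_wpM2l//.
by rewrite ger0_norm ?exprn_ge0// powexp_bound.
Qed.

(** For [x > 0], the n-th derivative of [exp (- 1 / x)] is [p_n (1 / x)] times
[exp (- 1 / x)], where [p_(n+1) = y^2 (p_n - p_n')]. *)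
Fixpoint flat_poly n : {poly R} :=
  if n is m.+1 then 'X^2 * (flat_poly m - (flat_poly m)^`()) else 1.

Definition flat n (x : R) : R :=
  if 0 < x then (flat_poly n).[x^-1] * expR (- x^-1) else 0.

(** At [0], the difference quotient is [O(|x|)] because every polynomial in [1 / x] is
absorbed by the exponential. *)
Lemma flat_is_derive n (x : R) : is_derive x 1 (flat n) (flat n.+1 x).
Proof.
have [x0|x0|x0] := ltgtP x 0.
- rewrite {2}/flat ltNge (ltW x0)/=.
  apply: (near_eq_is_derive _ (is_derive_cst 0 x 1)).
  have : \forall t \near x, t < 0 by exact: lt_nbhsl.
  by apply: filterS => t t0; rewrite /flat ltNge (ltW t0).
- have near_f : \forall t \near x, (flat_poly n).[t^-1] * expR (- t^-1) = flat n t.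
    have : \forall t \near x, 0 < t by exact: lt_nbhsr.
    by apply: filterS => t t0; rewrite /flat t0.
  apply: (near_eq_is_derive near_f).
  have xn0 : x != 0 by rewrite gt_eqF.
  have d1 := @is_deriveV R id x _ 1 xn0 (is_derive_id _ _).
  have d2 := @is_derive1_comp R (horner (flat_poly n)) (fun y => (id y)^-1) x _ _ (is_derive_poly _ _) d1.
  have d3 := @is_derive1_comp R (@expR R) (fun y => - (id y)^-1) x _ _ (is_derive_expR _) (is_deriveN d1).
  have := is_deriveM d2 d3.
  move/is_derive_eq; apply; rewrite /flat x0 /= /GRing.scale/=.
  rewrite hornerM hornerXn hornerD hornerN.
  set a := horner _ _; set b := horner _ _; set e := expR _.
  by field.
- have [C [C0 HC]] := polyexp_bound ('X^2 * flat_poly n).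
  rewrite x0 {2}/flat ltxx.
  apply/is_derive1_caratheodory; exists (fun z => if 0 < z then z^-1 * flat n z else 0).
  split; last by rewrite ltxx.
    move=> z; rewrite {2}/flat ltxx !subr0; case: ifP => [z0|z0].
      by rewrite mulrAC mulVf ?mul1r// gt_eqF.
    by rewrite /flat z0 mul0r.
  have H z : `|if 0 < z then z^-1 * flat n z else 0| <= C * `|z|.
    case: ifP => [z0|_]; last by rewrite normr0 mulr_ge0.
    rewrite /flat z0 !normrM (gtr0_norm z0) gtr0_norm ?invr_gt0//.
    rewrite (gtr0_norm (expR_gt0 _)) expRN.
    have zi : 0 <= z^-1 by rewrite invr_ge0 ltW.
    have := HC _ zi; rewrite hornerM hornerXn normrM normrX (ger0_norm zi).
    rewrite mulrA ler_pdivrMr ?expR_gt0//.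
    move=> h; have := ler_wpM2l (ltW z0) h.
    rewrite [leLHS](_ : _ = z^-1 * `|(flat_poly n).[z^-1]|); last by field; rewrite gt_eqF.
    by move=> /le_trans; apply; rewrite le_eqVlt; apply/orP; left; apply/eqP; ring.
  rewrite /prop_for /continuous_at ltxx.
  apply/cvgrPdist_lt => e e0; near=> z.
  rewrite sub0r normrN; apply: le_lt_trans (H z) _.
  have zd : `|z| < e / (C + 1).
    near: z; have d0 : 0 < e / (C + 1) by rewrite divr_gt0//; lra.
    by exists (e / (C + 1)) => //= y /=; rewrite sub0r normrN.
  apply: (@le_lt_trans _ _ (C * (e / (C + 1)))); first by rewrite ler_wpM2l// ltW.
  by rewrite mulrA ltr_pdivrMr; [rewrite mulrC ltr_pM2l//; lra|lra].
Unshelve. all: by end_near. Qed.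

Lemma smooth1_flat : smooth1 (flat 0).
Proof. by apply: (@Smooth_tower flat); exact: flat_is_derive. Qed.

Lemma flat_gt0 x : 0 < x -> 0 < flat 0 x.
Proof. by move=> x0; rewrite /flat x0/= hornerE mul1r expR_gt0. Qed.

Lemma flat_le0 x : x <= 0 -> flat 0 x = 0.
Proof. by move=> x0; rewrite /flat ltNge x0. Qed.

(** Positive on ]1/4, 1[ and zero elsewhere, to be composed with multiples of the
squared distance; vanishing around [0] makes its divisions by the variable smooth. *)
Definition bump (s : R) : R := flat 0 (s - 1 / 4) * flat 0 (1 - s).

Lemma smooth1_affine (a b : R) : smooth1 (fun s => a * s + b).
Proof.
apply: (@Smooth_add (fun s => a * s) (fun=> b)); last exact: smooth1_cst.
apply: (@Smooth_mul (fun=> a) id); [exact: smooth1_cst|exact: smooth1_id].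
Qed.

Lemma smooth1_bump : smooth1 bump.
Proof.
apply: Smooth_mul.
  have := Smooth_comp smooth1_flat (smooth1_affine 1 (- (1 / 4))).
  by congr smooth1; apply/funext => s; rewrite mul1r.
have := Smooth_comp smooth1_flat (smooth1_affine (-1) 1).
by congr smooth1; apply/funext => s; rewrite mulN1r addrC.
Qed.

Lemma flat_ge0 x : 0 <= flat 0 x.
Proof. by have [/flat_le0->//|/flat_gt0/ltW] := leP x 0. Qed.

Lemma bump_ge0 s : 0 <= bump s.
Proof. by rewrite mulr_ge0// flat_ge0. Qed.

Lemma bump_gt0 s : 1 / 4 < s < 1 -> 0 < bump s.
Proof. by move=> /andP[a b]; rewrite mulr_gt0// flat_gt0// subr_gt0. Qed.

Lemma bump_left s : s <= 1 / 4 -> bump s = 0.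
Proof. by move=> h; rewrite /bump flat_le0 ?mul0r// subr_le0. Qed.

Lemma bump_right s : 1 <= s -> bump s = 0.
Proof. by move=> h; rewrite /bump (@flat_le0 (1 - s)) ?mulr0// subr_le0. Qed.

(** The theorem on segments applies from [a - 1], since nothing is lost on the left
of [a]. *)
Lemma primitive_exists f (a : R) : continuous f -> (forall x, x <= a -> f x = 0) ->
  exists F, (forall x : R, is_derive x 1 F (f x)) /\ forall x, x <= a -> F x = 0.
Proof.
move=> cf f0; pose mu := @lebesgue_measure R.
pose F x := (\int[mu]_(t in `[a - 1, x]) f t)%R.
have F0 x : x <= a -> F x = 0.
  move=> xa; rewrite /F /Rintegral.
  rewrite (eq_integral (cst 0%E)); last first.
    move=> t; rewrite inE/= in_itv/= => /andP[_ tx]; rewrite f0//.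
    exact: le_trans xa.
  by rewrite integral0.
exists F; split => // x.
have [xa|xa] := ltP x a.
  rewrite f0 ?ltW//.
  apply: (near_eq_is_derive _ (is_derive_cst 0 x 1)).
  have : \forall t \near x, t < a by exact: lt_nbhsl.
  by apply: filterS => t ta; rewrite F0// ltW.
have int : mu.-integrable `[a - 1, x + 1] (EFin \o f).
  apply: continuous_compact_integrable; first exact: segment_compact.
  exact: continuous_subspaceT.
have xx1 : x < x + 1 by rewrite ltrDl.
have ax : a - 1 < x by lra.
have [dF FE] := continuous_FTC1_closed xx1 int ax (cf x).
have {}FE : 'D_1 F x = f x by rewrite -derive1E.
exact: (DeriveDef dF FE).
Qed.

End Smooth1.

(** * Integration over boxes *)

Section PlaneMeasure.
Context {R : realType}.
Implicit Types (A U : set (plane R)) (g : plane R -> R).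

Let mu := @lebesgue_measure R.

Definition box (a1 b1 a2 b2 : R) : set (plane R) := `[a1, b1] `*` `[a2, b2].

(** An open set is a countable union of boxes with rational corners. *)
Lemma open_measurable2 A : open A ->
  measurable (A : set (measurableTypeR R * measurableTypeR R)).
Proof.
move=> oA; pose I (a b : rat) : set R := `]ratr a, ratr b[%classic.
pose F a b c d : set (plane R) := if `[< I a b `*` I c d `<=` A >] then I a b `*` I c d else set0.
have -> : A = \bigcup_a \bigcup_b \bigcup_c \bigcup_d F a b c d.
  apply/seteqP; split => [X AX|X [a _ [b _ [c _ [d _]]]]]; last first.
    by rewrite /F; case: asboolP => // IA; exact: IA.
  have : nbhs X A by apply: open_nbhs_nbhs.
  case: X AX => x y AX [[A1 A2] /= [[e /= e0 H1] [e' /= e'0 H2]] H].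
  have [a] := @rat_in_itvoo R (x - e) x ltac:(lra).
  have [b] := @rat_in_itvoo R x (x + e) ltac:(lra).
  have [c] := @rat_in_itvoo R (y - e') y ltac:(lra).
  have [d] := @rat_in_itvoo R y (y + e') ltac:(lra).
  rewrite !in_itv/= => /andP[d1 d2] /andP[c1 c2] /andP[b1 b2] /andP[a1 a2].
  exists a => //; exists b => //; exists c => //; exists d => //.
  rewrite /F asboolT; first by split; rewrite /I/= in_itv/= ?a2 ?b1 ?c2 ?d1.
  move=> [s t] [/=]; rewrite /I/= !in_itv/= => /andP[s1 s2] /andP[t1 t2].
  apply: H; split => /=; [apply: H1|apply: H2]; rewrite /= ltr_distlC; lra.
apply: bigcupT_measurable_rat => a; apply: bigcupT_measurable_rat => b.
apply: bigcupT_measurable_rat => c; apply: bigcupT_measurable_rat => d.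
rewrite /F; case: asboolP => // _.
by apply: measurableX; exact: measurable_itv.
Qed.

Lemma measurable_box a1 b1 a2 b2 :
  measurable (box a1 b1 a2 b2 : set (measurableTypeR R * measurableTypeR R)).
Proof. by apply: measurableX; exact: measurable_itv. Qed.

Lemma measurable_fun_cont U (D : set (plane R)) g : open U ->
  (forall X, U X -> {for X, continuous g}) -> D `<=` U ->
  measurable (D : set (measurableTypeR R * measurableTypeR R)) ->
  measurable_fun (D : set (measurableTypeR R * measurableTypeR R)) g.
Proof.
move=> oU cg DU mD; apply: (measurability _ (measurable_realfun.RGenOpens.measurableE R)).
move=> _ [_ [a [b ->] <-]].
rewrite (_ : D `&` _ = D `&` (U `&` g @^-1` `]a, b[%classic)); last first.
  by rewrite setIA (setIidl DU).
apply: measurableI => //; apply: open_measurable2.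
rewrite openE => X [UX gX]; apply: filterI; first exact: open_nbhs_nbhs.
have : nbhs (g X) (`]a, b[%classic : set R).
  by apply: open_nbhs_nbhs; split => //; exact: interval_open.
exact: cg.
Qed.

Lemma box_finite a1 b1 a2 b2 : ((@lebesgue2 R) (box a1 b1 a2 b2) < +oo)%E.
Proof.
have -> : (@lebesgue2 R) (box a1 b1 a2 b2) = (mu `[a1, b1] * mu `[a2, b2])%E.
  by apply: product_measure1E; exact: measurable_itv.
rewrite /mu !lebesgue_measure_itv/=; do 2 case: ifP => _;
  by rewrite ?mule0 ?mul0e ?ltry// -!EFinB -EFinM ltry.
Qed.

Lemma compact_box a1 b1 a2 b2 : compact (box a1 b1 a2 b2).
Proof. by apply: compact_setX; exact: segment_compact. Qed.

Lemma cont_bounded U (K : set (plane R)) g : compact K -> K `<=` U -> open U ->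
  (forall X, U X -> {for X, continuous g}) -> exists M, forall X, K X -> `|g X| <= M.
Proof.
move=> cK KU oU cg.
have [->|/set0P K0] := eqVneq K set0; first by exists 0.
have ch : {within K, continuous (fun X => `|g X|)}.
  apply: (continuous_subspaceW KU).
  rewrite (continuous_open_subspace _ oU) => X; rewrite inE => UX.
  by apply: (@continuous_comp _ _ _ g (fun r : R => `|r|)); [exact: cg|exact: norm_continuous].
have [c cK' Hc] := compact_EVT_max K0 cK ch.
by exists `|g c| => X KX; apply: Hc; rewrite inE.
Qed.

Lemma integrable_bounded (D : set (plane R)) g a1 b1 a2 b2 : D = box a1 b1 a2 b2 ->
  measurable_fun (D : set (measurableTypeR R * measurableTypeR R)) g ->
  (exists M, forall X, D X -> `|g X| <= M) ->
  (@lebesgue2 R).-integrable D (EFin \o g).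
Proof.
move=> -> mg [M HM]; apply: measurable_bounded_integrable => //.
- exact: measurable_box.
- exact: box_finite.
- exists M; split; first exact: num_real.
  by move=> x Mx y By; apply: le_trans (HM _ By) (ltW Mx).
Qed.

Lemma integrable_box U g a1 b1 a2 b2 : open U ->
  (forall X, U X -> {for X, continuous g}) -> box a1 b1 a2 b2 `<=` U ->
  (@lebesgue2 R).-integrable (box a1 b1 a2 b2) (EFin \o g).
Proof.
move=> oU cg BU; apply: integrable_bounded => //.
  by apply: (measurable_fun_cont oU) => //; exact: measurable_box.
exact: (cont_bounded (@compact_box a1 b1 a2 b2) BU oU cg).
Qed.

(** The slices are allowed to vanish in either direction: each second derivative in
Green's identity is integrated first in its own variable. *)
Lemma fubini_zero U g a1 b1 a2 b2 : open U ->
  (forall X, U X -> {for X, continuous g}) -> box a1 b1 a2 b2 `<=` U ->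
  (forall y, a2 <= y <= b2 -> (\int[mu]_(x in `[a1, b1]) (g (x, y))%:E = 0)%E) \/
  (forall x, a1 <= x <= b1 -> (\int[mu]_(y in `[a2, b2]) (g (x, y))%:E = 0)%E) ->
  \int[@lebesgue2 R]_(X in box a1 b1 a2 b2) g X = 0.
Proof.
move=> oU cg BU int0.
set B := box a1 b1 a2 b2.
have ig := integrable_box oU cg BU.
pose f := ((EFin \o g) \_ B).
have iff : (@lebesgue2 R).-integrable setT f.
  have mB' := measurable_box a1 b1 a2 b2.
  apply: (integrable_restrict (@lebesgue2 R) mB' measurableT (EFin \o g)).1.
  by rewrite setTI.
have mB := measurable_box a1 b1 a2 b2.
rewrite /Rintegral integral_mkcond -/f.
have fE x y : f (x, y) = if (x \in `[a1, b1]) && (y \in `[a2, b2]) then (g (x, y))%:E else 0%E.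
  by rewrite /f /patch /B /box -[(x, y) \in _]/((x, y) \in (_ `*` _)) in_setX/= !mem_setE.
case: int0 => int0.
  rewrite -integral21_prod_meas1//.
  rewrite /fubini_G (eq_integral (cst 0%E)) ?integral0// => y _.
  have [yB|yB] := boolP (y \in `[a2, b2]); last first.
    rewrite (eq_integral (cst 0%E)) ?integral0// => x _.
    by rewrite fE (negbTE yB) andbF.
  rewrite -(int0 y); last by move: yB; rewrite in_itv.
  rewrite [RHS]integral_mkcond; apply: eq_integral => x _.
  by rewrite fE yB andbT /patch mem_setE.
rewrite -integral12_prod_meas1//.
rewrite /fubini_F (eq_integral (cst 0%E)) ?integral0// => x _.
have [xB|xB] := boolP (x \in `[a1, b1]); last first.
  rewrite (eq_integral (cst 0%E)) ?integral0// => y _.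
  by rewrite fE (negbTE xB).
rewrite -(int0 x); last by move: xB; rewrite in_itv.
rewrite [RHS]integral_mkcond; apply: eq_integral => y _.
by rewrite fE xB /patch mem_setE.
Qed.

End PlaneMeasure.

(** * Smooth functions of the plane *)

Section Smooth2.
Context {R : realType}.
Implicit Types (f g u : plane R -> R) (X P Y : plane R).

Lemma is_derive_e1 f X (a : R) :
  is_derive X (e1 : plane R) f a <-> is_derive X.1 1 (fun t : R => f (t, X.2)) a.
Proof.
have E : (fun h : R => h^-1 *: ((f \o shift X) (h *: (e1 : plane R)) - f X)) =
         (fun h : R => h^-1 *: (((fun t : R => f (t, X.2)) \o shift X.1) (h *: 1) - f (X.1, X.2))).
  apply/funext => h /=; congr (_ *: (f _ - f _)); last exact: surjective_pairing.
  by rewrite [LHS]surjective_pairing /= /GRing.scale/= mulr0 add0r.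
by split=> -[d1 d2]; constructor; rewrite /derivable /derive /= ?E -?E // in d1 d2 *.
Qed.

Lemma is_derive_e2 f X (a : R) :
  is_derive X (e2 : plane R) f a <-> is_derive X.2 1 (fun t : R => f (X.1, t)) a.
Proof.
have E : (fun h : R => h^-1 *: ((f \o shift X) (h *: (e2 : plane R)) - f X)) =
         (fun h : R => h^-1 *: (((fun t : R => f (X.1, t)) \o shift X.2) (h *: 1) - f (X.1, X.2))).
  apply/funext => h /=; congr (_ *: (f _ - f _)); last exact: surjective_pairing.
  by rewrite [LHS]surjective_pairing /= /GRing.scale/= mulr0 add0r.
by split=> -[d1 d2]; constructor; rewrite /derivable /derive /= ?E -?E // in d1 d2 *.
Qed.

(** The counterpart of [smooth1] in two variables, rich enough for radial test
functions and closed under both partial derivatives. *)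
Inductive smooth2 : (plane R -> R) -> Prop :=
| Smooth2_cst c : smooth2 (fun=> c)
| Smooth2_fst : smooth2 fst
| Smooth2_snd : smooth2 snd
| Smooth2_add f g of smooth2 f & smooth2 g : smooth2 (fun X => f X + g X)
| Smooth2_mul f g of smooth2 f & smooth2 g : smooth2 (fun X => f X * g X)
| Smooth2_comp F f of smooth1 F & smooth2 f : smooth2 (fun X => F (f X)).

Lemma smooth2_continuous f : smooth2 f -> continuous f.
Proof.
elim=> [c|||{}f g _ cf _ cg|{}f g _ cf _ cg|F {}f sF _ cf] X.
- exact: cst_continuous.
- exact: fst_cont.
- exact: snd_cont.
- exact: continuousD (cf X) (cg X).
- exact: continuousM (cf X) (cg X).
- apply: (@continuous_comp _ _ _ f F); first exact: cf.
  exact: (@smooth1_continuous R F sF (f X)).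
Qed.

Lemma smooth2_derive f : smooth2 f -> exists fx fy, [/\ smooth2 fx, smooth2 fy,
  forall X, is_derive X (e1 : plane R) f (fx X) & forall X, is_derive X (e2 : plane R) f (fy X)].
Proof.
elim=> [c|||{}f g _ [fx [fy [s1 s2 h1 h2]]] _ [gx [gy [s3 s4 h3 h4]]]
  |{}f g sf [fx [fy [s1 s2 h1 h2]]] sg [gx [gy [s3 s4 h3 h4]]]|F {}f sF sf [fx [fy [s1 s2 h1 h2]]]].
- exists (fun=> 0), (fun=> 0); split; try exact: Smooth2_cst.
    by move=> X; exact: is_derive_cst.
  by move=> X; exact: is_derive_cst.
- exists (fun=> 1), (fun=> 0); split; try exact: Smooth2_cst.
    by move=> X; apply/is_derive_e1; exact: is_derive_id.
  by move=> X; apply/is_derive_e2; exact: is_derive_cst.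
- exists (fun=> 0), (fun=> 1); split; try exact: Smooth2_cst.
    by move=> X; apply/is_derive_e1; exact: is_derive_cst.
  by move=> X; apply/is_derive_e2; exact: is_derive_id.
- exists (fun X => fx X + gx X), (fun X => fy X + gy X); split.
  + exact: Smooth2_add.
  + exact: Smooth2_add.
  + by move=> X; exact: is_deriveD (h1 X) (h3 X).
  + by move=> X; exact: is_deriveD (h2 X) (h4 X).
- exists (fun X => f X * gx X + g X * fx X), (fun X => f X * gy X + g X * fy X); split.
  + by apply: Smooth2_add; apply: Smooth2_mul.
  + by apply: Smooth2_add; apply: Smooth2_mul.
  + by move=> X; exact: is_deriveM (h1 X) (h3 X).
  + by move=> X; exact: is_deriveM (h2 X) (h4 X).
- have [F' sF' FF'] := smooth1_derive sF.
  exists (fun X => F' (f X) * fx X), (fun X => F' (f X) * fy X); split.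
  + by apply: Smooth2_mul => //; exact: Smooth2_comp.
  + by apply: Smooth2_mul => //; exact: Smooth2_comp.
  + move=> [x y]; apply/is_derive_e1 => /=.
    have /is_derive_e1/= d := h1 (x, y).
    exact: (@is_derive1_comp R F (fun t : R => f (t, y)) x _ _ (FF' _) d).
  + move=> [x y]; apply/is_derive_e2 => /=.
    have /is_derive_e2/= d := h2 (x, y).
    exact: (@is_derive1_comp R F (fun t : R => f (x, t)) y _ _ (FF' _) d).
Qed.

Lemma smooth2_pderiv f s : smooth2 f -> smooth2 (pderiv s f).
Proof.
move=> sf; elim: s => [//|b s IH] /=.
have [fx [fy [s1 s2 h1 h2]]] := smooth2_derive IH.
case: b.
  by rewrite (_ : 'D_e2 _ = fy)//; apply/funext => X; have [] := h2 X.
by rewrite (_ : 'D_e1 _ = fx)//; apply/funext => X; have [] := h1 X.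
Qed.

Lemma smooth2_smooth_on f : smooth2 f -> smooth_on setT f.
Proof.
move=> sf k s _ X _; have sp := smooth2_pderiv s sf.
split; first exact: smooth2_continuous.
have [fx [fy [_ _ h1 h2]]] := smooth2_derive sp.
by move=> _; split; [have [] := h1 X|have [] := h2 X].
Qed.

Lemma smooth2_sqd P : smooth2 (sqd P).
Proof.
have h1 : smooth2 (fun X => X.1 - P.1) by apply: Smooth2_add; [exact: Smooth2_fst|exact: Smooth2_cst].
have h2 : smooth2 (fun X => X.2 - P.2) by apply: Smooth2_add; [exact: Smooth2_snd|exact: Smooth2_cst].
by apply: Smooth2_add; apply: Smooth2_mul.
Qed.

Lemma smooth2_radial F P : smooth1 F -> smooth2 (fun Y => F (sqd P Y)).
Proof. by move=> sF; apply: Smooth2_comp => //; exact: smooth2_sqd. Qed.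

Lemma radial_derivs (F F' F'' : R -> R) P : (forall x : R, is_derive x 1 F (F' x)) ->
  (forall x : R, is_derive x 1 F' (F'' x)) ->
  let f Y := F (sqd P Y) in
  [/\ 'D_e1 f = (fun Y => F' (sqd P Y) * (2 * (Y.1 - P.1))),
      'D_e2 f = (fun Y => F' (sqd P Y) * (2 * (Y.2 - P.2))),
      'D_e1 ('D_e1 f) = (fun Y => F'' (sqd P Y) * (2 * (Y.1 - P.1)) ^+ 2 + 2 * F' (sqd P Y)) &
      'D_e2 ('D_e2 f) = (fun Y => F'' (sqd P Y) * (2 * (Y.2 - P.2)) ^+ 2 + 2 * F' (sqd P Y))].
Proof.
move=> h h' f.
have d1 (H H' : R -> R) Y : (forall x : R, is_derive x 1 H (H' x)) ->
    is_derive Y (e1 : plane R) (fun Y => H (sqd P Y)) (H' (sqd P Y) * (2 * (Y.1 - P.1))).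
  move=> hH; apply/is_derive_e1.
  have [_ [b [d [j1 _ _]]]] := jet_sqd P Y.
  exact: (@is_derive1_comp R H (fun t => sqd P (t, Y.2)) Y.1 _ _ (hH _) (jet2_deriv j1)).
have d2 (H H' : R -> R) Y : (forall x : R, is_derive x 1 H (H' x)) ->
    is_derive Y (e2 : plane R) (fun Y => H (sqd P Y)) (H' (sqd P Y) * (2 * (Y.2 - P.2))).
  move=> hH; apply/is_derive_e2.
  have [_ [b [d [_ j2 _]]]] := jet_sqd P Y.
  exact: (@is_derive1_comp R H (fun t => sqd P (Y.1, t)) Y.2 _ _ (hH _) (jet2_deriv j2)).
have E1 : 'D_e1 f = (fun Y => F' (sqd P Y) * (2 * (Y.1 - P.1))).
  by apply/funext => Y; have [] := d1 _ _ Y h.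
have E2 : 'D_e2 f = (fun Y => F' (sqd P Y) * (2 * (Y.2 - P.2))).
  by apply/funext => Y; have [] := d2 _ _ Y h.
split => //.
- rewrite E1; apply/funext => Y.
  have j : is_derive Y (e1 : plane R) (fun Y => 2 * (Y.1 - P.1)) 2.
    apply/is_derive_e1; have [_ [b [d [j1 _ _]]]] := jetZ 2 (jet_fstB P.1 Y).
    by apply: is_derive_eq (jet2_deriv j1) _; rewrite mulr1.
  have [_ ->] := is_deriveM (d1 _ _ Y h') j.
  by rewrite /GRing.scale/=; ring.
- rewrite E2; apply/funext => Y.
  have j : is_derive Y (e2 : plane R) (fun Y => 2 * (Y.2 - P.2)) 2.
    apply/is_derive_e2; have [_ [b [d [_ j2 _]]]] := jetZ 2 (jet_sndB P.2 Y).
    by apply: is_derive_eq (jet2_deriv j2) _; rewrite mulr1.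
  have [_ ->] := is_deriveM (d2 _ _ Y h') j.
  by rewrite /GRing.scale/=; ring.
Qed.

Lemma radial_laplacian (F F' F'' : R -> R) P X : (forall x : R, is_derive x 1 F (F' x)) ->
  (forall x : R, is_derive x 1 F' (F'' x)) ->
  laplacian (fun Y => F (sqd P Y)) X = 4 * (sqd P X * F'' (sqd P X) + F' (sqd P X)).
Proof.
move=> h h'; have [_ _ E1 E2] := radial_derivs P h h'.
have E := f_equal2 (fun a b : R => a + b) (congr1 (fun g : plane R -> R => g X) E1)
  (congr1 (fun g : plane R -> R => g X) E2).
apply: (eq_trans E); cbv beta.
set a := F'' _; set b := F' _; rewrite /sqd; ring.
Qed.

Lemma Ck_jet U u X : open U -> Ck_on U 2 u -> U X ->
  jet u X ('D_e1 u X) ('D_e2 u X) (laplacian u X).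
Proof.
move=> oU cu UX.
have c0 Y : U Y -> {for Y, continuous u} /\ (derivable u Y e1 /\ derivable u Y e2).
  by move=> UY; have [? h] := cu [::] isT Y UY; split => //; exact: h.
have c1 Y : U Y -> derivable ('D_e1 u) Y e1.
  by move=> UY; have [_ h] := cu [:: false] isT Y UY; exact: (h isT).1.
have c2 Y : U Y -> derivable ('D_e2 u) Y e2.
  by move=> UY; have [_ h] := cu [:: true] isT Y UY; exact: (h isT).2.
have nU : \forall Y \near X, U Y by apply: open_nbhs_nbhs.
split; first by have [] := c0 X UX.
exists ('D_e1 ('D_e1 u) X), ('D_e2 ('D_e2 u) X); split => //.
- exists (fun t => 'D_e1 u (t, X.2)); split.
  + have := near_slice1 nU; apply: filterS => t Ut.
    have [_ [/derivableP + _]] := c0 _ Ut; by move=> /is_derive_e1.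
  + by rewrite -surjective_pairing.
  + by have /derivableP/is_derive_e1 := c1 X UX.
- exists (fun t => 'D_e2 u (X.1, t)); split.
  + have := near_slice2 nU; apply: filterS => t Ut.
    have [_ [_ /derivableP]] := c0 _ Ut; by move=> /is_derive_e2.
  + by rewrite -surjective_pairing.
  + by have /derivableP/is_derive_e2 := c2 X UX.
Qed.

End Smooth2.

(** * Green's identity on squares *)

Section Green.
Context {R : realType}.
Implicit Types (u : plane R -> R) (X P Y : plane R) (U : set (plane R)).

Let mu := @lebesgue_measure R.

Lemma integral_derivative_zero (W w : R -> R) (a b : R) : a < b ->
  (forall x : R, a <= x <= b -> is_derive x 1 W (w x)) ->
  (forall x : R, a <= x <= b -> {for x, continuous w}) -> W a = 0 -> W b = 0 ->
  (\int[mu]_(x in `[a, b]) (w x)%:E = 0)%E.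
Proof.
move=> ab dW cw Wa Wb.
have cW x : a <= x <= b -> {for x, continuous W} by move=> /dW; exact: is_derive_continuous.
rewrite (@continuous_FTC2 R w W a b ab).
- by rewrite Wa Wb subee.
- by apply: continuous_in_subspaceT => x; rewrite inE/= in_itv/= => h; exact: cw.
- split.
  + by move=> x; rewrite in_itv/= => /andP[h1 h2]; have [] := dW x; rewrite ?(ltW h1) ?(ltW h2).
  + by apply: cvg_at_right_filter; apply: cW; rewrite lexx ltW.
  + by apply: cvg_at_left_filter; apply: cW; rewrite lexx ltW.
- move=> x; rewrite in_itv/= => /andP[h1 h2]; rewrite derive1E.
  by have [] := dW x; rewrite ?(ltW h1) ?(ltW h2).
Qed.

Definition square P (r : R) := box (P.1 - r) (P.1 + r) (P.2 - r) (P.2 + r).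

Lemma square_sqd P r Y : 0 <= r -> ~ square P r Y -> r ^+ 2 < sqd P Y.
Proof.
move=> r0; rewrite /square /box/= !in_itv/= => h.
have : r < `|Y.1 - P.1| \/ r < `|Y.2 - P.2|.
  apply: contrapT => /not_orP[/negP + /negP]; rewrite -!leNgt => h1 h2.
  by apply: h; rewrite -!ler_distlC !(distrC _ Y.1) !(distrC _ Y.2).
have sq (a : R) : r < `|a| -> r ^+ 2 < a ^+ 2.
  by move=> ra; rewrite -[a ^+ 2]real_normK ?num_real// ltr_pXn2r ?nnegrE.
by case=> /sq k; apply: lt_le_trans k _; rewrite ?lerDl ?lerDr sqr_ge0.
Qed.

Lemma Ck2_continuous U u X : open U -> Ck_on U 2 u -> U X ->
  [/\ {for X, continuous u}, {for X, continuous ('D_e1 ('D_e1 u))} & {for X, continuous ('D_e2 ('D_e2 u))}].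
Proof.
move=> oU cu UX; split.
- by have [] := cu [::] isT X UX.
- by have [h _] := cu [:: false; false] isT X UX.
- by have [h _] := cu [:: true; true] isT X UX.
Qed.

Lemma measurable_square P r :
  measurable (square P r : set (measurableTypeR R * measurableTypeR R)).
Proof. exact: measurable_box. Qed.

(** The difference of the two integrands splits into the terms
[d_i (u d_i f - f d_i u)], whose primitive in the i-th variable vanishes on the
sides of the square because [f] does to first order. *)
Lemma green_square U u P r (F F' F'' : R -> R) (rho : R) : open U -> Ck_on U 2 u -> 0 < r ->
  square P r `<=` U -> smooth1 F -> smooth1 F'' ->
  (forall x : R, is_derive x 1 F (F' x)) ->
  (forall x : R, is_derive x 1 F' (F'' x)) ->
  rho < r ^+ 2 -> (forall s, rho <= s -> F s = 0) ->
  let f Y := F (sqd P Y) in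
  \int[@lebesgue2 R]_(Y in square P r) (u Y * laplacian f Y) =
  \int[@lebesgue2 R]_(Y in square P r) (laplacian u Y * f Y).
Proof.
move=> oU cu r0 QU sF sF'' hF hF' rhor F0 f.
have [E1 E2 E11 E22] := radial_derivs P hF hF'.
rewrite -/f in E1 E2 E11 E22.
have E1' Y : 'D_e1 f Y = F' (sqd P Y) * (2 * (Y.1 - P.1)) := congr1 (fun h => h Y) E1.
have E2' Y : 'D_e2 f Y = F' (sqd P Y) * (2 * (Y.2 - P.2)) := congr1 (fun h => h Y) E2.
have wronskian (a b c d k m : R) : a * b + c * d - (d * c + m * k) = a * b - k * m.
  by ring.
have F'0 s : rho < s -> F' s = 0.
  move=> rs; apply: (derivative_near0 _ (hF s)).
  have : \forall t \near s, rho < t by exact: lt_nbhsr.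
  by apply: filterS => t /ltW; exact: F0.
have outf a b : r ^+ 2 <= sqd P (a, b) -> f (a, b) = 0 /\ F' (sqd P (a, b)) = 0.
  move=> h; split; first by apply: F0; apply: ltW; exact: lt_le_trans h.
  by apply: F'0; exact: lt_le_trans h.
have sf : smooth2 f by exact: smooth2_radial.
have cf : continuous f by exact: smooth2_continuous.
have cf11 : continuous ('D_e1 ('D_e1 f)).
  by apply: smooth2_continuous; exact: (@smooth2_pderiv R f [:: false; false]).
have cf22 : continuous ('D_e2 ('D_e2 f)).
  by apply: smooth2_continuous; exact: (@smooth2_pderiv R f [:: true; true]).
have jf Y : jet f Y ('D_e1 f Y) ('D_e2 f Y) (laplacian f Y).
  apply: (@Ck_jet _ setT) => //; first exact: openT.
  exact: (smooth2_smooth_on sf).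
pose g1 Y := u Y * 'D_e1 ('D_e1 f) Y - 'D_e1 ('D_e1 u) Y * f Y.
pose g2 Y := u Y * 'D_e2 ('D_e2 f) Y - 'D_e2 ('D_e2 u) Y * f Y.
have cg1 X : U X -> {for X, continuous g1}.
  move=> UX; have [cu0 cu1 _] := Ck2_continuous oU cu UX.
  have c11 : {for X, continuous ('D_e1 ('D_e1 f))} by exact: cf11.
  have c0 : {for X, continuous f} by exact: cf.
  exact: (continuousB (continuousM cu0 c11) (continuousM cu1 c0)).
have cg2 X : U X -> {for X, continuous g2}.
  move=> UX; have [cu0 _ cu2] := Ck2_continuous oU cu UX.
  have c22 : {for X, continuous ('D_e2 ('D_e2 f))} by exact: cf22.
  have c0 : {for X, continuous f} by exact: cf.
  exact: (continuousB (continuousM cu0 c22) (continuousM cu2 c0)).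
have dx (v : plane R -> R) (V : set (plane R)) Y : open V -> Ck_on V 2 v -> V Y ->
    is_derive Y.1 1 (fun t => v (t, Y.2)) ('D_e1 v Y) /\
    is_derive Y.1 1 (fun t => 'D_e1 v (t, Y.2)) ('D_e1 ('D_e1 v) Y).
  move=> oV cv VY; split.
    have [_ h] := cv [::] isT Y VY.
    exact: (is_derive_e1 v Y _).1 (derivableP (h isT).1).
  have [_ h] := cv [:: false] isT Y VY.
  exact: (is_derive_e1 ('D_e1 v) Y _).1 (derivableP (h isT).1).
have dy (v : plane R -> R) (V : set (plane R)) Y : open V -> Ck_on V 2 v -> V Y ->
    is_derive Y.2 1 (fun t => v (Y.1, t)) ('D_e2 v Y) /\
    is_derive Y.2 1 (fun t => 'D_e2 v (Y.1, t)) ('D_e2 ('D_e2 v) Y).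
  move=> oV cv VY; split.
    have [_ h] := cv [::] isT Y VY.
    exact: (is_derive_e2 v Y _).1 (derivableP (h isT).2).
  have [_ h] := cv [:: true] isT Y VY.
  exact: (is_derive_e2 ('D_e2 v) Y _).1 (derivableP (h isT).2).
have sfo : Ck_on setT 2 f by exact: (@smooth2_smooth_on R f sf 2).
have rP (p : R) : p - r < p + r by lra.
have I1 : \int[@lebesgue2 R]_(X in square P r) g1 X = 0.
  apply: (fubini_zero oU cg1 QU); left => y hy.
  apply: (@integral_derivative_zero (fun x => u (x, y) * 'D_e1 f (x, y) - 'D_e1 u (x, y) * f (x, y))) => //.
  - move=> x hx; have Uxy : U (x, y) by apply: QU; split; rewrite /= in_itv.
    have [/= u1 u2] := dx u U _ oU cu Uxy.
    have [/= f1 f2] := dx f setT (x, y) openT sfo I.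
    have := is_deriveB (is_deriveM u1 f2) (is_deriveM u2 f1).
    move/is_derive_eq; apply; rewrite /g1 /GRing.scale/=.
    by apply: wronskian.
  - move=> x hx; have Uxy : U (x, y) by apply: QU; split; rewrite /= in_itv.
    apply: (@continuous_comp _ _ _ (fun x => (x, y)) g1); last exact: cg1.
    by apply: continuous_pair; [exact: cvg_id|exact: cst_continuous].
  - rewrite E1'; have [|-> ->] := outf (P.1 - r) y; last by rewrite mul0r !mulr0 subrr.
    by rewrite /sqd/= addrAC subrr add0r sqrrN lerDl sqr_ge0.
  - rewrite E1'; have [|-> ->] := outf (P.1 + r) y; last by rewrite mul0r !mulr0 subrr.
    by rewrite /sqd/= addrAC subrr add0r lerDl sqr_ge0.
have I2 : \int[@lebesgue2 R]_(X in square P r) g2 X = 0.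
  apply: (fubini_zero oU cg2 QU); right => x hx.
  apply: (@integral_derivative_zero (fun y => u (x, y) * 'D_e2 f (x, y) - 'D_e2 u (x, y) * f (x, y))) => //.
  - move=> y hy; have Uxy : U (x, y) by apply: QU; split; rewrite /= in_itv.
    have [/= u1 u2] := dy u U _ oU cu Uxy.
    have [/= f1 f2] := dy f setT (x, y) openT sfo I.
    have := is_deriveB (is_deriveM u1 f2) (is_deriveM u2 f1).
    move/is_derive_eq; apply; rewrite /g2 /GRing.scale/=.
    by apply: wronskian.
  - move=> y hy; have Uxy : U (x, y) by apply: QU; split; rewrite /= in_itv.
    apply: (@continuous_comp _ _ _ (fun y => (x, y)) g2); last exact: cg2.
    by apply: continuous_pair; [exact: cst_continuous|exact: cvg_id].
  - rewrite E2'; have [|-> ->] := outf x (P.2 - r); last by rewrite mul0r !mulr0 subrr.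
    by rewrite /sqd/= (addrAC P.2) subrr add0r sqrrN lerDr sqr_ge0.
  - rewrite E2'; have [|-> ->] := outf x (P.2 + r); last by rewrite mul0r !mulr0 subrr.
    by rewrite /sqd/= (addrAC P.2) subrr add0r lerDr sqr_ge0.
have mQ := measurable_square P r.
have iQ h : (forall X, U X -> {for X, continuous h}) ->
    (@lebesgue2 R).-integrable (square P r) (EFin \o h).
  by move=> ch; exact: (integrable_box oU ch QU).
have ig1 := iQ _ cg1; have ig2 := iQ _ cg2.
have cul X : U X -> {for X, continuous (fun Y => u Y * laplacian f Y)}.
  move=> UX; have [cu0 _ _] := Ck2_continuous oU cu UX.
  have c11 : {for X, continuous ('D_e1 ('D_e1 f))} by exact: cf11.
  have c22 : {for X, continuous ('D_e2 ('D_e2 f))} by exact: cf22.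
  exact: (continuousM cu0 (continuousD c11 c22)).
have clu X : U X -> {for X, continuous (fun Y => laplacian u Y * f Y)}.
  move=> UX; have [_ cu1 cu2] := Ck2_continuous oU cu UX.
  have c0 : {for X, continuous f} by exact: cf.
  exact: (continuousM (continuousD cu1 cu2) c0).
have il := iQ _ cul; have ir := iQ _ clu.
have ED : \int[@lebesgue2 R]_(X in square P r) (g1 X + g2 X) = 0.
  apply: (eq_trans (RintegralD mQ ig1 ig2)).
  by apply: (eq_trans (f_equal2 +%R I1 I2)); exact: addr0.
have EB := RintegralB mQ il ir.
apply/eqP; rewrite -subr_eq0; apply/eqP; apply: (eq_trans (esym EB)).
apply: (eq_trans _ ED); apply: eq_Rintegral => X _.
have split_lap (a b c d k m : R) :
  a * (b + c) - (d + k) * m = (a * b - d * m) + (a * c - k * m) by ring.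
exact: split_lap.
Qed.

Lemma positive_integral (D : set (plane R)) (g : plane R -> R) P (r m : R) :
  measurable (D : set (measurableTypeR R * measurableTypeR R)) ->
  (@lebesgue2 R).-integrable D (EFin \o g) ->
  0 < r -> square P r `<=` D -> 0 < m -> (forall X, D X -> 0 <= g X) ->
  (forall X, square P r X -> m <= g X) ->
  m * (4 * r ^+ 2) <= \int[@lebesgue2 R]_(X in D) g X.
Proof.
move=> mD ig r0 sD m0 g0 gm.
have mQ := measurable_square P r.
have igQ := integrableS mD mQ sD ig.
have muQ : (@lebesgue2 R) (square P r) = (4 * r ^+ 2)%:E.
  have -> : (@lebesgue2 R) (square P r) = (mu `[(P.1 - r)%R, (P.1 + r)%R] * mu `[(P.2 - r)%R, (P.2 + r)%R])%E.
    by apply: product_measure1E; exact: measurable_itv.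
  rewrite /mu !lebesgue_measure_itv/= !lte_fin.
  by rewrite !ifT ?ltrD2l ?gtrN// -!EFinB -EFinM; congr EFin; ring.
have imQ : (@lebesgue2 R).-integrable (square P r) (EFin \o (fun=> m)).
  apply: measurable_bounded_integrable => //.
    by apply: (@eq_ind _ _ (fun e => (e < +oo)%E) _ _ (esym muQ)); exact: ltry.
  exact: bounded_cst.
have -> : m * (4 * r ^+ 2) = \int[@lebesgue2 R]_(X in square P r) m.
  apply/esym; apply: (eq_trans (@Rintegral_cst _ _ R (@lebesgue2 R) _ mQ m)); congr (_ * _).
  exact: (congr1 fine muQ).
apply: (@le_trans _ _ (\int[@lebesgue2 R]_(X in square P r) g X)).
  by apply: le_Rintegral => // X /gm.
rewrite /Rintegral fine_le//.
- exact: integrable_fin_num.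
- exact: integrable_fin_num.
- apply: ge0_subset_integral => //; first by move/integrableP: ig => [].
Qed.

Lemma integral_gt0_square U (g : plane R -> R) P (r : R) Q : open U ->
  (forall X, U X -> {for X, continuous g}) -> square P r `<=` U ->
  (forall X, square P r X -> 0 <= g X) ->
  `|Q.1 - P.1| < r /\ `|Q.2 - P.2| < r -> 0 < g Q ->
  0 < \int[@lebesgue2 R]_(X in square P r) g X.
Proof.
move=> oU cg QU g0 [Q1 Q2] gQ.
have sQ : square P r Q.
  by split; rewrite /= in_itv/= -ler_distlC distrC ltW.
have [|d d0 Hd] := @near_rdisk _ Q (fun Y => g Q / 2 < g Y).
  by apply: (near_gt (cg _ (QU _ sQ))); lra.
pose m := Num.min (r - `|Q.1 - P.1|) (r - `|Q.2 - P.2|).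
pose e := Num.min (d / 2) m.
have m0 : 0 < m by rewrite lt_min !subr_gt0 Q1.
have e0 : 0 < e by rewrite lt_min m0 andbT divr_gt0.
have [ed em] := ge_minlr (d / 2) m; rewrite -/e in ed em.
have [m1 m2] := ge_minlr (r - `|Q.1 - P.1|) (r - `|Q.2 - P.2|).
rewrite -/m in m1 m2.
have near (a p q : R) : e <= r - `|q - p| -> q - e <= a <= q + e -> p - r <= a <= p + r.
  move=> h /andP[h1 h2]; have := ler_norm (q - p); have := ler_norm (- (q - p)).
  by rewrite normrN; lra.
have sub : square Q e `<=` square P r.
  move=> [x y] []; rewrite /square /box/= !in_itv/= => hx hy.
  by split; [apply: (near _ _ _ (le_trans em m1))|apply: (near _ _ _ (le_trans em m2))].
have g2 : 0 < g Q / 2 by rewrite divr_gt0.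
have ig : (@lebesgue2 R).-integrable (square P r) (EFin \o g).
  by apply: (integrable_box oU).
have H := positive_integral (measurable_square P r) ig e0 sub g2 g0.
apply: lt_le_trans (H _); first by rewrite mulr_gt0// mulr_gt0// exprn_gt0.
move=> [x y] []; rewrite /square /box /= !in_itv/= => /andP[a b] /andP[c k].
apply/ltW; apply: Hd; rewrite /rdisk/= /sqd/=.
have sq (z q : R) : q - e <= z -> z <= q + e -> (z - q) ^+ 2 <= e ^+ 2.
  move=> z1 z2; rewrite -subr_ge0 subr_sqr mulr_ge0//; lra.
have e2 : e ^+ 2 <= (d / 2) ^+ 2 by rewrite ler_pXn2r ?nnegrE// ltW// divr_gt0.
have d2 : 0 < d ^+ 2 by rewrite exprn_gt0.
have E2 : (d / 2) ^+ 2 = d ^+ 2 / 4 by field.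
by have := sq _ _ a b; have := sq _ _ c k; lra.
Qed.

End Green.

(** * Radial bumps of constant mass *)

Section Kernel.
Context {R : realType}.
Implicit Types (X P Y : plane R).

Let mu := @lebesgue_measure R.

(** [K] is a primitive of [bump], hence a smooth step. *)
Lemma cutoff_exists : exists (K : R -> R) (K1 : R), [/\ 0 < K1,
  forall s : R, is_derive s 1 K (bump s), forall s, s <= 1 / 4 -> K s = 0 &
  forall s, 1 <= s -> K s = K1].
Proof.
have [K [dK K0]] := primitive_exists (@smooth1_continuous R _ smooth1_bump) (@bump_left R).
have cK : continuous K by move=> x; exact: is_derive_continuous (dK x).
have mvt (x y : R) : x < y -> exists2 c, x < c < y & K y - K x = bump c * (y - x).
  move=> xy; have [|c + ->] := MVT xy (fun z _ => dK z).
    exact: continuous_subspaceT.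
  by rewrite in_itv/= => cxy; exists c.
exists K, (K 1); split => //.
- have [|c /andP[c1 c2]] := mvt (1 / 4) 1; first lra.
  rewrite (K0 (1 / 4))// subr0 => ->; rewrite mulr_gt0//; last lra.
  by rewrite bump_gt0// c1.
- move=> s; rewrite le_eqVlt => /predU1P[<-//|s1].
  have [c /andP[c1 _]] := mvt _ _ s1.
  by rewrite bump_right ?(ltW c1)// mul0r => /eqP; rewrite subr_eq0 => /eqP.
Qed.

(** The function [F] satisfies [F' s = (K (a s) - K (b s)) / s] with [K] a smooth step,
so that [F (|X|^2)] is smooth, is a multiple of a logarithm plus a constant between the two
scales, and has as Laplacian four times a difference of two bumps. *)
Lemma log_kernel : exists2 K1 : R, 0 < K1 & forall a b : R, 0 < b -> b < a ->
  exists F F' F'' : R -> R, [/\ smooth1 F, smooth1 F'',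
    (forall s : R, is_derive s 1 F (F' s)) /\ (forall s : R, is_derive s 1 F' (F'' s)),
    (forall s, b^-1 <= s -> F s = 0) /\
    (forall s, s * F'' s + F' s = a * bump (a * s) - b * bump (b * s)) &
    (forall s, a^-1 <= s -> 4 * b * s <= 1 -> s * F' s = K1) /\
    (forall s, b^-1 <= s -> F' s = 0)].
Proof.
have [K [K1 [K10 dK K0 KK1]]] := cutoff_exists; exists K1 => // a b b0 ba.
have a0 : 0 < a by exact: lt_trans ba.
have sK : smooth1 K := Smooth_primitive smooth1_bump dK.
have q0 : (0 : R) < 1 / 4 by lra.
have sk : smooth1 (fun s => K s * s^-1).
  by apply: (Smooth_div sK q0) => s /ltW; exact: K0.
have k0 s : s <= 1 / 4 -> K s * s^-1 = 0 by move=> h; rewrite K0// mul0r.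
have [G [dG _]] := primitive_exists (@smooth1_continuous R _ sk) k0.
have sG : smooth1 G := Smooth_primitive sk dG.
have dlin (c s : R) : is_derive s 1 (fun s => c * s) c.
  have := @is_deriveZ _ _ _ id c s 1 1 (is_derive_id _ _).
  by move/is_derive_eq; apply; rewrite /GRing.scale/= mulr1.
have slin (c : R) : smooth1 (fun s => c * s).
  by apply: (@Smooth_mul _ (fun=> c) id); [exact: smooth1_cst|exact: smooth1_id].
(* the constant that makes [F] vanish from [s = 1 / b] on *)
pose C0 := G (a * b^-1) - G (b * b^-1).
pose F s := G (a * s) + (-1) * G (b * s) + (- C0).
pose F' s := a * (K (a * s) * (a * s)^-1) - b * (K (b * s) * (b * s)^-1).
have sGlin c : smooth1 (fun s => G (c * s)) by exact: (Smooth_comp sG (slin c)).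
have sF : smooth1 F.
  apply: (@Smooth_add _ (fun s => G (a * s) + (-1) * G (b * s)) (fun=> - C0)); last exact: smooth1_cst.
  apply: (@Smooth_add _ (fun s => G (a * s)) (fun s => (-1) * G (b * s))) => //.
  by apply: (@Smooth_mul _ (fun=> -1) (fun s => G (b * s))) => //; exact: smooth1_cst.
have skc c : smooth1 (fun s => c * (K (c * s) * (c * s)^-1)).
  apply: (@Smooth_mul _ (fun=> c) (fun s => K (c * s) * (c * s)^-1)); first exact: smooth1_cst.
  exact: (Smooth_comp sk (slin c)).
have sF' : smooth1 F'.
  have := @Smooth_add _ (fun s => a * (K (a * s) * (a * s)^-1)) (fun s => (-1) * (b * (K (b * s) * (b * s)^-1))) (skc a).
  rewrite (_ : (fun x => _ + _) = F'); last by apply/funext => s; rewrite /F' mulN1r.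
  by apply; apply: (@Smooth_mul _ (fun=> -1)) => //; exact: smooth1_cst.
have dGc (c s : R) : is_derive s 1 (fun s => G (c * s)) (c * (K (c * s) * (c * s)^-1)).
  have := @is_derive1_comp R G (fun s => c * s) s _ _ (dG (c * s)) (dlin c s).
  by move/is_derive_eq; apply; rewrite mulrC.
have dF (s : R) : is_derive s 1 F (F' s).
  have h1 := @is_deriveZ _ _ _ (fun s => G (b * s)) (-1) s 1 _ (dGc b s).
  have := is_deriveD (is_deriveD (dGc a s) h1) (is_derive_cst (- C0) s 1).
  by move/is_derive_eq; apply; rewrite /F' /GRing.scale/= mulN1r addr0.
have sKE (c s : R) : 0 < c -> s * (c * (K (c * s) * (c * s)^-1)) = K (c * s).
  move=> c0; have [->|s0] := eqVneq s 0; first by rewrite mulr0 K0 ?mul0r//; lra.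
  by field; rewrite s0 gt_eqF.
have sF'E s : s * F' s = K (a * s) - K (b * s) by rewrite mulrBr !sKE.
have F'0 s : b^-1 <= s -> F' s = 0.
  move=> bs; have s0 : 0 < s by apply: lt_le_trans bs; rewrite invr_gt0.
  have bs1 : 1 <= b * s by rewrite mulrC -ler_pdivrMr// mul1r.
  have as1 : 1 <= a * s by apply: le_trans bs1 _; rewrite ler_pM2r// ltW.
  have /eqP : s * F' s = 0 by rewrite sF'E !KK1// subrr.
  by rewrite mulf_eq0 gt_eqF//= => /eqP.
have [F'' sF'' dF'] := smooth1_derive sF'.
exists F, F', F''; split => //; last split => //.
- split => s.
    have Fb : F b^-1 = 0 by rewrite /F mulN1r subrr.
    rewrite le_eqVlt => /predU1P[<-//|bs].
    have cF : continuous F by move=> x; exact: is_derive_continuous (dF x).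
    have [|c] := MVT bs (fun z _ => dF z); first exact: continuous_subspaceT.
    rewrite in_itv/= => /andP[bc _]; rewrite Fb subr0 => ->.
    by rewrite F'0 ?mul0r// ltW.
  have h1 : is_derive s 1 (fun s => s * F' s) (s * F'' s + F' s).
    have := is_deriveM (is_derive_id s 1) (dF' s).
    by move/is_derive_eq; apply; rewrite /GRing.scale/= mulr1.
  have dKc (c : R) : is_derive s 1 (fun s => K (c * s)) (c * bump (c * s)).
    have := @is_derive1_comp R K (fun s => c * s) s _ _ (dK (c * s)) (dlin c s).
    by move/is_derive_eq; apply; rewrite mulrC.
  have h2 := is_deriveB (dKc a) (dKc b).
  have E : (fun s => s * F' s) = (fun s => K (a * s)) - (fun s => K (b * s)).
    by apply/funext => x; rewrite sF'E.
  have [_ <-] := h1; have [_ <-] := h2; by rewrite E.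
- move=> s sa sb; rewrite sF'E.
  rewrite KK1; last by rewrite mulrC -ler_pdivrMr// mul1r.
  by rewrite K0 ?subr0//; lra.
Qed.

Definition mass (t : R) P : R := \int[@lebesgue2 R]_Y (t * bump (t * sqd P Y)).

Lemma Rintegral_support (D : set (plane R)) (h : plane R -> R) P r :
  square P r `<=` D -> (forall Y, ~ square P r Y -> h Y = 0) ->
  \int[@lebesgue2 R]_(Y in D) h Y = \int[@lebesgue2 R]_(Y in square P r) h Y.
Proof.
move=> sD h0; rewrite Rintegral_mkcond [RHS]Rintegral_mkcond.
congr (Rintegral _ _ _); apply/funext => Y; rewrite /patch.
case: ifPn => YD; case: ifPn => YQ //.
  by rewrite h0// => /mem_set; rewrite (negbTE YQ).
by move: YQ; rewrite inE => /sD/mem_set; rewrite (negbTE YD).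
Qed.

Lemma bump_support t P r Y : 0 < t -> 0 <= r -> 1 <= t * r ^+ 2 -> ~ square P r Y ->
  bump (t * sqd P Y) = 0.
Proof.
move=> t0 r0 tr /(square_sqd r0) h; apply: bump_right; apply: le_trans tr _.
by rewrite ler_pM2l// ltW.
Qed.

Lemma mass_square t P r : 0 < t -> 0 <= r -> 1 <= t * r ^+ 2 ->
  mass t P = \int[@lebesgue2 R]_(Y in square P r) (t * bump (t * sqd P Y)).
Proof.
by move=> t0 r0 tr; apply: Rintegral_support => // Y nY; rewrite (bump_support t0 r0 tr nY) mulr0.
Qed.

Lemma bump_sqd_cont t P : continuous (fun Y => t * bump (t * sqd P Y)).
Proof.
apply: smooth2_continuous; apply: (@Smooth2_mul _ (fun=> t)); first exact: Smooth2_cst.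
apply: (@Smooth2_comp _ bump (fun Y => t * sqd P Y)); first exact: smooth1_bump.
by apply: (@Smooth2_mul _ (fun=> t)); [exact: Smooth2_cst|exact: smooth2_sqd].
Qed.

Lemma Ck_cst (c : R) : Ck_on setT 2 (fun _ : plane R => c).
Proof. by have := smooth2_smooth_on (Smooth2_cst c); apply. Qed.

Lemma laplacian_cst (c : R) X : laplacian (fun _ : plane R => c) X = 0.
Proof.
have h := Ck_jet openT (Ck_cst c) (I : setT X).
have [_ [b [d [[f' [n1 _ d1]] [g' [n2 _ d2]] ->]]]] := h.
have z (f : R -> R) (k : R -> R) x e : (\forall t \near x, is_derive (t : R) 1 (fun=> c) (k t)) ->
    is_derive x 1 k e -> e = 0.
  move=> nk; apply: derivative_near0.
  by apply: filterS nk => t [_ <-]; exact: derive_cst.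
by rewrite (z _ _ _ _ n1 d1) ?(z _ _ _ _ n2 d2) ?addr0.
Qed.

(** Green's identity for the constant function [1] and the function [F] of
[log_kernel], whose Laplacian is four times the difference of the two kernels. *)
Lemma mass_scale a b P : 0 < b -> b < a -> mass a P = mass b P.
Proof.
move=> b0 ba; have a0 : 0 < a by exact: lt_trans ba.
have [K1 _ HK] := log_kernel.
have [F [F' [F'' [sF sF'' [dF dF'] [F0 FE] _]]]] := HK a b b0 ba.
pose r := b^-1 + 1.
have bi : 0 < b^-1 by rewrite invr_gt0.
have r1 : 1 <= r by rewrite /r; lra.
have r0 : 0 < r by lra.
have rr : r <= r ^+ 2 by rewrite expr2 ler_peMl// ltW.
have br : b^-1 < r ^+ 2 by rewrite /r in rr *; lra.
have tb : 1 <= b * r ^+ 2 by rewrite mulrC -ler_pdivrMr// mul1r ltW.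
have ta : 1 <= a * r ^+ 2 by apply: le_trans tb _; rewrite ler_pM2r ?exprn_gt0// ltW.
have Q (D : set (plane R)) : D `<=` setT by [].
have G := green_square openT (Ck_cst 1) r0 (@Q (square P r)) sF sF'' dF dF' br F0.
rewrite (mass_square _ a0 (ltW r0) ta) (mass_square _ b0 (ltW r0) tb).
have mQ := measurable_square P r.
have iQ (h : plane R -> R) : continuous h ->
    (@lebesgue2 R).-integrable (square P r) (EFin \o h).
  by move=> ch; apply: (integrable_box openT) => // X _; exact: ch.
have ia := iQ _ (@bump_sqd_cont a P); have ib := iQ _ (@bump_sqd_cont b P).
apply/eqP; rewrite -subr_eq0; apply/eqP; apply: (eq_trans (esym (RintegralB mQ ia ib))).
have four : (4 : R) != 0 by [].
apply: (mulfI four); rewrite mulr0.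
have iab : (@lebesgue2 R).-integrable (square P r) (EFin \o (fun Y => a * bump (a * sqd P Y) - b * bump (b * sqd P Y))).
  apply: iQ => X; apply: (@continuousB _ _ _ (fun Y => a * bump (a * sqd P Y)) (fun Y => b * bump (b * sqd P Y))); exact: bump_sqd_cont.
apply: (eq_trans (esym (RintegralZl 4 mQ iab))).
transitivity (\int[@lebesgue2 R]_(Y in square P r) ((fun _ : plane R => 1 : R) Y * laplacian (fun Z => F (sqd P Z)) Y)).
  apply: eq_Rintegral => Y _; rewrite (radial_laplacian P Y dF dF') -FE; by rewrite mul1r.
apply: (eq_trans G).
transitivity (\int[@lebesgue2 R]_(Y in square P r) (0 : R)).
  by apply: eq_Rintegral => Y _; rewrite laplacian_cst mul0r.
by apply: (eq_trans (@Rintegral_cst _ _ R (@lebesgue2 R) _ mQ 0)); rewrite mul0r.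
Qed.

Lemma translation_invariance (G : R -> R) p : continuous G -> (forall x, 0 <= G x) ->
  (\int[mu]_x (G (x - p))%:E = \int[mu]_x (G x)%:E)%E.
Proof.
move=> cG G0; pose F x : R := x - p.
have dF (x : R) : is_derive x 1 F 1.
  have := is_deriveB (is_derive_id x 1) (is_derive_cst p x 1).
  by move/is_derive_eq; apply; rewrite subr0.
have F'E : derive1 F = (fun=> 1).
  by apply/funext => x; rewrite derive1E; have [] := dF x.
rewrite [RHS](@increasing_ge0_integration_by_substitutionT _ F)//.
- by apply: eq_integral => x _; rewrite F'E mulr1.
- by move=> x y xy; rewrite /F ltrD2r.
- by rewrite F'E; exact: cst_continuous.
- by rewrite F'E; exact: is_cvg_cst.
- by rewrite F'E; exact: is_cvg_cst.
- by apply/cvgrNyPle => A; near=> x; rewrite /F lerBlDr; near: x; apply: nbhs_ninfty_le; exact: num_real.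
- by apply/cvgryPge => A; near=> x; rewrite /F lerBrDr; near: x; apply: nbhs_pinfty_ge; exact: num_real.
Unshelve. all: by end_near. Qed.

(** By Tonelli, the translation is performed in one variable at a time. *)
Lemma mass_translate (t : R) P : 0 < t -> mass t P = mass t (0, 0).
Proof.
move=> t0; have h0 X Y : 0 <= t * bump (t * sqd X Y) by rewrite mulr_ge0 ?bump_ge0// ltW.
have meas X : measurable_fun (setT : set (measurableTypeR R * measurableTypeR R))
    (fun Y : plane R => t * bump (t * sqd X Y)).
  apply: (measurable_fun_cont openT) => //.
  by move=> Y _; exact: bump_sqd_cont.
have sliceE (c p : R) : (\int[mu]_x (t * bump (t * ((x - p) ^+ 2 + c)))%:E =
    \int[mu]_x (t * bump (t * ((x - 0) ^+ 2 + c)))%:E)%E.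
  have := @translation_invariance (fun x => t * bump (t * ((x - 0) ^+ 2 + c))) p.
  under eq_integral do rewrite subr0; apply.
    move=> x; apply: (@smooth1_continuous R (fun x => t * bump (t * ((x - 0) ^+ 2 + c)))).
    apply: (@Smooth_mul _ (fun=> t)); first exact: smooth1_cst.
    apply: (@Smooth_comp _ bump (fun x => t * ((x - 0) ^+ 2 + c))); first exact: smooth1_bump.
    apply: (@Smooth_mul _ (fun=> t)); first exact: smooth1_cst.
    apply: (@Smooth_add _ (fun x => (x - 0) ^+ 2) (fun=> c)); last exact: smooth1_cst.
    have sx : smooth1 (fun x : R => x - 0).
      by apply: (@Smooth_add _ id (fun=> - 0)); [exact: smooth1_id|exact: smooth1_cst].
    exact: (Smooth_mul sx sx).
  by move=> x; rewrite mulr_ge0 ?bump_ge0// ltW.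
pose ef X : plane R -> \bar R := fun Y : plane R => (t * bump (t * sqd X Y))%:E.
have ef0 X Y : (0 <= ef X Y)%E by rewrite lee_fin.

have T1 X : (\int[@lebesgue2 R]_Y ef X Y = \int[mu]_x \int[mu]_y ef X (x, y))%E.
  apply: (@fubini_tonelli1 _ _ _ _ R mu mu (ef X) _ (ef0 X)).
  by apply/measurable_realfun.measurable_EFinP; exact: meas.
have T2 X : (\int[@lebesgue2 R]_Y ef X Y = \int[mu]_y \int[mu]_x ef X (x, y))%E.
  apply: (@fubini_tonelli2 _ _ _ _ R mu mu (ef X) _ (ef0 X)).
  by apply/measurable_realfun.measurable_EFinP; exact: meas.
suff E : (\int[@lebesgue2 R]_Y ef P Y = \int[@lebesgue2 R]_Y ef (0, 0)%R Y)%E.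
  by rewrite /mass /Rintegral; exact: (congr1 fine E).
apply: (@eq_trans _ _ (\int[@lebesgue2 R]_Y ef (P.1, 0)%R Y)%E).
  apply: (eq_trans (T1 P)); apply: (eq_trans _ (esym (T1 _))).
  apply: eq_integral => x _.
  have E (p : R) : (\int[mu]_y ef (P.1, p)%R (x, y) = \int[mu]_y (t * bump (t * ((y - p) ^+ 2 + (x - P.1) ^+ 2)))%:E)%E.
    by apply: eq_integral => y _; rewrite /ef /sqd/= addrC.
  apply: (eq_trans _ (esym (E 0))); apply: (eq_trans _ (sliceE _ _)).
  apply: (eq_trans _ (E P.2)).
  by apply: eq_integral => y _; rewrite -surjective_pairing.
apply: (eq_trans (T2 _)); apply: (eq_trans _ (esym (T2 _))).
apply: eq_integral => y _.
exact: (sliceE ((y - 0) ^+ 2) P.1).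
Qed.

Definition unit_mass : R := mass 1 (0, 0).

Lemma massE t P : 0 < t -> mass t P = unit_mass.
Proof.
move=> t0; apply: (eq_trans (mass_translate P t0)); rewrite /unit_mass.
have [t1|t1|->//] := ltgtP t 1; last exact: mass_scale.
exact/esym/mass_scale.
Qed.

Lemma unit_mass_gt0 : 0 < unit_mass.
Proof.
pose o : plane R := (0, 0).
rewrite /unit_mass (@mass_square 1 _ 1)//; last by rewrite expr1n mulr1.
pose P : plane R := (7 / 10, 0).
apply: (@integral_gt0_square R setT (fun Y => 1 * bump (1 * sqd o Y)) o 1 P) => //.
- exact: openT.
- by move=> X _; exact: bump_sqd_cont.
- by move=> X _; rewrite mulr_ge0// bump_ge0.
- by rewrite /P/=; split; rewrite ltr_norml; lra.
- by rewrite !mul1r bump_gt0// /sqd /P/= !subr0 expr0n/= addr0 expr2; lra.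
Qed.

End Kernel.

(** * Consequences of the distributional equation *)

Section WeakSolution.
Context {R : realType}.
Implicit Types (X P Y : plane R) (E : set (plane R)) (u : plane R -> R).

Let mu := @lebesgue_measure R.

Definition weak_dipole E u := laplacian_eq E u (distr_dgrad (0, 1) (dirac_distr origin)).

Lemma closed_square P r : closed (square P r).
Proof.
apply: compact_closed; first exact: norm_hausdorff.
exact: compact_box.
Qed.

Lemma radial_test E P r F (rho : R) : smooth1 F -> 0 <= r -> rho <= r ^+ 2 ->
  (forall s, rho <= s -> F s = 0) -> square P r `<=` E ->
  test_function E (fun Y => F (sqd P Y)).
Proof.
move=> sF r0 rr F0 QE.
have sub : closure [set X | F (sqd P X) != 0] `<=` square P r.
  rewrite [X in _ `<=` X]((closure_id (square P r)).1 (@closed_square P r)).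
  apply: closure_subset => Y /=; apply: contraNP => /(square_sqd r0) h.
  by apply/eqP; apply: F0; apply: le_trans rr (ltW h).
split; last exact: subset_trans QE.
  by apply: smooth2_smooth_on; exact: smooth2_radial.
apply: (subclosed_compact _ (@compact_box R _ _ _ _) sub).
exact: closed_closure.
Qed.

Lemma weak_radial E u P r (F F' F'' : R -> R) (rho : R) : weak_dipole E u ->
  smooth1 F -> (forall x : R, is_derive x 1 F (F' x)) ->
  (forall x : R, is_derive x 1 F' (F'' x)) ->
  0 <= r -> rho < r ^+ 2 -> (forall s, rho <= s -> F s = 0) -> square P r `<=` E ->
  \int[@lebesgue2 R]_(Y in square P r) (u Y * laplacian (fun Z => F (sqd P Z)) Y) =
  2 * P.2 * F' (sqd P (0, 0)).
Proof.
move=> [_ wu] sF dF dF' r0 rr F0 QE.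
have F'0 s : rho < s -> F' s = 0.
  move=> rs; apply: (derivative_near0 _ (dF s)).
  have : \forall t \near s, rho < t by exact: lt_nbhsr.
  by apply: filterS => t /ltW; exact: F0.
have F''0 s : rho < s -> F'' s = 0.
  move=> rs; apply: (derivative_near0 _ (dF' s)).
  have : \forall t \near s, rho < t by exact: lt_nbhsr.
  by apply: filterS => t; exact: F'0.
have := wu _ (radial_test sF r0 (ltW rr) F0 QE).
rewrite /distr_laplacian /distr_of => I0.
have -> : \int[@lebesgue2 R]_(Y in square P r) (u Y * laplacian (fun Z => F (sqd P Z)) Y) =
   \int[@lebesgue2 R]_(Y in E) (u Y * laplacian (fun Z => F (sqd P Z)) Y).
  apply/esym; apply: Rintegral_support => // Y /(square_sqd r0) h.
  have h' := lt_trans rr h.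
  by rewrite (radial_laplacian P Y dF dF') F'0// F''0// mulr0 addr0 !mulr0.
apply: (eq_trans I0); rewrite /distr_dgrad /dirac_distr /dotp /grad /=.
have [_ E2 _ _] := radial_derivs P dF dF'.
have -> : 'D_e2 (fun Y => F (sqd P Y)) origin = F' (sqd P origin) * (2 * (origin.2 - P.2)).
  exact: (congr1 (fun h => h origin) E2).
rewrite mul0r add0r mul1r /origin /= sub0r; ring.
Qed.

Lemma square_subset P Q r r' : `|P.1 - Q.1| <= r' - r -> `|P.2 - Q.2| <= r' - r ->
  square P r `<=` square Q r'.
Proof.
rewrite !ler_norml => /andP[p1 p2] /andP[p3 p4] [x y].
by move=> [/=]; rewrite !in_itv/= => /andP[a1 a2] /andP[a3 a4]; split; rewrite /= in_itv/=; lra.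
Qed.

Lemma square_half P (r : R) : 0 < r -> square P r (P.1 + r / 2, P.2).
Proof. by move=> r0; split; rewrite /= in_itv/=; lra. Qed.

Lemma square_center P (r : R) : 0 <= r -> square P r P.
Proof. by move=> r0; split; rewrite /= in_itv/=; lra. Qed.

Lemma half_radius (r : R) : 0 < r -> [/\ 2 / r ^+ 2 * (r / 2) ^+ 2 = 1 / 2, 0 < r / 2, r / 2 < r & r / 2 <= r].
Proof. by move=> r0; split; [field; rewrite gt_eqF|lra|lra|lra]. Qed.

Lemma bump_half_gt0 : 0 < bump (1 / 2 : R).
Proof. by apply: bump_gt0; lra. Qed.

(** Otherwise the Laplacian keeps a sign on a small square around [P]; but the
equation and Green's identity for a radial bump supported there show that its
integral against the bump is zero. *)
Lemma weak_harmonic E u : open E -> weak_dipole E u -> Ck_on (E `\ origin) 2 u ->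
  forall P, E P -> P <> origin -> laplacian u P = 0.
Proof.
move=> oE wu cu P EP Po; apply/eqP/negP => /negP L0.
pose L := laplacian u P.
have oE' : open (E `\ origin).
  rewrite setDE; apply: openI => //; apply: closed_openC.
  by apply: accessible_closed_set1; apply: hausdorff_accessible; exact: norm_hausdorff.
have EP' : (E `\ origin) P by [].
have cL X : (E `\ origin) X -> {for X, continuous (fun Y => L * laplacian u Y)}.
  move=> UX; have [_ c1 c2] := Ck2_continuous oE' cu UX.
  apply: (@continuousM _ _ (fun=> L) (laplacian u)); first exact: cst_continuous.
  exact: (continuousD c1 c2).
have L2 : 0 < L * laplacian u P by rewrite -/L -expr2 exprn_even_gt0.
have [|d d0 Hd] := @near_rdisk _ P (fun Y => (E `\ origin) Y /\ 0 < L * laplacian u Y).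
  apply: filterI; first by apply: open_nbhs_nbhs.
  exact: (near_gt (cL _ EP')).
pose r := d / 2.
have r0 : 0 < r by rewrite divr_gt0.
have sqV Y : square P r Y -> (E `\ origin) Y /\ 0 < L * laplacian u Y.
  move=> [/=]; rewrite !in_itv/= -!ler_distlC => h1 h2; apply: Hd.
  rewrite /rdisk/= /sqd -(real_normK (num_real (Y.1 - P.1))) -(real_normK (num_real (Y.2 - P.2))).
  rewrite !(distrC Y.1) !(distrC Y.2).
  have sq (a : R) : 0 <= a -> a <= r -> a ^+ 2 <= r ^+ 2 by move=> a0 ar; rewrite ler_pXn2r ?nnegrE// ltW.
  have := sq _ (normr_ge0 _) h1; have := sq _ (normr_ge0 _) h2.
  have d2 : 0 < d ^+ 2 by rewrite exprn_gt0.
  have E2 : r ^+ 2 = d ^+ 2 / 4 by rewrite /r; field.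
  lra.
have QE' : square P r `<=` E `\ origin by move=> Y /sqV[].
have QE : square P r `<=` E by move=> Y /QE'[].
(* the bump [bump (c s)] is supported in [s <= r^2 / 2], inside the square *)
pose c := 2 / r ^+ 2.
have r2 : 0 < r ^+ 2 by rewrite exprn_gt0.
have c0 : 0 < c by rewrite divr_gt0.
pose F s := bump (c * s).
have sF : smooth1 F.
  apply: (@Smooth_comp _ bump (fun s => c * s)); first exact: smooth1_bump.
  by apply: (@Smooth_mul _ (fun=> c) id); [exact: smooth1_cst|exact: smooth1_id].
have [F' [F'' [_ sF'' dF dF' _]]] := smooth1_jet2 sF.
have F0 s : r ^+ 2 / 2 <= s -> F s = 0.
  move=> h; apply: bump_right; rewrite /c mulrAC ler_pdivlMr// mul1r; lra.
have rr : r ^+ 2 / 2 < r ^+ 2 by lra.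
have W := weak_radial wu sF dF dF' (ltW r0) rr F0 QE.
have nQo : ~ square P r (0, 0) by move=> /QE'[_]; apply.
have F'o : F' (sqd P (0, 0)) = 0.
  have h := lt_trans rr (square_sqd (ltW r0) nQo).
  apply: (derivative_near0 _ (dF _)).
  have : \forall t \near sqd P (0, 0), r ^+ 2 / 2 < t by exact: lt_nbhsr.
  by apply: filterS => t /ltW; exact: F0.
have G := green_square oE' cu r0 QE' sF sF'' dF dF' rr F0.
rewrite F'o mulr0 in W.
have {G}G0 := eq_trans (esym G) W.
pose f := fun Y => F (sqd P Y).
have cf X : {for X, continuous f} by apply: smooth2_continuous; exact: smooth2_radial.
have clf X : (E `\ origin) X -> {for X, continuous (fun Y => laplacian u Y * f Y)}.
  move=> UX; have [_ c1 c2] := Ck2_continuous oE' cu UX.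
  exact: (continuousM (continuousD c1 c2) (cf X)).
have cg X : (E `\ origin) X -> {for X, continuous (fun Y => L * (laplacian u Y * f Y))}.
  move=> UX; apply: (@continuousM _ _ (fun=> L) (fun Y => laplacian u Y * f Y)); first exact: cst_continuous.
  exact: clf.
have ig : (@lebesgue2 R).-integrable (square P r) (EFin \o (fun Y => laplacian u Y * f Y)).
  exact: (integrable_box oE' clf QE').
have Z := RintegralZl L (measurable_square P r) ig.
pose Q : plane R := (P.1 + r / 2, P.2).
have sQ : square P r Q by exact: square_half.
have [cr2 rh0 rh1 _] := half_radius r0.
have := @integral_gt0_square R _ _ P r Q oE' cg QE'.
apply: contraPP => _ H; suff : 0 < \int[@lebesgue2 R]_(X in square P r) (L * (laplacian u X * f X)).
  by rewrite Z G0 mulr0 ltxx.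
apply: H.
- move=> X /sqV[_ h]; rewrite mulrA mulr_ge0 ?(ltW h)// bump_ge0//.
- by rewrite /Q/= subrr normr0 r0 addrC addKr gtr0_norm.
- have [_ h] := sqV _ sQ; rewrite mulrA; apply: mulr_gt0 h _.
  rewrite /f /F /sqd /Q/= subrr expr0n/= addr0 (addrC P.1) addrK cr2.
  exact: bump_half_gt0.
Qed.

Lemma bump_le1 (s : R) : bump s <= 1.
Proof.
have f1 (x : R) : flat 0 x <= 1.
  have [/flat_le0->|x0] := leP x 0; first exact: ler01.
  by rewrite /flat x0/= hornerE mul1r -expR0 ler_expR oppr_le0 invr_ge0 ltW.
by rewrite /bump mulr_ile1// ?flat_ge0.
Qed.

(** The kernel is concentrated where [s < d^2], and there [x] is close to [y]. *)
Lemma kernel_oscillation (a d e x y s : R) : 0 < a -> 1 <= a * d ^+ 2 -> 0 <= e ->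
  (s < d ^+ 2 -> `|x - y| < e) ->
  `|x * (a * bump (a * s)) - y * (a * bump (a * s))| <= e * (a * bump (a * s)).
Proof.
move=> a0 ad e0 h; have k0 : 0 <= a * bump (a * s) by rewrite mulr_ge0 ?bump_ge0// ltW.
rewrite -mulrBl normrM (ger0_norm k0); have [/h/ltW h'|h'] := ltP s (d ^+ 2).
  by rewrite ler_wpM2r.
rewrite bump_right ?mulr0//; apply: le_trans ad _.
by rewrite ler_pM2l.
Qed.

Lemma solve_dipole (I J K p q : R) : 0 < q -> 4 * (I - J) = 2 * p * (K / q) ->
  I = J + K * p / (2 * q).
Proof.
move=> q0; have -> : 2 * p * (K / q) = 4 * (K * p / (2 * q)) by field; rewrite gt_eqF.
lra.
Qed.

Lemma fine_scale (d q b : R) : 0 < d -> 0 < q -> 0 < b ->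
  exists a, [/\ 0 < a, b < a, a^-1 <= q & 1 <= a * d ^+ 2].
Proof.
move=> d0 q0 b0; have d2 : 0 < d ^+ 2 by rewrite exprn_gt0.
have di : 0 < d ^- 2 by rewrite invr_gt0.
have qi : 0 < q^-1 by rewrite invr_gt0.
have a0 : 0 < d ^- 2 + q^-1 + b by lra.
exists (d ^- 2 + q^-1 + b); split => //; first by lra.
  by rewrite -(invrK q) lef_pV2 ?posrE//; lra.
rewrite -(@mulVf _ (d ^+ 2)) ?gt_eqF// ler_pM2r//; lra.
Qed.

(** Averages of [u] against bumps around [P] tend to [u P] times the mass when the
scale shrinks. By the equation tested on the function of [log_kernel], they differ
from the average at a fixed scale, which is bounded by the integral of [|u|], by
the derivative of a logarithm at the origin. *)
Lemma dipole_asymptotics : exists2 kappa : R, 0 < kappa & forall E u, open E -> E origin ->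
  weak_dipole E u -> (forall X, E X -> X <> origin -> {for X, continuous u}) ->
  exists rho B, 0 < rho /\ forall P, 0 < sqd (0, 0) P < rho ^+ 2 ->
    `|u P - kappa * (P.2 / sqd (0, 0) P)| <= B.
Proof.
have [K1 K10 HK] := @log_kernel R.
have m0 := @unit_mass_gt0 R; set m := unit_mass in m0.
exists (K1 / (2 * m)); first by rewrite divr_gt0// mulr_gt0.
move=> E u oE Eo wu cu.
have [|d d0 Hd] := @near_rdisk _ (0, 0) E; first exact: open_nbhs_nbhs.
pose r := d / 4; have r0 : 0 < r by rewrite divr_gt0.
pose o : plane R := (0, 0).
pose Bx := square o (2 * r).
have r2 : 0 < r ^+ 2 by rewrite exprn_gt0.
have E2 : d ^+ 2 = 16 * r ^+ 2 by rewrite /r; field.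
have BE : Bx `<=` E.
  move=> [x y] [/=]; rewrite !in_itv/= !sub0r !add0r => /andP[x1 x2] /andP[y1 y2].
  apply: Hd; rewrite /rdisk/= /sqd/= !subr0 E2.
  have sq (z : R) : - (2 * r) <= z -> z <= 2 * r -> z ^+ 2 <= 4 * r ^+ 2.
    move=> z1 z2; rewrite -subr_ge0 (_ : _ - _ = (2 * r - z) * (2 * r + z)); last by ring.
    by rewrite mulr_ge0//; lra.
  have := sq _ x1 x2; have := sq _ y1 y2; lra.
have mB : measurable (Bx : set (measurableTypeR R * measurableTypeR R)) by exact: measurable_square.
have iu : (@lebesgue2 R).-integrable Bx (EFin \o u).
  by have [+ _] := wu; apply => //; exact: compact_box.
pose b := r ^- 2.
have b0 : 0 < b by rewrite invr_gt0.
pose k a P Y := a * bump (a * sqd P Y).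
have k0 a P Y : 0 < a -> 0 <= k a P Y by move=> a0; rewrite mulr_ge0 ?bump_ge0// ltW.
have ka a P Y : 0 < a -> k a P Y <= a by move=> a0; rewrite ler_piMr ?bump_le1// ltW.
have kabs a P Y : 0 < a -> `|k a P Y| <= a by move=> a0; rewrite ger0_norm ?ka ?k0.
have mk a P : measurable_fun (Bx : set (measurableTypeR R * measurableTypeR R)) (k a P).
  by apply: (measurable_fun_cont openT) => // X _; exact: bump_sqd_cont.
have ik a P : (@lebesgue2 R).-integrable Bx (EFin \o k a P).
  by apply: (integrable_box openT) => // X _; exact: bump_sqd_cont.
have iuk a P : 0 < a -> (@lebesgue2 R).-integrable Bx (EFin \o (fun Y => u Y * k a P Y)).
  move=> a0; apply: (integrableMl mB iu (mk a P)).
  exists a; split; first exact: num_real.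
  by move=> x ax Y _; apply: le_trans (kabs _ _ _ a0) (ltW ax).
exists (r / 2), (b * (\int[@lebesgue2 R]_(Y in Bx) `|u Y|) / m).
split; first by rewrite divr_gt0.
move=> P /andP[oP0 oPr]; set q := sqd (0, 0) P in oP0 oPr *.
have Po : P <> origin by move=> PE; move: oP0; rewrite /q PE /sqd subrr expr0n/= addr0 ltxx.
have Pr : `|P.1| <= r /\ `|P.2| <= r.
  have h (z : R) : z ^+ 2 <= q -> `|z| <= r.
    move=> zq; rewrite -(ler_pXn2r (n:=2)) ?nnegrE ?normr_ge0 ?(ltW r0)//.
    rewrite real_normK ?num_real//; apply: le_trans zq _; apply: le_trans (ltW oPr) _.
    by rewrite (_ : (r / 2) ^+ 2 = r ^+ 2 / 4); [lra|field].
  by split; apply: h; rewrite /q /sqd/= !subr0 ?lerDl ?lerDr sqr_ge0.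
have sub : square P r `<=` Bx.
  have E1 : 2 * r - r = r by ring.
  by case: Pr => p1 p2; apply: square_subset; rewrite E1 subr0.
have EP : E P.
  by apply/BE/sub; apply: square_center; exact: ltW.
have q4 : 4 * b * q <= 1.
  rewrite /b (_ : 4 * r ^- 2 * q = 4 * q / r ^+ 2); last by ring.
  rewrite ler_pdivrMr// mul1r; have : (r / 2) ^+ 2 = r ^+ 2 / 4 by field.
  lra.
have intB a : 0 < a -> 1 <= a * r ^+ 2 -> \int[@lebesgue2 R]_(Y in Bx) k a P Y = m.
  move=> a0 ar; apply: (eq_trans _ (massE P a0)).
  apply/esym; apply: (eq_trans (mass_square P a0 (ltW r0) ar)).
  apply/esym; apply: Rintegral_support => // Y nY.
  by rewrite /k (bump_support a0 (ltW r0) ar nY) mulr0.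
pose J := \int[@lebesgue2 R]_(Y in Bx) (u Y * k b P Y).
have HJ : `|J| <= b * \int[@lebesgue2 R]_(Y in Bx) `|u Y|.
  apply: le_trans (le_normr_Rintegral mB (iuk b P b0)) _.
  have iau : (@lebesgue2 R).-integrable Bx (EFin \o (fun Y => `|u Y|)).
    exact: (integrable_norm iu).
  have <- := RintegralZl b mB iau.
  apply: le_Rintegral => //.
  - exact: (integrable_norm (iuk b P b0)).
  - exact: (integrableZl mB b iau).
  - by move=> Y _; rewrite normrM mulrC ler_wpM2r// kabs.
(* a square slightly larger than the support [|Y - P| <= r] of the kernels *)
pose r' := r * 3 / 2.
have key a : b < a -> a^-1 <= q ->
    \int[@lebesgue2 R]_(Y in Bx) (u Y * k a P Y) = J + K1 * P.2 / (2 * q).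
  move=> ba aq; have a0 : 0 < a by exact: lt_trans ba.
  have [F [F' [F'' [sF sF'' [dF dF'] [F0 FE] [FK _]]]]] := HK a b b0 ba.
  have bi : b^-1 = r ^+ 2 by rewrite /b invrK.
  have sub' : square P r' `<=` E.
    apply: subset_trans BE.
    have hz (z : R) : z ^+ 2 <= q -> `|z| <= r / 2.
      move=> zq; rewrite -(ler_pXn2r (n:=2)) ?nnegrE ?normr_ge0//; last by rewrite divr_ge0// ltW.
      by rewrite real_normK ?num_real//; apply: le_trans zq (ltW oPr).
    have E1 : 2 * r - r' = r / 2 by rewrite /r'; field.
    apply: square_subset; rewrite E1 subr0; apply: hz; rewrite /q /sqd/= !subr0.
      by rewrite lerDl sqr_ge0.
    by rewrite lerDr sqr_ge0.
  have r'0 : 0 <= r' by rewrite /r'; lra.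
  have rr : b^-1 < r' ^+ 2 by rewrite bi /r' (_ : (r * 3 / 2) ^+ 2 = 9 / 4 * r ^+ 2); [lra|field].
  have W := weak_radial wu sF dF dF' r'0 rr F0 sub'.
  have sqC : sqd P (0, 0) = q by rewrite /q /sqd/= !sub0r !subr0 !sqrrN.
  have F'q : F' q = K1 / q.
    by rewrite -(FK q aq q4) mulrAC divff ?mul1r// gt_eqF.
  have wE : \int[@lebesgue2 R]_(Y in square P r') (u Y * laplacian (fun Z => F (sqd P Z)) Y) =
      4 * (\int[@lebesgue2 R]_(Y in Bx) (u Y * k a P Y) - J).
    have <- := RintegralB mB (iuk a P a0) (iuk b P b0).
    have id := integrableB mB (iuk a P a0) (iuk b P b0).
    have <- := RintegralZl 4 mB id.
    have -> : \int[@lebesgue2 R]_(Y in square P r') (u Y * laplacian (fun Z => F (sqd P Z)) Y) =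
        \int[@lebesgue2 R]_(Y in square P r') (4 * (u Y * k a P Y - u Y * k b P Y)).
      apply: eq_Rintegral => Y _; rewrite (radial_laplacian P Y dF dF') FE -/(k a P Y) -/(k b P Y).
      by rewrite -mulrBr mulrCA.
    have z Y : ~ square P r Y -> 4 * (u Y * k a P Y - u Y * k b P Y) = 0.
      move=> nY; have hb : 1 <= b * r ^+ 2 by rewrite /b mulVf// gt_eqF.
      have ha : 1 <= a * r ^+ 2 by apply: le_trans hb _; rewrite ler_pM2r// ltW.
      rewrite /k (bump_support a0 (ltW r0) ha nY) (bump_support b0 (ltW r0) hb nY).
      by rewrite !mulr0 subrr mulr0.
    apply: (eq_trans (Rintegral_support _ z)).
      have [_ h1 _ _] := half_radius r0; have E1 : r' - r = r / 2 by rewrite /r'; field.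
      by apply: square_subset; rewrite E1 subrr normr0 ltW.
    by apply/esym; exact: (Rintegral_support sub z).
  by move: W; rewrite wE sqC F'q; exact: solve_dipole.
have close e : 0 < e -> `|J + K1 * P.2 / (2 * q) - u P * m| <= e * m.
  move=> e0.
  have [|d' d'0 Hd'] := @near_rdisk _ P (fun Y => `|u Y - u P| < e).
    have := cu P EP Po; move=> /cvgrPdist_lt /(_ e e0).
    by apply: filterS => Y; rewrite distrC.
  have [a [a0 ba aq ad]] := fine_scale d'0 oP0 b0.
  rewrite -(key a ba aq).
  have ar : 1 <= a * r ^+ 2.
    apply: (@le_trans _ _ (b * r ^+ 2)); first by rewrite /b mulVf// gt_eqF.
    by rewrite ler_pM2r// ltW.
  have im := intB a a0 ar.
  have iup : (@lebesgue2 R).-integrable Bx (EFin \o (fun Y => u P * k a P Y)).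
    exact: (integrableZl mB (u P) (ik a P)).
  have E1 : \int[@lebesgue2 R]_(Y in Bx) (u P * k a P Y) = u P * m.
    by rewrite -im; exact: (RintegralZl (u P) mB (ik a P)).
  rewrite -E1.
  have <- := RintegralB mB (iuk a P a0) iup.
  have idf := integrableB mB (iuk a P a0) iup.
  apply: le_trans (le_normr_Rintegral mB idf) _.
  rewrite -im; have <- := RintegralZl e mB (ik a P).
  have i1 := integrable_norm idf; have i2 := integrableZl mB e (ik a P).
  have pt Y : Bx Y -> `|u Y * k a P Y - u P * k a P Y| <= e * k a P Y.
    by move=> _; exact: (kernel_oscillation a0 ad (ltW e0) (Hd' Y)).
  exact: (le_Rintegral mB i1 i2 pt).
have eqm : u P * m = J + K1 * P.2 / (2 * q).
  apply/eqP; rewrite eq_sym -subr_eq0 -normr_eq0 -[_ == _]negbK; apply/negP => n0.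
  have n0' : 0 < `|J + K1 * P.2 / (2 * q) - u P * m| by rewrite lt_neqAle eq_sym n0/=.
  set D := `|_| in n0'.
  have := close (D / (2 * m)); rewrite -/D => /(_ _).
  rewrite (_ : D / (2 * m) * m = D / 2); last by field; rewrite gt_eqF.
  have D0 : 0 < D / (2 * m) by rewrite divr_gt0// mulr_gt0.
  by move=> /(_ D0); lra.
rewrite -(ler_pM2r m0) -[X in _ * X <= _](gtr0_norm m0) -normrM mulrBl eqm.
rewrite (_ : K1 / (2 * m) * (P.2 / q) * m = K1 * P.2 / (2 * q)); last first.
  by field; rewrite !gt_eqF.
by rewrite addrK mulfVK ?gt_eqF.
Qed.

End WeakSolution.

(** * Geometry of the inclusions *)

Section Geometry.
Context {R : realType}.
Implicit Types (X Y Z P : plane R) (A : set (plane R)).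

Let o : plane R := (0, 0).

(** What the sequel needs from one inclusion, [s] being [-1] for the left one and [1]
for the right one. *)
Record cone_domain (eps mu cs sn s : R) A : Prop := {
  cd_open : open A ;
  cd_cone : forall X, dist o X < mu -> (A X <->
    side_height eps cs sn s 1 X < 0 /\ side_height eps cs sn s (-1) X < 0) ;
  cd_half : forall X, A X -> eps / 2 <= s * X.1 ;
  cd_sym : forall x y, A (x, - y) <-> A (x, y) ;
  cd_curve : smooth_boundary_except A (side_vertex eps s) }.

Lemma side_heightE (eps cs sn s t : R) X : s ^+ 2 = 1 ->
  side_height eps cs sn s t X = t * cs * X.2 - sn * (s * X.1 - eps / 2).
Proof.
move=> s2; rewrite /side_height /tilt /side_normal /side_vertex/=.
rewrite [RHS](_ : _ = t * cs * X.2 - sn * (s * X.1 - s ^+ 2 * (eps / 2))); last by rewrite s2 mul1r.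
by ring.
Qed.

Lemma cone_sides (eps cs sn s : R) X : s ^+ 2 = 1 -> 0 < cs ->
  (`|X.2| < sn / cs * (s * X.1 - eps / 2)) <->
  (side_height eps cs sn s 1 X < 0 /\ side_height eps cs sn s (-1) X < 0).
Proof.
move=> s2 cs0; rewrite !side_heightE//.
rewrite mulrAC ltr_pdivlMr//.
rewrite -{1}(gtr0_norm cs0) -normrM ltr_norml.
by split=> [/andP[h1 h2]|[h1 h2]]; [split; lra|apply/andP; split; lra].
Qed.

Lemma diskE (r : R) X : disk r origin X <-> dist o X < r.
Proof. by rewrite /disk/= enormE /dist /sqd/= !subr0. Qed.

Lemma translateE A a X : translate A a X <-> A (X - a).
Proof.
split=> [[Y AY <-]|AX]; first by rewrite addrK.
by exists (X - a) => //; rewrite subrK.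
Qed.

Section OneConfiguration.
Variables (alpha mu eps : R) (Om1 Om2 : set (plane R)).
Hypotheses (ha : 0 < alpha < pi) (hmu : 1 < mu) (heps : 0 < eps) (heps1 : eps <= 1).
Hypothesis hinc : inclusions alpha mu eps Om1 Om2.

Let cs := cos (alpha / 2).
Let sn := sin (alpha / 2).

Lemma half_angle_pos : 0 < cs /\ 0 < sn /\ cs ^+ 2 + sn ^+ 2 = 1.
Proof.
have [a0 api] := andP ha.
split; [|split].
- by apply: cos_gt0_pihalf; apply/andP; split; have := pi_gt0 R; lra.
- by apply: sin_gt0_pi; apply/andP; split; have := pi_gt0 R; lra.
- exact: cos2Dsin2.
Qed.

Lemma cone1 X : dist o X < mu -> (Om1 X <->
    side_height eps cs sn (-1) 1 X < 0 /\ side_height eps cs sn (-1) (-1) X < 0).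
Proof.
move=> Xmu; have [cs0 _] := half_angle_pos.
rewrite -cone_sides ?sqrrN ?expr1n//.
have h := inc_cone1 hinc.
have hX : (Om1 `&` disk mu origin) X <-> (translate (cone alpha 1) ((1 - eps) / 2, 0) `&` disk mu origin) X by rewrite h.
have Xd : disk mu origin X by apply/diskE.
have -> : Om1 X <-> translate (cone alpha 1) ((1 - eps) / 2, 0) X.
  split=> H; first by case: (hX.1 (conj H Xd)).
  by case: (hX.2 (conj H Xd)).
rewrite translateE /cone/= subr0 expr1 mulN1r -/(tan _).
rewrite (_ : - tan (alpha / 2) * (X.1 - (1 - eps) / 2 - -1 * (1 / 2)) = sn / cs * (-1 * X.1 - eps / 2))//.
by rewrite -/(sn / cs); set k := sn / cs; rewrite (_ : tan (alpha / 2) = k)//; field.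
Qed.

Lemma cone2 X : dist o X < mu -> (Om2 X <->
    side_height eps cs sn 1 1 X < 0 /\ side_height eps cs sn 1 (-1) X < 0).
Proof.
move=> Xmu; have [cs0 _] := half_angle_pos.
rewrite -cone_sides ?expr1n//.
have h := inc_cone2 hinc.
have hX : (Om2 `&` disk mu origin) X <-> (translate (cone alpha 2) ((eps - 1) / 2, 0) `&` disk mu origin) X by rewrite h.
have Xd : disk mu origin X by apply/diskE.
have -> : Om2 X <-> translate (cone alpha 2) ((eps - 1) / 2, 0) X.
  split=> H; first by case: (hX.1 (conj H Xd)).
  by case: (hX.2 (conj H Xd)).
rewrite translateE /cone/= subr0 sqrrN expr1n mul1r.
rewrite (_ : 1 * tan (alpha / 2) * (X.1 - (eps - 1) / 2 - 1 / 2) = sn / cs * (1 * X.1 - eps / 2))//.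
by set k := sn / cs; rewrite (_ : tan (alpha / 2) = k)//; field.
Qed.

(** The mirror image of a point of one inclusion belongs to the other one, at
distance twice its abscissa. *)
Lemma abscissa_gap X : Om1 X -> eps / 2 <= `|X.1|.
Proof.
case: X => x y Oxy.
have O2 : Om2 (- x, y) by apply/(inc_mirror hinc); rewrite opprK.
have := inc_dist hinc; rewrite /set_dist => E.
have : inf [set d | exists X Y : plane R, [/\ Om1 X, Om2 Y & d = enorm (X - Y)]] <= 2 * `|x|.
  apply: ge_inf.
    by exists 0 => d [? [? [_ _ ->]]]; exact: sqrtr_ge0.
  exists (x, y), (- x, y); split => //.
  rewrite /enorm /dotp/= subrr opprK mulr0 addr0 -expr2 sqrtr_sqr.
  by rewrite (_ : x + x = 2 * x); [rewrite normrM gtr0_norm|ring].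
by rewrite E/=; lra.
Qed.

(** The inclusion is path connected and has points on the left of the strip
[|x1| < eps / 2]; a path to the right of it would cross the strip. *)
Lemma half1 X : Om1 X -> X.1 <= - (eps / 2).
Proof.
have [heps' heps1'] := (heps, heps1).
move=> OX; rewrite leNgt; apply/negP => Xx.
have X0 : eps / 2 <= X.1.
  have := abscissa_gap OX; have [h|h] := leP 0 X.1; first by rewrite ger0_norm.
  by rewrite ltr0_norm//; lra.
(* on the axis of the cone, at distance 1/4 from the vertex *)
pose P : plane R := (- (eps / 2) - 1 / 4, 0).
have [cs0 [sn0 _]] := half_angle_pos.
have OP : Om1 P.
  apply/cone1.
    apply: (lt_trans _ hmu); rewrite dist_ltP// /sqd /P/= !subr0 expr0n/= addr0 expr1n.
    by rewrite -[X in X < _]sqrrN expr_lt1//; lra.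
  by rewrite !side_heightE ?sqrrN ?expr1n// /P/= !mulr0 !add0r; split; nra.
have [[pc _] _] := inc_simply_connected hinc.
have [p [cp p0 p1 pO]] := pc _ _ OP OX.
have cf : {within `[0, 1], continuous (fun t => (p t).1)}.
  move=> t; apply: (@continuous_comp (subspace _) _ _ p fst); first exact: cp.
  exact: fst_cont.
have [|c c01 pc0] := @IVT R (fun t => (p t).1) 0 1 0 ler01 cf.
  rewrite p0 p1; apply/andP; split.
    by rewrite ge_min /P/=; apply/orP; left; lra.
  by rewrite le_max; apply/orP; right; lra.
by have := abscissa_gap (pO c c01); rewrite pc0 normr0; lra.
Qed.

Lemma domain1 : cone_domain eps mu cs sn (-1) Om1.
Proof.
split.
- by have [] := inc_open hinc.
- exact: cone1.
- by move=> X /half1; rewrite mulN1r; lra.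
- exact: (inc_sym1 hinc).
- have := inc_smooth1 hinc; congr smooth_boundary_except.
  by rewrite /vertex1 /side_vertex mulN1r mulNr.
Qed.

Lemma domain2 : cone_domain eps mu cs sn 1 Om2.
Proof.
split.
- by have [] := inc_open hinc.
- exact: cone2.
- by move=> [x y] /(inc_mirror hinc)/half1; rewrite mul1r/=; lra.
- exact: (inc_sym2 hinc).
- have := inc_smooth2 hinc; congr smooth_boundary_except.
  by rewrite /vertex2 /side_vertex mul1r.
Qed.

End OneConfiguration.

Section OneDomain.
Variables (eps mu cs sn s : R) (A : set (plane R)).
Hypotheses (cs0 : 0 < cs) (sn0 : 0 < sn) (s2 : s ^+ 2 = 1).
Hypothesis hA : cone_domain eps mu cs sn s A.

Let sh := side_height eps cs sn s.
Let sn0' := sn0.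

Lemma side_height_cont (e c n a t : R) X : {for X, continuous (side_height e c n a t)}.
Proof. exact: tilt_cont. Qed.

(** A point of the closed cone enters the open cone when pushed along its axis. *)
Lemma closed_cone_closure X : dist o X < mu -> sh 1 X <= 0 -> sh (-1) X <= 0 -> closure A X.
Proof.
move=> Xmu h1 h2 B nB.
pose g (d : R) : plane R := (X.1 + d * s, X.2).
have cg : {for 0, continuous g}.
  have c1 : {for (0 : R), continuous (fun d : R => X.1 + d * s)}.
    exact: jet2_continuous (jet2D (jet2_cst X.1 0) (jet2M (jet2_id 0) (jet2_cst s 0))).
  have c2 : {for (0 : R), continuous (fun d : R => X.2)} by exact: cst_continuous.
  exact: (continuous_pair c1 c2).
have g0 : g 0 = X by rewrite /g mul0r addr0 -surjective_pairing.
have nbB : \forall d \near (0 : R), B (g d) by apply: cg; rewrite g0.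
have nbm : \forall d \near (0 : R), dist o (g d) < mu.
  apply: (cg [set Y | dist o Y < mu]); rewrite g0.
  have mu0 : 0 <= mu by apply: le_trans (ltW Xmu); exact: dist_ge0.
  rewrite dist_ltP// in Xmu.
  have := near_lt (@sqd_cont _ o X) Xmu.
  by apply: filterS => Y /=; rewrite dist_ltP.
have [d [d0 [dB dm]]] : exists d : R, 0 < d /\ (B (g d) /\ dist o (g d) < mu).
  have [e /= e0 He] := filterI nbB nbm.
  exists (e / 2); split; first by rewrite divr_gt0.
  by apply: He => /=; rewrite sub0r normrN gtr0_norm; lra.
exists (g d); split => //; apply/(cd_cone hA) => //.
have E t : side_height eps cs sn s t (g d) = sh t X - sn * d * s ^+ 2.
  by rewrite /sh !side_heightE// /g/=; ring.
by rewrite !E s2 mulr1; have : 0 < sn * d by [rewrite mulr_gt0|]; lra.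
Qed.

Lemma side_open_exterior t X : t = 1 \/ t = -1 -> dist o X < mu -> 0 < sh t X -> ~ closure A X.
Proof.
move=> ht Xmu h cA.
have mu0 : 0 <= mu by apply: le_trans (ltW Xmu); exact: dist_ge0.
have n1 : \forall Y \near X, 0 < sh t Y by exact: near_gt (@side_height_cont _ _ _ _ _ _) h.
have n2 : \forall Y \near X, dist o Y < mu.
  rewrite dist_ltP// in Xmu.
  have := near_lt (@sqd_cont _ o X) Xmu.
  by apply: filterS => Y; rewrite dist_ltP.
have [Y [AY [h1 h2]]] := cA _ (filterI n1 n2).
have [k1 k2] := (cd_cone hA h2).1 AY.
case: ht => ht; rewrite ht in h1.
  by have := lt_trans h1 k1; rewrite ltxx.
by have := lt_trans h1 k2; rewrite ltxx.
Qed.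

Lemma closure_half X : closure A X -> eps / 2 <= s * X.1.
Proof.
move=> cA; rewrite leNgt; apply/negP => h.
have cf : {for X, continuous (fun Y : plane R => s * Y.1)} by case: (jetZ s (jet_fst X)).
have [Y [AY hY]] := cA _ (near_lt cf h).
by have := cd_half hA AY; rewrite leNgt hY.
Qed.

Lemma bdry_open X : bdry A X <-> closure A X /\ ~ A X.
Proof. rewrite /bdry ((interior_id A).1 (cd_open hA)). by split=> -[]. Qed.

Lemma flat_bdry t X : t = 1 \/ t = -1 -> dist o X < mu -> sh t X = 0 -> eps / 2 <= s * X.1 ->
  bdry A X.
Proof.
move=> ht Xmu h0 X1; apply/bdry_open.
have H : sh t X <= 0 /\ sh (- t) X <= 0.
  split; first by rewrite h0.
  move: h0; rewrite /sh !side_heightE// => h0.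
  have : 0 <= sn * (s * X.1 - eps / 2) by rewrite mulr_ge0 ?(ltW sn0)// subr_ge0.
  lra.
split.
  case: ht H => -> [h1 h2]; first exact: closed_cone_closure.
  by rewrite opprK in h2; exact: closed_cone_closure.
move=> /(cd_cone hA Xmu)[k1 k2]; case: ht h0 => ->; rewrite /sh => h0.
  by rewrite h0 ltxx in k1.
by rewrite h0 ltxx in k2.
Qed.

Lemma closure_reflect x y : closure A (x, - y) <-> closure A (x, y).
Proof.
suff H (a b : R) : closure A (a, b) -> closure A (a, - b).
  by split => h; [rewrite -(opprK y)|]; exact: H.
move=> cA B nB.
pose g (Y : plane R) : plane R := (Y.1, - Y.2).
have cg : {for (a, b), continuous g}.
  apply: continuous_pair; first exact: fst_cont.
  by case: (jetN (jet_snd (a, b))).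
have [Y [AY BY]] := cA _ (cg _ nB).
exists (g Y); split => //; apply/(cd_sym hA); move: AY; by case: Y BY.
Qed.

End OneDomain.

End Geometry.

(** * Maximum principle in exterior domains *)

Section Comparison.
Context {R : realType}.
Implicit Types (X Y Z P : plane R) (D : set (plane R)) (w : plane R -> R).

Let o : plane R := (0, 0).

Lemma jet_log_sqd X : 0 < sqd o X -> exists a c, jet (fun Y => ln (sqd o Y)) X a c 0.
Proof.
move=> X0; do 2 eexists; apply: (jet_eq (jet_radial (jet2_ln X0))) => //.
by field; rewrite gt_eqF.
Qed.

(** The logarithmic barrier [d (log r^2 - log |Y|^2)] is infinite at the origin, where
[w] is only bounded above, and nonnegative in the disk of radius [r], outside which
decay takes over; then [d] tends to [0]. *)
Lemma exterior_max_principle D w (m : R) : open D -> ~ D o -> harmonic_on D w ->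
  (exists rho B, 0 < rho /\ forall Y, D Y -> sqd o Y < rho ^+ 2 -> w Y <= B) ->
  (forall e, 0 < e -> exists r, forall Y, D Y -> r < dist o Y -> w Y <= m + e) ->
  (forall Z, ~ D Z -> Z <> o -> forall e, 0 < e -> \forall Y \near Z, D Y -> w Y <= m + e) ->
  forall X, D X -> w X <= m.
Proof.
move=> oD nDo hw [rho [B [rho0 wB]]] winf wb X DX.
apply/ler_addgt0Pr => e e0.
have [r1 wr1] := winf e e0.
pose r := Num.max (Num.max (r1 + 1) (dist o X + 1)) 1.
have r1r : r1 < r by rewrite !lt_max ltrDl ltr01.
have Xr : dist o X < r by rewrite !lt_max ltrDl ltr01 orbT.
have r0 : 0 < r by rewrite !lt_max ltr01 orbT.
have r20 : 0 < r ^+ 2 by rewrite exprn_gt0.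
pose l Y := ln (r ^+ 2) - ln (sqd o Y).
have neo Y : D Y -> Y <> o by move=> DY Yo; apply: nDo; rewrite -Yo.
have l0 Y : D Y -> sqd o Y < r ^+ 2 -> 0 <= l Y.
  move=> /neo/sqd_o_gt0 Y0 Yr; rewrite subr_ge0 ler_ln ?posrE//; exact: ltW.
have H d : 0 < d -> w X - d * l X <= m + e.
  move=> d0.
  apply: (@max_principle _ (D `&` rdisk r o) (fun Y => w Y - d * l Y) (m + e) (r ^+ 2)).
  - by apply: openI => //; exact: open_rdisk.
  - by move=> Y [_ /ltW].
  - move=> Y [DY _]; have [a [c jw]] := hw _ DY.
    have [a' [c' jl]] := jet_log_sqd (sqd_o_gt0 (neo _ DY)).
    do 3 eexists; split; first exact: jetB jw (jetZ d (jetB (jet_cst (ln (r ^+ 2)) Y) jl)).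
    by rewrite !subr0 mulr0 subr0.
  - move=> Z nZ e' e'0.
    have [Zo|Zo] := pselect (Z = o).
      (* for [|Y|^2 < t] the barrier exceeds [|B| + |m|] *)
      pose t := expR (ln (r ^+ 2) - (`|B| + `|m|) / d).
      have t0 : 0 < t by exact: expR_gt0.
      have n1 : \forall Y \near Z, sqd o Y < Num.min t (rho ^+ 2).
        apply: near_lt; first exact: sqd_cont.
        by rewrite Zo /sqd subrr expr0n/= addr0 lt_min t0 exprn_gt0.
      apply: filterS n1 => Y; rewrite lt_min => /andP[Yt Yrho] [DY Yr].
      have wY := wB _ DY Yrho.
      have lY : (`|B| + `|m|) / d <= l Y.
        have Y0 := sqd_o_gt0 (neo _ DY).
        have : ln (sqd o Y) <= ln t by rewrite ler_ln ?posrE// ltW.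
        by rewrite expRK /l; lra.
      have : `|B| + `|m| <= d * l Y by rewrite mulrC -ler_pdivrMr.
      by have := ler_norm B; have := ler_norm (- m); rewrite normrN; lra.
    have [Zr|Zr] := ltP (sqd o Z) (r ^+ 2).
      have nDZ : ~ D Z by move=> DZ; apply: nZ.
      have := wb Z nDZ Zo e' e'0; apply: filterS => Y wY [DY Yr].
      have := wY DY; have : 0 <= d * l Y by rewrite mulr_ge0 ?(ltW d0)// l0.
      lra.
    have r1Z : \forall Y \near Z, r1 < dist o Y.
      have [r1n|r1p] := ltP r1 0.
        by near=> Y; apply: lt_le_trans r1n _; exact: dist_ge0.
      have : r1 ^+ 2 < sqd o Z.
        by apply: lt_le_trans Zr; rewrite ltr_pXn2r ?nnegrE// ltW.
      move=> /(near_gt (@sqd_cont _ o Z)); apply: filterS => Y.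
      by rewrite ltNge -dist_leP// -ltNge.
    apply: filterS r1Z => Y Yr1 [DY Yr].
    have := wr1 _ DY Yr1; have : 0 <= d * l Y by rewrite mulr_ge0 ?(ltW d0)// l0.
    lra.
  - by split => //; rewrite /rdisk/= -dist_ltP// ltW.
have lX : 0 <= l X by apply: l0 => //; rewrite -dist_ltP// ltW.
apply/ler_addgt0Pr => e' e'0.
have d0 : 0 < e' / (l X + 1) by rewrite divr_gt0//; lra.
have := H _ d0; suff : e' / (l X + 1) * l X <= e' by lra.
by rewrite mulrAC ler_pdivrMr; [rewrite ler_pM2l//; lra|lra].
Unshelve. all: by end_near. Qed.

End Comparison.

(** * Local structure of the boundary curve *)

Section BoundaryCurve.
Context {R : realType}.
Implicit Types (X Y Z P : plane R) (A : set (plane R)).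

Lemma closure_not_bdry A Y : open A -> ~ bdry A Y -> closure A Y -> A Y.
Proof.
move=> /interior_id AE nb cA; apply: contrapT => nA; apply: nb.
by rewrite /bdry AE.
Qed.

Lemma open_not_bdry A Y : open A -> A Y -> ~ bdry A Y.
Proof. by move=> /interior_id AE AY; rewrite /bdry AE => -[]. Qed.

(** A connected set that avoids the boundary of [A] lies in [A] or misses it. *)
Lemma segment_stays A Y Z : open A ->
  (forall s : R, 0 <= s <= 1 ->
     ~ bdry A (Y.1 + s * (Z.1 - Y.1), Y.2 + s * (Z.2 - Y.2))) ->
  A Y -> A Z.
Proof.
move=> oA nb AY.
pose g (s : R) : plane R := (Y.1 + s * (Z.1 - Y.1), Y.2 + s * (Z.2 - Y.2)).
have cg : continuous g.
  move=> s.
  have c1 := jet2_continuous (jet2D (jet2_cst Y.1 s) (jet2M (jet2_id s) (jet2_cst (Z.1 - Y.1) s))).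
  have c2 := jet2_continuous (jet2D (jet2_cst Y.2 s) (jet2M (jet2_id s) (jet2_cst (Z.2 - Y.2) s))).
  exact: (continuous_pair c1 c2).
pose B : set R := `[0, 1] `&` g @^-1` A.
have g0 : g 0 = Y by rewrite /g !mul0r !addr0 -surjective_pairing.
have g1 : g 1 = Z by rewrite /g !mul1r !(addrC _ (_ - _)) !subrK -surjective_pairing.
have : B = `[0, 1]%classic.
  apply: (@segment_connected R 0 1).
  - by exists 0; split; rewrite /= ?g0// in_itv/= lexx ler01.
  - by exists (g @^-1` A) => //; apply: open_comp => // x _; exact: cg.
  - exists (g @^-1` (closure A)).
      by apply: closed_comp; [move=> x _; exact: cg|exact: closed_closure].
    apply/seteqP; split=> s [s01 h]; split => //; first exact: subset_closure.
    apply: closure_not_bdry => //; apply: nb.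
    by move: s01; rewrite /= in_itv.
move/seteqP=> [_ /(_ 1)]; rewrite /B /= g1 in_itv/= lexx ler01 => /(_ isT)[].
by [].
Qed.

Lemma segment_stays_iff A Y Z : open A ->
  (forall s : R, 0 <= s <= 1 ->
     ~ bdry A (Y.1 + s * (Z.1 - Y.1), Y.2 + s * (Z.2 - Y.2))) ->
  A Y <-> A Z.
Proof.
move=> oA nb; split; apply: segment_stays => // s s01.
have /nb : 0 <= 1 - s <= 1 by lra.
congr (~ bdry A _); congr pair; ring.
Qed.

Lemma increasing_of_derivative (h h' : R -> R) (a b : R) :
  (forall t, a < t < b -> is_derive t 1 h (h' t)) -> (forall t, a < t < b -> 0 < h' t) ->
  forall s t, a < s -> s < t -> t < b -> h s < h t.
Proof.
move=> dh h0 s t as_ st tb.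
have [x||c] := @MVT _ h h' s t st.
- by rewrite in_itv/= => /andP[x1 x2]; apply: dh; lra.
- apply: derivable_within_continuous => x; rewrite in_itv/= => /andP[x1 x2].
  by have [] := dh x _ => //; lra.
- rewrite in_itv/= => /andP[c1 c2] E; rewrite -subr_gt0 E mulr_gt0 ?subr_gt0//.
  by apply: h0; lra.
Qed.

Lemma convex_gt (x u w s : R) : 0 <= s <= 1 -> x < u -> x < w ->
  x < (1 - s) * u + s * w.
Proof.
move=> /andP[s0 s1] xu xw; have [->|sn0] := eqVneq s 0; first by lra.
have sp : 0 < s by rewrite lt_neqAle eq_sym sn0.
have : 0 < s * (w - x) by rewrite mulr_gt0// subr_gt0.
have : 0 <= (1 - s) * (u - x) by rewrite mulr_ge0// subr_ge0// ltW.
lra.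
Qed.

Lemma segment_norm_lt (x y z s : R) : 0 <= s <= 1 -> `|x| < z -> `|y| < z -> `|x + s * (y - x)| < z.
Proof.
move=> s01; rewrite !ltr_norml => /andP[h1 h2] /andP[h3 h4].
have -> : x + s * (y - x) = (1 - s) * x + s * y by ring.
rewrite convex_gt//= -ltrN2 opprD -!mulrN convex_gt// ltrN2//.
Qed.

Definition along X (n : plane R) (s : R) : plane R := (X.1 + s * n.1, X.2 + s * n.2).

Lemma near_between (a b t : R) : a < t < b -> \forall s \near t, a < s < b.
Proof.
move=> /andP[h1 h2]; have n1 : \forall s \near t, a < s by exact: lt_nbhsr.
have n2 : \forall s \near t, s < b by exact: lt_nbhsl.
by apply: filterS2 n1 n2 => s -> ->.
Qed.

Lemma inner_interval (t0 em ep : R) : 0 < Num.min em ep -> 0 < t0 -> t0 < 1 ->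
  exists lo hi, [/\ [/\ 0 < lo, lo < t0, t0 < hi & hi < 1],
    forall t, lo <= t <= hi -> t0 - em < t < t0 + em &
    forall t, lo <= t <= hi -> t0 - ep < t < t0 + ep].
Proof.
rewrite lt_min => /andP[em0 ep0] t00 t01.
pose d := Num.min (Num.min em ep) (Num.min t0 (1 - t0)).
have d0 : 0 < d by rewrite !lt_min em0 ep0 t00 subr_gt0.
have : d <= d := lexx d.
rewrite {2}/d !le_min => /andP[/andP[h1 h2] /andP[h3 h4]].
by exists (t0 - d / 2), (t0 + d / 2); split; [split|move=> t /andP[k1 k2]|move=> t /andP[k1 k2]]; lra.
Qed.

Lemma frame_lt (a b p q : R) : a - p < b - q -> a + p < b + q -> a < b.
Proof. by lra. Qed.

Lemma frame_norm (a q : R) :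
  (a = 0 /\ q = 0) \/ (a - q < 0 /\ a + q < 0) \/ (0 < a - q /\ 0 < a + q) -> `|q| <= `|a|.
Proof.
move=> [[-> ->]|[[h1 h2]|[h1 h2]]]; first by [].
  by rewrite [leRHS]ltr0_norm ?ler_norml; lra.
by rewrite [leRHS]gtr0_norm ?ler_norml; lra.
Qed.

(** Along the two directions at 45 degrees from the tangent, the curve has positive
velocity near [t0]; both [a - q] and [a + q] increase, where [a] and [q] are the
tangential and normal coordinates, hence so does [a], and [|q| <= |a|]. *)
Lemma frame_coordinates A V (gamma : R -> plane R) (t0 : R) :
  boundary_param A V gamma -> 0 < t0 < 1 ->
  exists (tau : plane R) (lo hi : R), let n : plane R := (- tau.2, tau.1) in
  [/\ tau.1 ^+ 2 + tau.2 ^+ 2 = 1, dotp n (velocity gamma t0) = 0,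
      [/\ 0 < lo, lo < t0, t0 < hi & hi < 1],
      forall s t, lo <= s -> s < t -> t <= hi ->
        tilt tau (gamma t0) (gamma s) < tilt tau (gamma t0) (gamma t) &
      forall t, lo <= t <= hi ->
        `|tilt n (gamma t0) (gamma t)| <= `|tilt tau (gamma t0) (gamma t)|].
Proof.
move=> [_ _ _ _ gsm] ht0.
have [t00 t01] := andP ht0.
pose X0 := gamma t0.
have t01' : t0 \in `]0, 1[ by rewrite in_itv/= t00.
pose v := velocity gamma t0.
have v0 : v <> origin by have [_] := gsm t0 t01'.
have vE : velocity gamma t0 = v by [].
have vE1 : derive1 (fun s => (gamma s).1) t0 = v.1 by [].
have vE2 : derive1 (fun s => (gamma s).2) t0 = v.2 by [].
clearbody v.
have e0 : 0 < dist (0, 0) v.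
  by rewrite sqrtr_gt0; apply: sqd_o_gt0.
set e := dist (0, 0) v in e0.
have e2 : e ^+ 2 = v.1 ^+ 2 + v.2 ^+ 2 by rewrite dist_sqr /sqd/= !subr0.
clearbody e.
pose tau : plane R := (v.1 / e, v.2 / e).
pose n : plane R := (- (v.2 / e), v.1 / e).
have tau1 : tau.1 ^+ 2 + tau.2 ^+ 2 = 1.
  by rewrite /tau/= !expr_div_n -mulrDl -e2 divff// expf_neq0// gt_eqF.
have nv : dotp n (velocity gamma t0) = 0 by rewrite vE /dotp /n/=; ring.
pose g1 s := (gamma s).1; pose g2 s := (gamma s).2.
have d1 (t : R) : 0 < t < 1 -> is_derive t 1 g1 (derive1 g1 t).
  move=> ht; have [|/(_ 0%N)[h _] _] := gsm t; first by rewrite in_itv.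
  by rewrite derive1E; apply: derivableP.
have d2 (t : R) : 0 < t < 1 -> is_derive t 1 g2 (derive1 g2 t).
  move=> ht; have [|/(_ 0%N)[_ h] _] := gsm t; first by rewrite in_itv.
  by rewrite derive1E; apply: derivableP.
have c1 : {for t0, continuous (derive1 g1)}.
  have [/(_ 1%N)[h _] _] := gsm t0 t01'.
  by apply: differentiable_continuous; apply/derivable1_diffP.
have c2 : {for t0, continuous (derive1 g2)}.
  have [/(_ 1%N)[_ h] _] := gsm t0 t01'.
  by apply: differentiable_continuous; apply/derivable1_diffP.
pose coord (w : plane R) t := tilt w X0 (gamma t).
pose coord' (w : plane R) t := w.1 * derive1 g1 t + w.2 * derive1 g2 t.
have dcoord w (t : R) : 0 < t < 1 -> is_derive t 1 (coord w) (coord' w t).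
  move=> ht.
  have h1 := is_deriveZ w.1 (is_deriveB (d1 t ht) (is_derive_cst X0.1 t 1)).
  have h2 := is_deriveZ w.2 (is_deriveB (d2 t ht) (is_derive_cst X0.2 t 1)).
  have := is_deriveD h1 h2; move/is_derive_eq; apply.
  by rewrite !subr0.
have ccoord' w : {for t0, continuous (coord' w)}.
  have k1 := @continuousM _ _ (fun=> w.1) (derive1 g1) t0 (@cst_continuous _ _ w.1 t0) c1.
  have k2 := @continuousM _ _ (fun=> w.2) (derive1 g2) t0 (@cst_continuous _ _ w.2 t0) c2.
  exact: (continuousD k1 k2).
(* directions at 45 degrees from the tangent *)
pose wm : plane R := (tau.1 - n.1, tau.2 - n.2).
pose wp : plane R := (tau.1 + n.1, tau.2 + n.2).
have wm0 : 0 < coord' wm t0.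
  rewrite /coord' /g1 /g2 vE1 vE2 /wm /tau /n/=.
  rewrite [ltRHS](_ : _ = (v.1 ^+ 2 + v.2 ^+ 2) / e); last by field; rewrite gt_eqF.
  by rewrite -e2 divr_gt0// exprn_gt0.
have wp0 : 0 < coord' wp t0.
  rewrite /coord' /g1 /g2 vE1 vE2 /wp /tau /n/=.
  rewrite [ltRHS](_ : _ = (v.1 ^+ 2 + v.2 ^+ 2) / e); last by field; rewrite gt_eqF.
  by rewrite -e2 divr_gt0// exprn_gt0.
have mono w : 0 < coord' w t0 -> exists2 e : R, 0 < e & forall t, t0 - e < t < t0 + e ->
    0 < t < 1 /\ 0 < coord' w t.
  move=> w0; have [d /= d0 Hd] : \forall t \near t0, 0 < t < 1 /\ 0 < coord' w t.
    apply: filterI; last exact: cvgr_gt (ccoord' w) _ w0.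
    exact: near_between.
  by exists d => // t ht; apply: Hd; rewrite /ball_/= ltr_distlC.
have [em em0 Hm] := mono _ wm0; have [ep ep0 Hp] := mono _ wp0.
have [lo [hi [[lo0 lot thi hi1] inm inp]]] : exists lo hi, [/\ [/\ 0 < lo, lo < t0, t0 < hi & hi < 1],
    forall t, lo <= t <= hi -> t0 - em < t < t0 + em &
    forall t, lo <= t <= hi -> t0 - ep < t < t0 + ep].
  have emp0 : 0 < Num.min em ep by rewrite lt_min em0.
  exact: inner_interval emp0 t00 t01.
have monoW w d : (forall t, t0 - d < t < t0 + d -> 0 < t < 1 /\ 0 < coord' w t) ->
    (forall t, lo <= t <= hi -> t0 - d < t < t0 + d) ->
    forall s t, lo <= s -> s < t -> t <= hi -> coord w s < coord w t.
  move=> w0 ind s t ls st th.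
  have [s1 _] := andP (ind s ltac:(by rewrite ls (le_trans (ltW st) th))).
  have [_ t1] := andP (ind t ltac:(by rewrite th (le_trans ls (ltW st)))).
  apply: (increasing_of_derivative _ _ s1 st t1).
  - by move=> x /w0[hx _]; exact: dcoord.
  - by move=> x /w0[].
have monom := monoW wm em Hm inm.
have monop := monoW wp ep Hp inp.
have wmE t : coord wm t = coord tau t - coord n t by rewrite /coord /tilt /wm/=; ring.
have wpE t : coord wp t = coord tau t + coord n t by rewrite /coord /tilt /wp/=; ring.
have c0 w : coord w t0 = 0 by rewrite /coord /tilt !subrr !mulr0 addr0.
exists tau, lo, hi; split => //.
- by move=> s t h1 h2 h3; apply: (@frame_lt _ _ (coord n s) (coord n t)); rewrite -?wmE -?wpE; [exact: monom|exact: monop].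
- move=> t /andP[h1 h2]; apply: frame_norm.
  have [tt0|tt0|->] := ltgtP t t0; last by left; rewrite -/(coord tau t0) -/(coord n t0) !c0.
  + right; left; have k1 := monom _ _ h1 tt0 (ltW thi); have k2 := monop _ _ h1 tt0 (ltW thi).
    by rewrite c0 wmE in k1; rewrite c0 wpE in k2.
  + right; right; have k1 := monom _ _ (ltW lot) tt0 h2; have k2 := monop _ _ (ltW lot) tt0 h2.
    by rewrite c0 wmE in k1; rewrite c0 wpE in k2.
Qed.

Lemma param_continuous A V (gamma : R -> plane R) (t : R) :
  boundary_param A V gamma -> 0 < t < 1 -> {for t, continuous gamma}.
Proof.
move=> [_ _ _ _ gsm] ht; have [|/(_ 0%N)[h1 h2] _] := gsm t; first by rewrite in_itv.
have c1 : {for t, continuous (fun s => (gamma s).1)}.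
  by apply: differentiable_continuous; apply/derivable1_diffP; exact: h1.
have c2 : {for t, continuous (fun s => (gamma s).2)}.
  by apply: differentiable_continuous; apply/derivable1_diffP; exact: h2.
have := continuous_pair c1 c2; rewrite /prop_for.
by rewrite (_ : (fun s => _) = gamma)//; apply/funext => s; rewrite -surjective_pairing.
Qed.

Lemma param_bdry A V (gamma : R -> plane R) (t : R) :
  boundary_param A V gamma -> 0 < t < 1 -> bdry A (gamma t).
Proof. by move=> [_ _ _ <- _] /andP[h1 h2]; exists t => //=; rewrite in_itv/= !ltW. Qed.

Definition normal (tau : plane R) : plane R := (- tau.2, tau.1).

(** The point with tangential coordinate [x] and normal coordinate [y]. *)
Definition frame X (tau : plane R) (x y : R) : plane R :=
  (X.1 + x * tau.1 - y * tau.2, X.2 + x * tau.2 + y * tau.1).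

Lemma frameK X tau x y : tau.1 ^+ 2 + tau.2 ^+ 2 = 1 ->
  [/\ tilt tau X (frame X tau x y) = x, tilt (normal tau) X (frame X tau x y) = y &
      sqd X (frame X tau x y) = x ^+ 2 + y ^+ 2].
Proof.
move=> h; split.
- rewrite [RHS](_ : _ = (tau.1 ^+ 2 + tau.2 ^+ 2) * x); last by rewrite h mul1r.
  by rewrite /tilt /=; ring.
- rewrite [RHS](_ : _ = (tau.1 ^+ 2 + tau.2 ^+ 2) * y); last by rewrite h mul1r.
  by rewrite /tilt /=; ring.
- rewrite [RHS](_ : _ = (tau.1 ^+ 2 + tau.2 ^+ 2) * (x ^+ 2 + y ^+ 2)); last by rewrite h mul1r.
  by rewrite /sqd /=; ring.
Qed.

Lemma tiltK X tau Y : tau.1 ^+ 2 + tau.2 ^+ 2 = 1 ->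
  frame X tau (tilt tau X Y) (tilt (normal tau) X Y) = Y.
Proof.
move=> h; rewrite [RHS]surjective_pairing /frame; congr pair.
  rewrite [RHS](_ : _ = X.1 + (tau.1 ^+ 2 + tau.2 ^+ 2) * (Y.1 - X.1)); last by rewrite h; ring.
  by rewrite /tilt /=; ring.
rewrite [RHS](_ : _ = X.2 + (tau.1 ^+ 2 + tau.2 ^+ 2) * (Y.2 - X.2)); last by rewrite h; ring.
by rewrite /tilt /=; ring.
Qed.

Lemma arc_far A V (gamma : R -> plane R) (t0 b c : R) :
  boundary_param A V gamma -> 0 < t0 < 1 -> 0 <= b -> b <= c -> c <= 1 ->
  (forall t, b <= t <= c -> t != t0) ->
  exists2 r, 0 < r & forall t, b <= t <= c -> r <= dist (gamma t0) (gamma t).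
Proof.
move=> [cg [gV0 gV1] ginj _ _] /andP[t00 t01] b0 bc c10 nt.
pose X0 := gamma t0.
have cd : {within `[b, c], continuous (fun t => dist X0 (gamma t))}.
  have sub : `[b, c] `<=` `[0, 1]%classic.
    move=> t /=; rewrite !in_itv/= => /andP[h1 h2].
    by rewrite (le_trans b0 h1) (le_trans h2 c10).
  apply: (continuous_subspaceW sub) => t; apply: (@continuous_comp (subspace _) _ _ (fun t => sqd X0 (gamma t)) (@Num.sqrt R)).
    by apply: (@continuous_comp (subspace _) _ _ gamma (sqd X0)); [exact: cg|exact: sqd_cont].
  exact: sqrt_continuous.
have [m mbc Hm] := EVT_min bc cd.
exists (dist X0 (gamma m)); last by move=> t ht; apply: Hm; rewrite in_itv.
rewrite lt_neqAle dist_ge0 andbT; apply/eqP => /esym h0.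
have gm : gamma m = X0.
  have : dist X0 (gamma m) ^+ 2 = 0 by rewrite h0 expr0n.
  rewrite dist_sqr /sqd => /eqP; rewrite paddr_eq0 ?sqr_ge0// !sqrf_eq0 !subr_eq0 => /andP[/eqP k1 /eqP k2].
  by rewrite [LHS]surjective_pairing k1 k2 -surjective_pairing.
move: mbc; rewrite in_itv/= => mbc.
have [m1|m1] := eqVneq m 1.
  have : gamma 0 = gamma t0 by rewrite gV0 -gV1 -m1.
  move/ginj; rewrite !in_itv/= lexx ltr01 (ltW t00) t01 => /(_ isT isT) h.
  by move: t00; rewrite -h ltxx.
have /ginj : gamma m = gamma t0 by [].
rewrite !in_itv/= (ltW t00) t01 => h.
have : m = t0 by apply: h => //; case/andP: mbc => k1 k2; rewrite (le_trans b0 k1) lt_neqAle m1 (le_trans k2 c10).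
by apply/eqP; exact: nt.
Qed.

(** The curve is injective and compact: arcs that miss the parameter [t0] stay at a
positive distance from the point. *)
Lemma curve_far A V (gamma : R -> plane R) (t0 lo hi : R) :
  boundary_param A V gamma -> [/\ 0 < lo, lo < t0, t0 < hi & hi < 1] ->
  exists2 r, 0 < r & forall t, 0 <= t <= 1 -> dist (gamma t0) (gamma t) < r -> lo < t < hi.
Proof.
move=> bp [lo0 lot thi hi1].
have ht0 : 0 < t0 < 1 by rewrite (lt_trans lo0 lot) (lt_trans thi hi1).
have lo1 : lo <= 1 := ltW (lt_trans lot (lt_trans thi hi1)).
have hi0 : 0 <= hi := ltW (lt_trans lo0 (lt_trans lot thi)).
have [|r1 r10 Hr1] := arc_far bp ht0 (lexx 0) (ltW lo0) lo1.
  by move=> t /andP[_ h]; rewrite lt_eqF//; apply: le_lt_trans h _.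
have [|r2 r20 Hr2] := arc_far bp ht0 hi0 (ltW hi1) (lexx 1).
  by move=> t /andP[h _]; rewrite gt_eqF//; apply: lt_le_trans h.
exists (Num.min r1 r2); first by rewrite lt_min r10.
move=> t /andP[h0 h1]; rewrite lt_min => /andP[k1 k2].
rewrite !ltNge; apply/andP; split; apply/negP => h.
  by have := Hr1 t; rewrite h0 h => /(_ isT) /(lt_le_trans k1); rewrite ltxx.
by have := Hr2 t; rewrite h1 h => /(_ isT) /(lt_le_trans k2); rewrite ltxx.
Qed.

(** Twice as high as wide, so that a graph of slope at most [1] leaves room above and
below it. *)
Definition frame_box X tau (d : R) : set (plane R) :=
  [set Y | `|tilt tau X Y| < d /\ `|tilt (normal tau) X Y| < 2 * d].

Lemma frame_box_dist X tau d Y : tau.1 ^+ 2 + tau.2 ^+ 2 = 1 -> 0 <= d ->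
  frame_box X tau d Y -> dist X Y < 3 * d.
Proof.
move=> h d0 [h1 h2]; rewrite dist_ltP; last by rewrite mulr_ge0.
have [_ _ E] := frameK X (tilt tau X Y) (tilt (normal tau) X Y) h.
rewrite tiltK// in E; rewrite E.
have s1 : tilt tau X Y ^+ 2 < d ^+ 2 by rewrite -[ltLHS]real_normK ?num_real// ltr_pXn2r ?nnegrE.
have s2 : tilt (normal tau) X Y ^+ 2 < (2 * d) ^+ 2.
  by rewrite -[ltLHS]real_normK ?num_real// ltr_pXn2r ?nnegrE// mulr_ge0.
by have := sqr_ge0 d; move: s2; rewrite !exprMn; lra.
Qed.

Lemma open_frame_box X tau d : open (frame_box X tau d).
Proof.
apply: openP => Y [h1 h2].
have k n : {for Y, continuous (fun Y => `|tilt n X Y|)}.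
  by apply: (@continuous_comp _ _ _ (tilt n X) (fun r : R => `|r|)); [exact: tilt_cont|exact: norm_continuous].
by apply: filterI; [exact: near_lt (k _) h1|exact: near_lt (k _) h2].
Qed.

(** The tangential coordinate is a strictly increasing continuous function of the
parameter, so the arc is a graph over it; the rest of the curve is far away. *)
Lemma curve_graph A V (gamma : R -> plane R) (t0 : R) :
  boundary_param A V gamma -> 0 < t0 < 1 ->
  exists (tau : plane R) (d : R) (phi : R -> R),
  [/\ tau.1 ^+ 2 + tau.2 ^+ 2 = 1, dotp (normal tau) (velocity gamma t0) = 0, 0 < d,
      forall x, `|x| < d -> `|phi x| <= `|x| &
      forall Y, frame_box (gamma t0) tau d Y ->
        bdry A Y <-> tilt (normal tau) (gamma t0) Y = phi (tilt tau (gamma t0) Y)].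
Proof.
move=> bp ht0.
have [tau [lo [hi [t1 nv bnd mono dom]]]] := frame_coordinates bp ht0.
rewrite -/(normal tau) in nv dom; set X0 := gamma t0 in mono dom *.
have [r r0 Hr] := curve_far bp bnd.
have [lo0 lot thi hi1] := bnd.
pose a t := tilt tau X0 (gamma t).
have at0 : a t0 = 0 by rewrite /a /tilt !subrr !mulr0 addr0.
have alo : 0 < - a lo by rewrite oppr_gt0 -at0; apply: mono => //; exact: ltW.
have ahi : 0 < a hi by rewrite -at0; apply: mono => //; exact: ltW.
pose d := Num.min (r / 3) (Num.min (a hi) (- a lo)).
have d0 : 0 < d by rewrite !lt_min ahi alo divr_gt0.
have [d1 d2 d3] : [/\ d <= r / 3, d <= a hi & d <= - a lo] by rewrite /d !ge_min !lexx !orbT.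
clearbody d.
have ca (t : R) : lo <= t <= hi -> {for t, continuous a}.
  move=> /andP[h1 h2].
  have ht : 0 < t < 1 by rewrite (lt_le_trans lo0 h1) (le_lt_trans h2 hi1).
  by apply: (@continuous_comp _ _ _ gamma (tilt tau X0)); [exact: param_continuous bp ht|exact: tilt_cont].
have reach x : `|x| < d -> exists2 t, lo < t < hi & a t = x.
  rewrite ltr_norml => /andP[x1 x2].
  have xhi : x < a hi := lt_le_trans x2 d2.
  have xlo : a lo < x by apply: le_lt_trans x1; rewrite lerNr.
  have cw : {within `[lo, hi], continuous a}.
    by apply: continuous_in_subspaceT => t; rewrite inE/= in_itv/= => /ca.
  have [|t] := @IVT R a lo hi x (ltW (lt_trans lot thi)) cw.
    by rewrite ge_min le_max (ltW xlo) (ltW xhi) orbT.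
  rewrite in_itv/= => /andP[k1 k2] E; exists t => //.
  rewrite !lt_neqAle k1 k2 !andbT; apply/andP; split; apply/eqP => Et.
    by move: xlo; rewrite -E -Et ltxx.
  by move: xhi; rewrite -E -Et ltxx.
have inj t t' : lo < t < hi -> lo < t' < hi -> a t = a t' -> t = t'.
  move=> /andP[t1' t2] /andP[t3 t4] E; apply/eqP; rewrite eq_le !leNgt; apply/andP; split; apply/negP => h.
    by have := mono _ _ (ltW t3) h (ltW t2); rewrite -/(a t) -/(a t') E ltxx.
  by have := mono _ _ (ltW t1') h (ltW t4); rewrite -/(a t) -/(a t') E ltxx.
(* the inverse of the tangential coordinate *)
pose T x := xget 0 [set t | lo < t < hi /\ a t = x].
have TE x : `|x| < d -> lo < T x < hi /\ a (T x) = x.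
  move=> /reach[t ht E].
  by apply: (@xgetPex _ 0 [set t | lo < t < hi /\ a t = x]); exists t.
have Ta t : lo < t < hi -> `|a t| < d -> T (a t) = t.
  by move=> ht /TE[h1 h2]; exact: inj.
exists tau, d, (fun x => tilt (normal tau) X0 (gamma (T x))); split => //.
  move=> x /TE[/andP[h1 h2] E]; rewrite -[X in _ <= `|X|]E; apply: dom.
  by rewrite (ltW h1) (ltW h2).
have [_ _ _ gim _] := bp.
move=> Y NY; split=> [bY|E].
  move: (bY); rewrite -gim => -[t /=]; rewrite in_itv/= => ht gt.
  have tlh : lo < t < hi.
    apply: Hr => //; rewrite gt.
    apply: lt_le_trans (frame_box_dist t1 (ltW d0) NY) _.
    by rewrite mulrC -ler_pdivlMr.
  by rewrite -gt -/(a t) Ta// /a gt; case: NY.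
have [/andP[h1 h2] E2] := TE _ NY.1.
have -> : Y = gamma (T (tilt tau X0 Y)).
  by rewrite -[LHS](tiltK X0 Y t1) E -{1}E2 tiltK.
by apply: (param_bdry bp); rewrite (lt_trans lo0 h1) (lt_trans h2 hi1).
Qed.

Definition graph_side X tau (d : R) (phi : R -> R) (sg : R) : set (plane R) :=
  [set Y | frame_box X tau d Y /\ sg * phi (tilt tau X Y) < sg * tilt (normal tau) X Y].

Lemma sign_norm (sg : R) : sg ^+ 2 = 1 -> `|sg| = 1.
Proof. by move=> h; apply/eqP; rewrite -(eqrXn2 (n:=2))// real_normK ?num_real// h expr1n. Qed.

(** Any point of a side is joined to a fixed one by a vertical segment up to height
[3 d / 2], beyond the reach of the graph, followed by a horizontal one. *)
Lemma side_connected A X tau d phi sg Y : open A -> tau.1 ^+ 2 + tau.2 ^+ 2 = 1 -> 0 < d ->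
  (forall x, `|x| < d -> `|phi x| <= `|x|) ->
  (forall Y, frame_box X tau d Y -> bdry A Y <-> tilt (normal tau) X Y = phi (tilt tau X Y)) ->
  sg ^+ 2 = 1 -> graph_side X tau d phi sg Y ->
  A Y <-> A (frame X tau 0 (sg * (3 / 2 * d))).
Proof.
move=> oA t1 d0 dom bE sg2 [NY sY].
set x := tilt tau X Y in sY; set y := tilt (normal tau) X Y in sY.
have [xd yd] : `|x| < d /\ `|y| < 2 * d := NY.
pose y1 := sg * (3 / 2 * d).
have sy1 : sg * y1 = 3 / 2 * d by rewrite /y1 mulrA -expr2 sg2 mul1r.
have dd : 3 / 2 * d < 2 * d by rewrite ltr_pM2r//; lra.
have d32 : d < 3 / 2 * d by rewrite ltr_pMl//; lra.
have ny1 : `|y1| < 2 * d by rewrite /y1 normrM sign_norm// mul1r gtr0_norm// mulr_gt0.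
have above x' : `|x'| < d -> sg * phi x' < 3 / 2 * d.
  move=> h; apply: le_lt_trans (ler_norm _) _; rewrite normrM sign_norm// mul1r.
  by apply: le_lt_trans (dom _ h) (lt_trans h d32).
have off x' y' : `|x'| < d -> `|y'| < 2 * d -> sg * phi x' < sg * y' -> ~ bdry A (frame X tau x' y').
  move=> hx hy h; have [E1 E2 _] := frameK X x' y' t1.
  have hN : frame_box X tau d (frame X tau x' y') by rewrite /frame_box/= E1 E2.
  by move=> /(bE _ hN); rewrite E1 E2 => E; move: h; rewrite E ltxx.
have segE x' y' x2 y2 s : ((frame X tau x' y').1 + s * ((frame X tau x2 y2).1 - (frame X tau x' y').1),
    (frame X tau x' y').2 + s * ((frame X tau x2 y2).2 - (frame X tau x' y').2)) =
    frame X tau (x' + s * (x2 - x')) (y' + s * (y2 - y')).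
  by rewrite /frame/=; congr pair; ring.
have h1 : A Y <-> A (frame X tau x y1).
  rewrite -{1}(tiltK X Y t1); apply: segment_stays_iff => // s s01; rewrite segE subrr mulr0 addr0.
  apply: off => //; first exact: segment_norm_lt.
  have -> : sg * (y + s * (y1 - y)) = (1 - s) * (sg * y) + s * (sg * y1) by ring.
  by apply: convex_gt => //; rewrite sy1; exact: above.
apply: (iff_trans h1); apply: segment_stays_iff => // s s01; rewrite segE subrr mulr0 addr0.
have xs : `|x + s * (0 - x)| < d by apply: segment_norm_lt => //; rewrite normr0.
by apply: off => //; rewrite sy1; exact: above.
Qed.

Lemma side_near A X tau d phi sg Y : tau.1 ^+ 2 + tau.2 ^+ 2 = 1 ->
  (forall Y, frame_box X tau d Y -> bdry A Y <-> tilt (normal tau) X Y = phi (tilt tau X Y)) ->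
  sg ^+ 2 = 1 -> frame_box X tau d Y -> bdry A Y ->
  forall B, nbhs Y B -> exists Z, graph_side X tau d phi sg Z /\ B Z.
Proof.
move=> t1 bE sg2 NY bY B nB; have yE := (bE _ NY).1 bY.
set x := tilt tau X Y in yE.
pose g (s : R) := frame X tau x (phi x + sg * s).
have cgg : {for (0 : R), continuous g}.
  have k0 := jet2D (jet2_cst (phi x) 0) (jet2M (jet2_cst sg 0) (jet2_id 0)).
  have k1 := jet2_continuous (jet2B (jet2_cst (X.1 + x * tau.1) 0) (jet2M k0 (jet2_cst tau.2 0))).
  have k2 := jet2_continuous (jet2D (jet2_cst (X.2 + x * tau.2) 0) (jet2M k0 (jet2_cst tau.1 0))).
  exact: (continuous_pair k1 k2).
have g0 : g 0 = Y by rewrite /g mulr0 addr0 -yE tiltK.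
have nNB : nbhs (g 0) (frame_box X tau d `&` B).
  by rewrite g0; apply: filterI => //; apply: open_nbhs_nbhs; split => //; exact: open_frame_box.
have [e /= e0 He] := cgg _ nNB.
have e2 : 0 < e / 2 by rewrite divr_gt0.
have [|Ng Bg] := He (e / 2).
  by rewrite /ball_/= sub0r normrN gtr0_norm// ltr_pdivrMr// ltr_pMr// ltr1n.
exists (g (e / 2)); split => //; split => //.
have [E1 E2 _] := frameK X x (phi x + sg * (e / 2)) t1.
by rewrite /g E1 E2 mulrDr mulrA -expr2 sg2 mul1r ltrDl.
Qed.

(** The picture given by [curve_graph] and [side_connected], freed of coordinates. *)
Lemma curve_local A V (gamma : R -> plane R) (t0 : R) : open A ->
  boundary_param A V gamma -> 0 < t0 < 1 ->
  exists (n : plane R) (N : set (plane R)) (side : R -> set (plane R)) (d : R),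
  [/\ n.1 ^+ 2 + n.2 ^+ 2 = 1 /\ dotp n (velocity gamma t0) = 0,
      open N /\ N (gamma t0),
      0 < d /\ forall s, 0 < s < d ->
        side 1 (along (gamma t0) n s) /\ side (-1) (along (gamma t0) n (- s)),
      forall Y, N Y -> [\/ bdry A Y, side 1 Y | side (-1) Y] &
      forall sg, sg ^+ 2 = 1 ->
      [/\ (forall Y, side sg Y -> N Y), (forall Y, side sg Y -> ~ bdry A Y),
        (forall Y Y', side sg Y -> side sg Y' -> A Y -> A Y') &
        (forall Y, N Y -> bdry A Y -> forall B, nbhs Y B -> exists Z, side sg Z /\ B Z)]].
Proof.
move=> oA bp ht0; have [tau [d [phi [t1 nv d0 dom bE]]]] := curve_graph bp ht0.
set X0 := gamma t0 in dom bE *.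
have phi0 : phi 0 = 0 by have := dom 0; rewrite normr0 normr_le0 => /(_ d0)/eqP.
have dE x : along X0 (normal tau) x = frame X0 tau 0 x.
  by rewrite /along /frame/=; congr pair; ring.
have NP (x : R) : `|x| < 2 * d -> frame_box X0 tau d (frame X0 tau 0 x).
  by move=> h; have [E1 E2 _] := frameK X0 0 x t1; rewrite /frame_box/= E1 E2 normr0.
have d20 : 0 < 2 * d by rewrite mulr_gt0.
have axis (sg x : R) : `|x| < 2 * d -> 0 < sg * x -> graph_side X0 tau d phi sg (frame X0 tau 0 x).
  move=> h hx; split; first exact: NP.
  by have [E1 E2 _] := frameK X0 0 x t1; rewrite E1 E2 phi0 mulr0.
exists (normal tau), (frame_box X0 tau d), (graph_side X0 tau d phi), (2 * d); split.
- by split => //=; rewrite sqrrN addrC.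
- split; first exact: open_frame_box.
  have -> : X0 = frame X0 tau 0 0 by rewrite /frame !mul0r !addr0 subr0 -surjective_pairing.
  by rewrite /frame/= !mul0r !addr0 !subr0 -surjective_pairing; have := NP 0; rewrite /frame !mul0r !addr0 subr0 -surjective_pairing; apply; rewrite normr0.
- split => // s /andP[s0 sd]; rewrite !dE; split; apply: axis; rewrite ?normrN ?gtr0_norm ?mul1r//.
  by rewrite mulrNN mul1r.
- move=> Y NY; have [h|h|h] := ltgtP (phi (tilt tau X0 Y)) (tilt (normal tau) X0 Y).
  + by apply: Or32; split; rewrite ?mul1r.
  + by apply: Or33; split; rewrite ?mulN1r ?ltrN2.
  + by apply: Or31; apply/(bE _ NY).
- move=> sg sg2; split.
  + by move=> Y [].
  + by move=> Y [NY h] /(bE _ NY) E; move: h; rewrite E ltxx.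
  + move=> Y Y' hY hY' AY.
    by apply/(side_connected oA t1 d0 dom bE sg2 hY')/(side_connected oA t1 d0 dom bE sg2 hY).
  + by move=> Y NY bY B nB; exact: side_near t1 bE sg2 NY bY B nB.
Qed.

End BoundaryCurve.

(** * Inner and outer sides of the boundary curve *)

Section OutwardNormal.
Context {R : realType}.
Implicit Types (X Y Z P : plane R) (A : set (plane R)).

(** If both sides of the curve near a point were in [A], nearby boundary points would
be interior to the closure. This condition on the parameter is open and closed,
so it would hold along the whole curve, which the point [Z] forbids. This step
replaces the Jordan curve theorem. *)
Lemma outward_normal A V (gamma : R -> plane R) : open A -> boundary_param A V gamma ->
  (exists Z, [/\ bdry A Z, Z <> V & ~ nbhs Z (closure A)]) ->
  forall t0 : R, 0 < t0 < 1 -> exists n : plane R,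
    [/\ n.1 ^+ 2 + n.2 ^+ 2 = 1, dotp n (velocity gamma t0) = 0 &
     exists2 d : R, 0 < d & forall s, 0 < s < d ->
       A (along (gamma t0) n s) /\ ~ closure A (along (gamma t0) n (- s))].
Proof.
move=> oA bp [Z [bZ ZV nZ]] t0 ht0.
(* parameters near which both sides of the curve lie in [A] *)
pose D : set R := [set t : R | 0 < t < 1 /\ nbhs (gamma t) (closure A)].
have loc (t : R) : 0 < t < 1 -> (\forall s \near t, D s) \/
   ((\forall s \near t, ~ D s) /\ exists n : plane R,
    [/\ n.1 ^+ 2 + n.2 ^+ 2 = 1, dotp n (velocity gamma t) = 0 &
     exists2 d : R, 0 < d & forall s, 0 < s < d ->
       A (along (gamma t) n s) /\ ~ closure A (along (gamma t) n (- s))]).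
  move=> ht.
  have [n [N [side [d [[n1 nv] [oN Nt] [d0 Hd] tri sid]]]]] := curve_local oA bp ht.
  have nN : \forall s \near t, N (gamma s).
    by apply: (param_continuous bp ht); apply: open_nbhs_nbhs.
  have one : (1 : R) ^+ 2 = 1 by rewrite expr1n.
  have mone : (-1 : R) ^+ 2 = 1 by rewrite sqrrN expr1n.
  have [sN1 nb1 tr1 ap1] := sid 1 one.
  have [sNm nbm trm apm] := sid (-1) mone.
  have [UA|nUA] := pselect (exists Y, side 1 Y /\ A Y); last first.
    right; split.
      apply: filterS2 (near_between ht) nN => s hs Ns [_ cs].
      have [Y [sY cY]] := ap1 _ Ns (param_bdry bp hs) _ cs.
      by apply: nUA; exists Y; split => //; apply: closure_not_bdry => //; exact: nb1.
    have [Y [AY NY]] : exists Y, A Y /\ N Y.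
      have [cX _] := param_bdry bp ht.
      by apply: cX; apply: open_nbhs_nbhs.
    have sY : side (-1) Y.
      have [bY|sY|//] := tri Y NY; first by have := open_not_bdry oA AY.
      by exfalso; apply: nUA; exists Y.
    exists (- n.1, - n.2); split => /=.
    - by rewrite !sqrrN.
    - by rewrite /dotp/= !mulNr -opprD [X in - X]nv oppr0.
    - exists d => // s hs; have [p1 p2] := Hd s hs.
      have E x : along (gamma t) (- n.1, - n.2) x = along (gamma t) n (- x).
        by rewrite /along/= !mulrN !mulNr.
      rewrite !E opprK; split; first exact: trm sY p2 AY.
      move=> cl; apply: nUA; exists (along (gamma t) n s); split => //.
      by apply: closure_not_bdry => //; exact: nb1.
  have [LA|nLA] := pselect (exists Y, side (-1) Y /\ A Y); last first.
    right; split.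
      apply: filterS2 (near_between ht) nN => s hs Ns [_ cs].
      have [Y [sY cY]] := apm _ Ns (param_bdry bp hs) _ cs.
      by apply: nLA; exists Y; split => //; apply: closure_not_bdry => //; exact: nbm.
    exists n; split => //; exists d => // s hs; have [p1 p2] := Hd s hs.
    have [Y [sY AY]] := UA.
    split; first exact: tr1 sY p1 AY.
    move=> cl; apply: nLA; exists (along (gamma t) n (- s)); split => //.
    by apply: closure_not_bdry => //; exact: nbm.
  left; have [Y [sY AY]] := UA; have [Y' [sY' AY']] := LA.
  have NA W : N W -> closure A W.
    move=> NW; have [[]//|sW|sW] := tri W NW; apply: subset_closure.
      exact: tr1 sY sW AY.
    exact: trm sY' sW AY'.
  apply: filterS2 (near_between ht) nN => s hs Ns; split => //.
  by apply: filterS NA _; apply: open_nbhs_nbhs.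
have [tZ htZ gtZ] : exists2 tZ, 0 < tZ < 1 & gamma tZ = Z.
  have [_ [g0 g1] _ gim _] := bp.
  move: bZ; rewrite -gim => -[t /=]; rewrite in_itv/= => /andP[h1 h2] gt.
  exists t => //; rewrite !lt_neqAle h1 h2 !andbT; apply/andP; split; apply/eqP => E.
    by apply: ZV; rewrite -gt -E.
  by apply: ZV; rewrite -gt E.
have nDZ : ~ D tZ by move=> [_]; rewrite gtZ.
have [Dt0|[_ //]] := loc t0 ht0.
exfalso; apply: nDZ.
pose lo := Num.min t0 tZ; pose hi := Num.max t0 tZ.
have lohi01 (t : R) : t \in `[lo, hi] -> 0 < t < 1.
  rewrite in_itv/= /lo /hi ge_min le_max => /andP[h1 h2].
  case/andP: ht0 => a1 a2; case/andP: htZ => b1 b2.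
  apply/andP; split.
    by case/orP: h1 => h; [exact: lt_le_trans h|exact: lt_le_trans h].
  by case/orP: h2 => h; [exact: le_lt_trans h _|exact: le_lt_trans h _].
have mt0 : t0 \in `[lo, hi] by rewrite in_itv/= /lo /hi ge_min le_max !lexx.
have mtZ : tZ \in `[lo, hi] by rewrite in_itv/= /lo /hi ge_min le_max !lexx !orbT.
pose C1 := [set t : R | \forall s \near t, D s].
pose C2 := [set t : R | \forall s \near t, ~ D s].
have oC (P : set R) : open [set t : R | \forall s \near t, P s].
  rewrite openE => t /= h; have /near_join h2 : \forall s \near t, P s by exact: h.
  exact: h2.
have D1 (t : R) : t \in `[lo, hi] -> D t <-> C1 t.
  move=> /lohi01 ht; split=> [Dt|h]; last exact: nbhs_singleton h.
  by have [//|[h _]] := loc t ht; have := nbhs_singleton h.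
have D2 (t : R) : t \in `[lo, hi] -> D t <-> ~ C2 t.
  move=> /lohi01 ht; split=> [Dt h|h]; first by have := nbhs_singleton h.
  by have [h'|[h' _]] := loc t ht; [exact: nbhs_singleton h'|exfalso; apply: h].
pose B : set R := `[lo, hi] `&` D.
have : B = `[lo, hi]%classic.
  apply: (@segment_connected R lo hi).
  - by exists t0; split => //; apply/D1 => //; exact: Dt0.
  - exists C1; first exact: oC.
    by apply/seteqP; split=> t [ht h]; split => //; apply/D1.
  - exists (~` C2); first by apply: open_closedC; exact: oC.
    by apply/seteqP; split=> t [ht h]; split => //; apply/D2.
by move/seteqP=> [_ /(_ tZ mtZ)][].
Qed.

End OutwardNormal.

(** * Hopf's lemma at the straight sides *)

Section FlatHopf.
Context {R : realType}.
Implicit Types (X Y Z P Q : plane R) (E : set (plane R)) (f : plane R -> R).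
Variables (eps mu cs sn s : R).
Hypotheses (eps0 : 0 < eps) (eps1 : eps <= 1) (mu1 : 1 < mu).
Hypotheses (cs0 : 0 < cs) (sn0 : 0 < sn) (cs_sn : cs ^+ 2 + sn ^+ 2 = 1) (s2 : s ^+ 2 = 1).

Let o : plane R := (0, 0).

Lemma sqr1_cases (t : R) : t ^+ 2 = 1 -> t = 1 \/ t = -1.
Proof.
move=> t2; have /eqP : t ^+ 2 = 1 ^+ 2 by rewrite t2 expr1n.
by rewrite eqf_sqr => /orP[] /eqP; [left|right].
Qed.

Definition flat_point (l : R) : plane R := (s * (eps / 2 + l * cs), l * sn).

Lemma trig_le1 : cs <= 1 /\ sn <= 1.
Proof.
split; first exact: unit_le1 cs_sn (ltW cs0).
by apply: (@unit_le1 _ sn cs); [rewrite addrC|exact: ltW].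
Qed.

Definition upper_wedge : set (plane R) := [set X | wedge eps mu cs sn 1 X /\ 0 < X.2].

Lemma upper_wedge_convex X Y (t : R) : 0 <= t <= 1 -> upper_wedge X -> upper_wedge Y ->
  upper_wedge ((1 - t) * X.1 + t * Y.1, (1 - t) * X.2 + t * Y.2).
Proof.
have m0 : 0 <= mu by have := mu1; lra.
move=> t01 [[x1 x2 x3] x4] [[y1 y2 y3] y4]; split; last by rewrite convex_gt.
have sideE (q : R) : side_height eps cs sn q 1 ((1 - t) * X.1 + t * Y.1, (1 - t) * X.2 + t * Y.2) =
   (1 - t) * side_height eps cs sn q 1 X + t * side_height eps cs sn q 1 Y.
  by rewrite /side_height /tilt/=; ring.
split; last 2 first.
- by rewrite sideE convex_gt.
- by rewrite sideE convex_gt.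
rewrite !dist_ltP// in x1 y1 *.
apply: le_lt_trans (_ : (1 - t) * sqd o X + t * sqd o Y < _).
  rewrite -subr_ge0 (_ : _ - _ = t * (1 - t) * sqd X Y); last by rewrite /sqd/=; ring.
  by case/andP: t01 => t0 t1; rewrite !mulr_ge0 ?sqd_ge0// subr_ge0.
have k1 : - mu ^+ 2 < - sqd o X by rewrite ltrN2.
have k2 : - mu ^+ 2 < - sqd o Y by rewrite ltrN2.
have := convex_gt t01 k1 k2; rewrite !mulrN -opprD ltrN2; exact.
Qed.

Lemma upper_wedge_segment X Y (r : R) :
  rdisk r X `<=` upper_wedge -> rdisk r Y `<=` upper_wedge ->
  forall t : R, 0 <= t <= 1 ->
  rdisk r (X.1 + t * (Y.1 - X.1), X.2 + t * (Y.2 - X.2)) `<=` upper_wedge.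
Proof.
move=> hX hY t t01 W hW.
pose D : plane R := (W.1 - (X.1 + t * (Y.1 - X.1)), W.2 - (X.2 + t * (Y.2 - X.2))).
have DE : sqd (X.1 + t * (Y.1 - X.1), X.2 + t * (Y.2 - X.2)) W = D.1 ^+ 2 + D.2 ^+ 2 by [].
have H1 : upper_wedge (X.1 + D.1, X.2 + D.2).
  apply: hX; move: hW; rewrite /rdisk/=; congr (_ < _); rewrite DE /sqd/=; ring.
have H2 : upper_wedge (Y.1 + D.1, Y.2 + D.2).
  apply: hY; move: hW; rewrite /rdisk/=; congr (_ < _); rewrite DE /sqd/=; ring.
have := upper_wedge_convex t01 H1 H2; congr upper_wedge.
by rewrite [RHS]surjective_pairing /D/=; congr pair; ring.
Qed.

Lemma open_upper_wedge : open upper_wedge.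
Proof.
have m0 : 0 <= mu by have := mu1; lra.
apply: openP => X [[h1 h2 h3] h4].
rewrite dist_ltP// in h1.
have n1 := near_lt (@sqd_cont _ o X) h1.
have n2 := near_gt (@tilt_cont _ (side_normal cs sn 1 1) (side_vertex eps 1) X) h2.
have n3 := near_gt (@tilt_cont _ (side_normal cs sn (-1) 1) (side_vertex eps (-1)) X) h3.
have n4 := near_gt (@snd_cont _ X) h4.
near=> Y; split; last by near: Y.
split; last 2 first.
- by near: Y.
- by near: Y.
by rewrite dist_ltP//; near: Y.
Unshelve. all: by end_near. Qed.

Lemma flat_pointE l : [/\ side_height eps cs sn s 1 (flat_point l) = 0,
   side_height eps cs sn (- s) 1 (flat_point l) = 2 * l * (cs * sn) + eps * sn &
   0 < l < 1 / 4 -> dist o (flat_point l) < 1 /\ eps / 2 <= s * (flat_point l).1].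
Proof.
have ms2 : (- s) ^+ 2 = 1 by rewrite sqrrN.
have sE : s * (flat_point l).1 = eps / 2 + l * cs by rewrite /flat_point/= mulrA -expr2 s2 mul1r.
split.
- by rewrite side_heightE// sE /flat_point/=; ring.
- by rewrite side_heightE// mulNr sE /flat_point/=; field.
move=> /andP[l0 l1]; have [c1 n1] := trig_le1.
have [e0 [e1 [c0 n0]]] := (eps0, (eps1, (cs0, sn0))).
have lc : l * cs <= l by rewrite ler_piMr// ltW.
have ln : l * sn <= l by rewrite ler_piMr// ltW.
have lc0 : 0 < l * cs by rewrite mulr_gt0.
have ln0 : 0 < l * sn by rewrite mulr_gt0.
split; last by rewrite sE; lra.
rewrite dist_ltP// /sqd /flat_point/= !subr0 exprMn s2 mul1r expr1n.
have h1 : (eps / 2 + l * cs) ^+ 2 <= (3 / 4) ^+ 2 by rewrite ler_pXn2r// ?nnegrE; lra.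
have h2 : (l * sn) ^+ 2 <= (1 / 4) ^+ 2 by rewrite ler_pXn2r// ?nnegrE; lra.
have : (3 / 4 : R) ^+ 2 + (1 / 4) ^+ 2 < 1 by lra.
lra.
Qed.

(** A disk in the upper wedge touches the side at the flat point. Positivity of [f]
comes down the vertical axis inside the strip, then crosses the convex upper
wedge to the centre of the disk. Hopf's bound is linear in the distance
travelled in a direction that enters the disk. *)
Lemma flat_hopf E f (l : R) : 0 < l < 1 / 4 -> upper_wedge `<=` E ->
  (forall X, `|X.1| < eps / 2 -> E X) ->
  harmonic_on (E `\ o) f -> (forall X, (E `\ o) X -> 0 <= f X) ->
  (exists y, 1 < y /\ 0 < f (0, y)) ->
  exists c r, [/\ 0 < c, 0 < r & forall n : plane R, forall d, n.1 ^+ 2 + n.2 ^+ 2 = 1 ->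
     0 < tilt (side_normal cs sn s 1) (0, 0) n -> 0 < d < r * tilt (side_normal cs sn s 1) (0, 0) n ->
     c * tilt (side_normal cs sn s 1) (0, 0) n * d <= f (along (flat_point l) n d)].
Proof.
move=> hl UE strip hf f0 [y [y1 fy]].
have [e0 [e1 [c0 [n0 m1]]]] := (eps0, (eps1, (cs0, (sn0, mu1)))).
have [l0 l4] := andP hl.
have UE' : upper_wedge `<=` E `\ o.
  by move=> X UX; split; [exact: UE|move=> Xo; case: UX => _; rewrite Xo ltxx].
pose N := side_normal cs sn s 1.
have N1 : N.1 ^+ 2 + N.2 ^+ 2 = 1 by rewrite /N/= sqrrN !exprMn s2 !mul1r expr1n mul1r addrC cs_sn.
pose Z := flat_point l.
have [Z1 Z2 Z3] := flat_pointE l; rewrite -/Z in Z1 Z2 Z3.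
have [dZ ZZ] := Z3 hl.
pose rho := Num.min (Num.min (eps * sn) (l * sn)) (mu - 1) / 4.
have m0 : 0 < Num.min (Num.min (eps * sn) (l * sn)) (mu - 1).
  by rewrite !lt_min !mulr_gt0//= subr_gt0.
have rho0 : 0 < rho by rewrite divr_gt0.
have [[r1 r2] r3] : (4 * rho <= eps * sn /\ 4 * rho <= l * sn) /\ 4 * rho <= mu - 1.
  have [k1 k2] := ge_minlr (Num.min (eps * sn) (l * sn)) (mu - 1).
  have [k3 k4] := ge_minlr (eps * sn) (l * sn).
  by split; [split|]; rewrite /rho; lra.
pose P := along Z N rho.
have ZP : sqd Z P = rho ^+ 2.
  rewrite [LHS](_ : _ = rho ^+ 2 * (N.1 ^+ 2 + N.2 ^+ 2)); first by rewrite N1 mulr1.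
  by rewrite /P /along /sqd/=; ring.
have dZP : dist Z P = rho by rewrite /dist ZP sqrtr_sqr gtr0_norm.
have ballP : rdisk rho P `<=` upper_wedge.
  move=> Y; rewrite /rdisk/= -dist_ltP ?(ltW rho0)// => PY.
  have ZY : dist Z Y < 2 * rho by have := dist_triangle Z P Y; lra.
  have hsd : 0 < side_height eps cs sn s 1 Y.
    have E1 : side_height eps cs sn s 1 Y = side_height eps cs sn s 1 Z + rho * (N.1 ^+ 2 + N.2 ^+ 2) + tilt N P Y.
      by rewrite /side_height /tilt /P /along /N/=; ring.
    have := tilt_le_dist P Y N1; rewrite ler_norml => /andP[h _].
    by rewrite E1 Z1 N1; lra.
  have hsd' : 0 < side_height eps cs sn (- s) 1 Y.
    have M1 : (side_normal cs sn (- s) 1).1 ^+ 2 + (side_normal cs sn (- s) 1).2 ^+ 2 = 1.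
      by rewrite /= sqrrN !exprMn sqrrN s2 !mul1r expr1n mul1r addrC cs_sn.
    have := tilt_le_dist Z Y M1; rewrite -(tiltB _ (side_vertex eps (- s))) ler_norml.
    rewrite -/(side_height _ _ _ _ _ _) -/(side_height eps cs sn (- s) 1 Z) => /andP[h _].
    rewrite Z2 in h; have : 0 < 2 * l * (cs * sn) by rewrite !mulr_gt0.
    lra.
  split; last first.
    have := snd_le_dist Z Y; rewrite ler_norml /Z/= => /andP[h _]; lra.
  split; first by have := dist_triangle o Z Y; lra.
    have [Es|Es] := sqr1_cases s2; first by rewrite Es in hsd.
    by rewrite Es opprK in hsd'.
  have [Es|Es] := sqr1_cases s2; first by rewrite Es in hsd'.
  by rewrite Es in hsd.
(* on the axis, in the strip and in the upper wedge *)
pose Q0 : plane R := (0, 1 / 4).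
have fQ0 : 0 < f Q0.
  pose rq := Num.min (eps / 2) (1 / 4).
  have rq0 : 0 < rq by rewrite lt_min; lra.
  have [q1 q2] := ge_minlr (eps / 2) (1 / 4); rewrite -/rq in q1 q2.
  apply: (@positive_segment _ (E `\ o) f rq (0, y) Q0 rq0 hf f0) => // t /andP[t0 t1] Y.
  rewrite /rdisk/= -dist_ltP ?(ltW rq0)// => hY.
  set W := (W in dist W Y) in hY.
  have h1 := fst_le_dist W Y.
  have h2 := snd_le_dist W Y.
  have W1 : W.1 = 0 by rewrite /W/= subrr mulr0 addr0.
  have W2 : W.2 = y + t * (1 / 4 - y) by [].
  rewrite W1 subr0 in h1; rewrite W2 in h2.
  split; first by apply: strip; lra.
  move=> Yo; have Y2 : Y.2 = 0 by rewrite Yo.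
  rewrite Y2 sub0r normrN in h2.
  have : 1 / 4 <= y + t * (1 / 4 - y).
    have : 0 <= (1 - t) * (y - 1 / 4) by rewrite mulr_ge0//; lra.
    lra.
  by have := ler_norm (y + t * (1 / 4 - y)); lra.
have Q0U : upper_wedge Q0.
  have hc0 : 0 < cs * (1 / 4) by rewrite mulr_gt0//; lra.
  have hn0 : 0 < sn * (eps / 2) by rewrite mulr_gt0//; lra.
  split; last by rewrite /Q0/=; lra.
  split.
  - apply: (lt_trans _ m1); rewrite dist_ltP// /sqd /Q0/= !subr0 expr0n/= add0r expr1n expr2; lra.
  - by rewrite side_heightE ?expr1n// /Q0/= mulr0; lra.
  - by rewrite side_heightE ?sqrrN ?expr1n// /Q0/= mulr0; lra.
have fP : 0 < f P.
  have [|r' r'0 Hr'] := @near_rdisk _ Q0 upper_wedge.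
    by apply: open_nbhs_nbhs; split => //; exact: open_upper_wedge.
  pose rr := Num.min r' rho.
  have rr0 : 0 < rr by rewrite lt_min r'0.
  have [q1 q2] := ge_minlr r' rho; rewrite -/rr in q1 q2.
  have mono (a : R) W : rr <= a -> rdisk rr W `<=` rdisk a W.
    move=> ra Y; rewrite /rdisk/= => /lt_le_trans; apply.
    by rewrite ler_pXn2r ?nnegrE// ?(ltW rr0)// (le_trans (ltW rr0) ra).
  apply: (@positive_segment _ (E `\ o) f rr Q0 P rr0 hf f0) => // t ht.
  apply: subset_trans UE'; apply: upper_wedge_segment => //.
    by apply: subset_trans Hr'; exact: mono.
  by apply: subset_trans ballP; exact: mono.
have hfP : harmonic_on (rdisk rho P) f by move=> X /ballP/UE'; exact: hf.
have [|c c00 Hc] := hopf_ball rho0 hfP _ fP; first by move=> X /ballP/UE'; exact: f0.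
exists (c * rho), rho; split => //; first by rewrite mulr_gt0.
move=> n d n1 k0 /andP[d0 dk]; set k := tilt _ _ _ in k0 dk *.
have sE : sqd P (along Z n d) = rho ^+ 2 - 2 * rho * d * k + d ^+ 2.
  rewrite [RHS](_ : _ = rho ^+ 2 * (N.1 ^+ 2 + N.2 ^+ 2) - 2 * rho * d * k + d ^+ 2 * (n.1 ^+ 2 + n.2 ^+ 2)).
    by rewrite /k /tilt /P /along /sqd /= -/N; ring.
  by rewrite N1 n1 !mulr1.
have dd : d ^+ 2 <= rho * k * d by rewrite expr2 ler_pM2r// ltW.
have rdk : 0 < rho * k * d by rewrite !mulr_gt0.
have inb : rdisk rho P (along Z n d) by rewrite /rdisk/= sE; lra.
apply: le_trans (Hc _ inb); rewrite (_ : c * rho * k * d = c * (rho * k * d)); last by rewrite !mulrA.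
by rewrite ler_pM2l// sE; lra.
Qed.

End FlatHopf.

(** * Reflection in the horizontal axis *)

Section Reflection.
Context {R : realType}.
Implicit Types (X Y Z P : plane R) (A : set (plane R)).

Definition refl X : plane R := (X.1, - X.2).

Lemma refl_cont X : {for X, continuous refl}.
Proof.
apply: continuous_pair; first exact: fst_cont.
by case: (jetN (jet_snd X)).
Qed.

Lemma reflK X : refl (refl X) = X.
Proof. by rewrite /refl/= opprK -surjective_pairing. Qed.

Lemma refl_neq_o X : X <> (0, 0) -> refl X <> (0, 0).
Proof. by move=> Xo h; apply: Xo; rewrite -[LHS]reflK h /refl/= oppr0. Qed.

Lemma sqd_refl X : sqd (0, 0) (refl X) = sqd (0, 0) X.
Proof. by rewrite /sqd/= !subr0 sqrrN. Qed.

Lemma harmonic_refl (U : set (plane R)) (u : plane R -> R) : (forall X, U X -> U (refl X)) ->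
  harmonic_on U u -> harmonic_on U (fun Y => u Y + u (refl Y)).
Proof.
move=> rU hu X UX; have [a [b j1]] := hu X UX.
have [a' [b' j2]] := hu (refl X) (rU _ UX).
have rE Y : (Y.1, 0 - Y.2) = refl Y by rewrite sub0r.
have j3 : jet u (X.1, 0 - X.2) a' b' 0 by rewrite rE.
have j5 : jet (fun Y => u (refl Y)) X a' (- b') 0.
  rewrite (_ : (fun Y => u (refl Y)) = (fun Y => u (Y.1, 0 - Y.2))); first exact: jet_reflect2 j3.
  by apply/funext => Y; rewrite rE.
by do 2 eexists; apply: (jet_eq (jetD j1 j5)) => //; rewrite addr0.
Qed.

(** Iterated derivatives at [t] depend only on values near [t], so equalities on the
open interval can be propagated by induction. *)
Lemma opp_derive1n (g : R -> R) :
  (forall n (t : R), 0 < t < 1 -> derivable (derive1n n g) t 1) ->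
  forall n (t : R), 0 < t < 1 ->
  derive1n n (fun s => - g s) t = - derive1n n g t /\
  derivable (derive1n n (fun s => - g s)) t 1.
Proof.
move=> dg n.
have step m : (forall t : R, 0 < t < 1 -> derive1n m (fun s => - g s) t = - derive1n m g t) ->
    forall t : R, 0 < t < 1 -> derivable (derive1n m (fun s => - g s)) t 1.
  move=> E t ht; apply: (@near_eq_derivable _ _ _ (- derive1n m g)).
    by apply: filterS (near_between ht) => s /E ->.
  by apply: derivableN; exact: dg.
suff E : forall t : R, 0 < t < 1 -> derive1n n (fun s => - g s) t = - derive1n n g t.
  by move=> t ht; split; [exact: E|exact: step].
elim: n => [//|n IH] t ht.
rewrite !derive1nS !derive1E -deriveN; last exact: dg.
by apply: near_eq_derive; apply: filterS (near_between ht) => s /IH ->.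
Qed.

Lemma reflect_param A V (gamma : R -> plane R) : V.2 = 0 ->
  (forall X, bdry A (refl X) <-> bdry A X) ->
  boundary_param A V gamma ->
  boundary_param A V (refl \o gamma) /\
  forall t : R, 0 < t < 1 -> velocity (refl \o gamma) t = refl (velocity gamma t).
Proof.
move=> V2 rb [cg [g0 g1] ginj gim gsm].
have rV : refl V = V by rewrite /refl V2 oppr0 -V2 -surjective_pairing.
have d2 n (t : R) : 0 < t < 1 -> derivable (derive1n n (fun s => (gamma s).2)) t 1.
  by move=> ht; have [|/(_ n)[]] := gsm t; first rewrite in_itv.
have vE (t : R) : 0 < t < 1 -> velocity (refl \o gamma) t = refl (velocity gamma t).
  move=> ht; rewrite /velocity /refl/=; congr pair.
  have [h _] := opp_derive1n d2 1 ht; exact: h.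
split => //; split.
- move=> t; apply: (@continuous_comp (subspace _) _ _ gamma refl); first exact: cg.
  exact: refl_cont.
- by rewrite /= g0 g1.
- move=> x y hx hy /= h; apply: ginj => //.
  by rewrite -[LHS]reflK h reflK.
- apply/seteqP; split=> X.
    by move=> [t ht <-]; apply/rb; rewrite -gim; exists t.
  move=> /rb; rewrite -gim => -[s hs E]; exists s => //=.
  by rewrite E reflK.
- move=> t ht; have [h1 h2] := gsm t ht.
  move: (ht); rewrite in_itv/= => ht'.
  split.
    move=> n; split; first exact: (h1 n).1.
    by have [_] := opp_derive1n d2 n ht'.
  rewrite vE// => h; apply: h2; rewrite -[LHS]reflK h.
  by rewrite /refl/= oppr0.
Qed.

End Reflection.

(** * Flux through the boundary of an inclusion *)

Section VanishingIntegral.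
Context {R : realType}.
Local Notation mu := (@lebesgue_measure R).

Lemma integral_zero_positive (F : R -> R) (a b : R) :
  mu.-integrable `]0, 1[ (EFin \o F) -> \int[mu]_(t in `]0, 1[) F t = 0 ->
  (forall t : R, 0 < t < 1 -> 0 <= F t) ->
  0 <= a -> a < b -> b <= 1 -> (forall t : R, a < t < b -> 0 < F t) -> False.
Proof.
move=> iF I0 F0 a0 ab b1 Fp.
have mD : measurable (`]0, 1[%classic : set (measurableTypeR R)) by exact: measurable_itv.
have mF := measurable_int _ iF.
have I1 : (\int[mu]_(x in `]0%R, 1%R[) `|(EFin \o F) x| = 0)%E.
  transitivity (\int[mu]_(x in `]0%R, 1%R[) (EFin \o F) x)%E.
    by apply: eq_integral => x; rewrite inE/= in_itv/= => /F0 h; rewrite ger0_norm.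
  have := integrable_fin_num mD iF => h.
  by rewrite -(fineK h); congr EFin; exact: I0.
have /(ae_eq_integral_abs mu mD mF) [N [mN N0 HN]] := I1.
have sub : `]a, b[%classic `<=` N.
  move=> t /=; rewrite in_itv/= => ht; apply: HN => /= h.
  have t01 : `]0, 1[%classic t by rewrite /= in_itv/=; move: ht; lra.
  have := h t01; move=> [] E; have := Fp t ht; by rewrite E ltxx.
have : (mu `]a, b[%classic <= mu N)%E.
  by apply: le_measure => //; rewrite inE//; exact: measurable_itv.
by rewrite N0 lebesgue_measure_itv/= lte_fin ab -EFinB lee_fin subr_le0 leNgt ab.
Qed.

End VanishingIntegral.

Section Flux.
Context {R : realType}.
Implicit Types (X Y Z P : plane R) (E : set (plane R)) (u : plane R -> R).
Variables (eps mu cs sn s : R) (A : set (plane R)).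
Hypotheses (eps0 : 0 < eps) (eps1 : eps <= 1) (mu1 : 1 < mu).
Hypotheses (cs0 : 0 < cs) (sn0 : 0 < sn) (cs_sn : cs ^+ 2 + sn ^+ 2 = 1) (s2 : s ^+ 2 = 1).
Hypothesis hA : cone_domain eps mu cs sn s A.

Let o : plane R := (0, 0).
Let V := side_vertex eps s.
Local Notation sh := (side_height eps cs sn s).

Lemma along_cont X n (x : R) : {for x, continuous (along X n)}.
Proof.
have k1 := jet2_continuous (jet2D (jet2_cst X.1 x) (jet2M (jet2_id x) (jet2_cst n.1 x))).
have k2 := jet2_continuous (jet2D (jet2_cst X.2 x) (jet2M (jet2_id x) (jet2_cst n.2 x))).
exact: (continuous_pair k1 k2).
Qed.

Lemma along0 X n : along X n 0 = X.
Proof. by rewrite /along !mul0r !addr0 -surjective_pairing. Qed.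

Lemma bdry_refl X : bdry A (refl X) <-> bdry A X.
Proof.
rewrite !(bdry_open hA); case: X => x y; rewrite /refl/=.
have := closure_reflect hA x y; have := cd_sym hA x y; tauto.
Qed.

(** Off the upper line, a point on the inner side of the lower line is either away
from the closure or in the open cone. *)
Lemma near_flat_point Z : dist o Z < mu -> sh (-1) Z < 0 -> bdry A Z -> sh 1 Z = 0.
Proof.
move=> Zmu h /(bdry_open hA)[cZ nZ].
apply/eqP; rewrite eq_le; apply/andP; split; rewrite leNgt; apply/negP => k.
  by apply: (side_open_exterior hA _ Zmu k cZ); left.
by apply: nZ; apply/(cd_cone hA Zmu).
Qed.

Lemma flat_point_of Z : sh 1 Z = 0 -> Z = flat_point eps cs sn s (Z.2 / sn).
Proof.
rewrite side_heightE// mul1r => h.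
have E2 : Z.2 / sn * sn = Z.2 by field; rewrite gt_eqF.
have E1 : Z.2 / sn * cs = s * Z.1 - eps / 2.
  have -> : Z.2 / sn * cs = (cs * Z.2) / sn by ring.
  have -> : cs * Z.2 = sn * (s * Z.1 - eps / 2) by lra.
  by field; rewrite gt_eqF.
rewrite [LHS]surjective_pairing /flat_point E1 E2; congr pair.
have -> : eps / 2 + (s * Z.1 - eps / 2) = s * Z.1 by ring.
by rewrite mulrA -expr2 s2 mul1r.
Qed.

(** Since the curve is injective, the normals obtained at each parameter assemble into
a function of the boundary point. *)
Lemma normals_exist (gamma : R -> plane R) : boundary_param A V gamma ->
  exists nu : plane R -> plane R, forall t : R, 0 < t < 1 ->
    [/\ (nu (gamma t)).1 ^+ 2 + (nu (gamma t)).2 ^+ 2 = 1,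
        dotp (nu (gamma t)) (velocity gamma t) = 0 &
     exists2 d : R, 0 < d & forall x, 0 < x < d ->
       A (along (gamma t) (nu (gamma t)) x) /\
       ~ closure A (along (gamma t) (nu (gamma t)) (- x))].
Proof.
move=> bp.
have oA := cd_open hA.
have l8 : 0 < (1 / 8 : R) < 1 / 4 by lra.
have [F1 F2 F3] := flat_pointE eps0 eps1 cs0 sn0 cs_sn s2 (1 / 8 : R).
have [F4 F5] := F3 l8.
set Z := flat_point _ _ _ _ _ in F1 F2 F4 F5.
have Zmu : dist o Z < mu by apply: lt_trans mu1.
have bZ : bdry A Z by apply: (@flat_bdry R eps mu cs sn s A sn0 s2 hA 1) => //; left.
have ex := @outward_normal R A V gamma oA bp _.
have {}ex : forall t0 : R, 0 < t0 < 1 -> exists n : plane R,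
    [/\ n.1 ^+ 2 + n.2 ^+ 2 = 1, dotp n (velocity gamma t0) = 0 &
     exists2 d : R, 0 < d & forall s, 0 < s < d ->
       A (along (gamma t0) n s) /\ ~ closure A (along (gamma t0) n (- s))].
  apply: ex; exists Z; split => //.
    move=> ZV; have : Z.2 = 0 by rewrite ZV.
    by rewrite /Z /flat_point/= => h; have : 0 < 1 / 8 * sn; [rewrite mulr_gt0//; lra|rewrite h ltxx].
  move=> nZ.
  pose N := side_normal cs sn s 1.
  have N1 : N.1 ^+ 2 + N.2 ^+ 2 = 1 by rewrite /N/= sqrrN !exprMn s2 !mul1r expr1n mul1r addrC cs_sn.
  have cg : {for (0 : R), continuous (along Z N)} by exact: along_cont.
  have g0 : along Z N 0 = Z by exact: along0.
  have nmu : \forall Y \near Z, dist o Y < mu.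
    have mu0 : 0 <= mu by apply: le_trans (ltW Zmu); exact: dist_ge0.
    rewrite dist_ltP// in Zmu; have := near_lt (@sqd_cont _ o Z) Zmu.
    by apply: filterS => Y; rewrite dist_ltP.
  have nn : nbhs (along Z N 0) (closure A `&` [set Y | dist o Y < mu]) by rewrite g0; apply: filterI.
  have [e /= ee He] := cg _ nn.
  have [|cl hmu] := He (e / 2); first by rewrite /ball_/= sub0r normrN gtr0_norm; lra.
  apply: (side_open_exterior hA _ hmu _ cl); first by left.
  have -> : sh 1 (along Z N (e / 2)) = sh 1 Z + e / 2 * (N.1 ^+ 2 + N.2 ^+ 2).
    by rewrite /side_height /tilt /along /N/=; ring.
  by rewrite F1 N1; lra.
pose Q (t : R) (n : plane R) := [/\ n.1 ^+ 2 + n.2 ^+ 2 = 1, dotp n (velocity gamma t) = 0 &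
     exists2 d : R, 0 < d & forall s, 0 < s < d ->
       A (along (gamma t) n s) /\ ~ closure A (along (gamma t) n (- s))].
pose S X := [set n : plane R | exists t : R, [/\ 0 < t < 1, gamma t = X & Q t n]].
exists (fun X => xget (0, 0) (S X)) => t ht.
have [n Qn] := ex t ht.
have : S (gamma t) (xget (0, 0) (S (gamma t))).
  by apply: (@xgetPex _ (0, 0) (S (gamma t))); exists n, t.
set m := xget _ _; move=> [t' [ht' gt' Qt']].
suff E : t' = t by rewrite E in Qt'.
have [_ _ ginj _ _] := bp.
by apply: ginj => //; rewrite in_itv/=; [case/andP: ht' => /ltW->|case/andP: ht => /ltW->].
Qed.

Lemma flat_stretch (gamma : R -> plane R) : boundary_param A V gamma ->
  exists a b : R, [/\ 0 <= a, a < b, b <= 1 &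
    forall t : R, a < t < b -> [/\ 0 < t < 1, dist o (gamma t) < mu, sh 1 (gamma t) = 0 &
      0 < (gamma t).2 / sn < 1 / 4]].
Proof.
move=> bp.
have l8 : 0 < (1 / 8 : R) < 1 / 4 by lra.
have [F1 F2 F3] := flat_pointE eps0 eps1 cs0 sn0 cs_sn s2 (1 / 8 : R).
have [F4 F5] := F3 l8.
set Z := flat_point _ _ _ _ _ in F1 F2 F4 F5.
have Zmu : dist o Z < mu by apply: lt_trans mu1.
have bZ : bdry A Z by apply: (@flat_bdry R eps mu cs sn s A sn0 s2 hA 1) => //; left.
have Z2 : Z.2 = sn * (1 / 8) by rewrite /Z /flat_point/= mulrC.
have Zm : sh (-1) Z < 0.
  have [k1 k2] := (cs0, sn0).
  have := F1; rewrite !side_heightE// Z2 => h.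
  have : 0 < cs * (sn * (1 / 8)) by rewrite !mulr_gt0//; lra.
  lra.
have [tZ htZ gtZ] : exists2 tZ, 0 < tZ < 1 & gamma tZ = Z.
  have [_ [g0 g1] _ gim _] := bp.
  have ZV : Z <> V.
    move=> ZV; have : Z.2 = 0 by rewrite ZV.
    by rewrite Z2 => h; have : 0 < sn * (1 / 8); [rewrite mulr_gt0//; lra|rewrite h ltxx].
  move: bZ; rewrite -gim => -[t /=]; rewrite in_itv/= => /andP[h1 h2] gt.
  exists t => //; rewrite !lt_neqAle h1 h2 !andbT; apply/andP; split; apply/eqP => Et.
    by apply: ZV; rewrite -gt -Et.
  by apply: ZV; rewrite -gt Et.
have nZ : \forall Y \near Z, [/\ dist o Y < mu, sh (-1) Y < 0, 0 < Y.2 & Y.2 < sn * (1 / 4)].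
  have mu0 : 0 <= mu by apply: le_trans (ltW Zmu); exact: dist_ge0.
  have [k1 k2] := (cs0, sn0).
  rewrite dist_ltP// in Zmu.
  have n1 := near_lt (@sqd_cont _ o Z) Zmu.
  have n2 := near_lt (@side_height_cont _ eps cs sn s (-1) Z) Zm.
  have z2 : 0 < Z.2 by rewrite Z2 mulr_gt0//; lra.
  have z2' : Z.2 < sn * (1 / 4) by rewrite Z2 ltr_pM2l//; lra.
  have n3 := near_gt (@snd_cont _ Z) z2.
  have n4 := near_lt (@snd_cont _ Z) z2'.
  near=> Y; split; [by rewrite dist_ltP//; near: Y|by near: Y|by near: Y|by near: Y].
have [e /= ee He] : \forall t \near tZ, 0 < t < 1 /\
    [/\ dist o (gamma t) < mu, sh (-1) (gamma t) < 0, 0 < (gamma t).2 & (gamma t).2 < sn * (1 / 4)].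
  apply: filterI.
    exact: near_between.
  have nn : nbhs (gamma tZ) [set Y : plane R | [/\ dist o Y < mu, sh (-1) Y < 0, 0 < Y.2 & Y.2 < sn * (1 / 4)]].
    by rewrite gtZ.
  have cgam := param_continuous bp htZ; exact: (cgam _ nn).
have He' (t : R) : tZ - e < t < tZ + e -> 0 < t < 1 /\
    [/\ dist o (gamma t) < mu, sh (-1) (gamma t) < 0, 0 < (gamma t).2 & (gamma t).2 < sn * (1 / 4)].
  by move=> ht; apply: He; rewrite /ball_/= ltr_distlC.
have [/andP[a0 _] _] : 0 < tZ - e / 2 < 1 /\ _ := He' (tZ - e / 2) ltac:(lra).
have [/andP[_ b1] _] : 0 < tZ + e / 2 < 1 /\ _ := He' (tZ + e / 2) ltac:(lra).
exists (tZ - e / 2), (tZ + e / 2); split; [exact: ltW|lra|exact: ltW|].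
move=> t hte; have [|ht [t1 t2 t3 t4]] := He' t; first lra.
split => //; first exact: near_flat_point t1 t2 (param_bdry bp ht).
by rewrite divr_gt0//= ltr_pdivrMr// mulrC.
Unshelve. all: by end_near. Qed.

(** Points just inside the inclusion are below the side. *)
Lemma inward_slope Z (n : plane R) (d : R) : dist o Z < mu -> sh 1 Z = 0 -> 0 < d ->
  (forall x, 0 < x < d -> A (along Z n x)) ->
  0 < tilt (side_normal cs sn s 1) (0, 0) (- n.1, - n.2).
Proof.
move=> t1 st d0 Hd.
have [x0] : exists x, 0 < x < d /\ dist o (along Z n x) < mu.
  have cg : {for (0 : R), continuous (along Z n)} by exact: along_cont.
  have g0 : along Z n 0 = Z by exact: along0.
  have mu0 : 0 <= mu by apply: le_trans (ltW t1); exact: dist_ge0.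
  have nn : \forall x \near (0 : R), dist o (along Z n x) < mu.
    apply: (cg [set Y | dist o Y < mu]); rewrite g0.
    move: t1; rewrite dist_ltP// => t1; have := near_lt (@sqd_cont _ o Z) t1.
    by apply: filterS => Y /=; rewrite dist_ltP.
  have [e' /= e'0 He2] := nn.
  have [q1 q2] := ge_minlr e' d.
  have q3 : 0 < Num.min e' d by rewrite lt_min e'0.
  exists (Num.min e' d / 2); split; first by lra.
  by apply: He2; rewrite /ball_/= sub0r normrN gtr0_norm; lra.
move=> [hx bx]; have Ax := Hd _ hx.
have [h _] := (cd_cone hA bx).1 Ax.
have Et : sh 1 (along Z n x0) = sh 1 Z - x0 * tilt (side_normal cs sn s 1) (0, 0) (- n.1, - n.2).
  by rewrite /side_height /tilt /along/=; ring.
move: h; rewrite Et st sub0r oppr_lt0 pmulr_rgt0//; by case/andP: hx.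
Qed.

(** The flux along the curve and along its reflection add up to the flux of the even
part, whose density is the limit of the quotients [(2 c - h) / s >= 0] and is
positive on the flat stretch by [flat_hopf]; yet its integral is zero. *)
Lemma flux_contradiction E u (c : R) :
  zero_flux A V u -> (forall X, bdry A X -> u X = c) ->
  (forall Z, closure A Z -> \forall Y \near Z, ~ closure A Y -> E Y) ->
  upper_wedge eps mu cs sn `<=` E -> (forall X, `|X.1| < eps / 2 -> E X) ->
  (forall X, E X -> E (refl X)) ->
  harmonic_on (E `\ o) u ->
  (forall X, (E `\ o) X -> u X + u (refl X) <= 2 * c) ->
  (exists y, 1 < y /\ u (0, y) + u (0, - y) < 2 * c) -> False.
Proof.
move=> zf uc Enear UE strip Erefl hu hle [y0 [y1 hy]].
pose f X := 2 * c - (u X + u (refl X)).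
have f0 X : (E `\ o) X -> 0 <= f X by move=> /hle; rewrite subr_ge0.
have hf : harmonic_on (E `\ o) f.
  have hc : harmonic_on (E `\ o) (fun=> 2 * c) by move=> X _; do 2 eexists; exact: jet_cst.
  apply: (harmonicB hc); apply: harmonic_refl hu => X [EX Xo].
  by split; [exact: Erefl|exact: refl_neq_o].
have fy : exists y, 1 < y /\ 0 < f (0, y) by exists y0; split => //; rewrite /f subr_gt0.
have [gamma bp] := cd_curve hA.
have [nu Hnu] := normals_exist bp.
have V2 : V.2 = 0 by [].
have [bp' vE] := reflect_param V2 bdry_refl bp.
pose nu' X := refl (nu (refl X)).
have in01 (t : R) : t \in `]0, 1[ -> 0 < t < 1 by rewrite in_itv.
have scaleE X n (x : R) : X + x *: n = along X n x.
  by [].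
have un : unit_normal_into A gamma nu.
  move=> t /in01 /Hnu [n1 nv [d d0 Hd]]; split => //.
    by rewrite /enorm /dotp -!expr2 n1 sqrtr1.
  near=> x; rewrite scaleE; apply: (Hd x _).1; apply/andP; split; near: x.
    exact: nbhs_right_gt.
  exact: nbhs_right_lt.
have un' : unit_normal_into A (refl \o gamma) nu'.
  move=> t /in01 ht; have [n1 nv [d d0 Hd]] := Hnu t ht; split => //.
  - by rewrite /enorm /dotp /nu' /= reflK mulrNN -!expr2 n1 sqrtr1.
  - by rewrite vE// /dotp /nu' /= reflK mulrNN.
  near=> x; rewrite scaleE /nu' /= reflK.
  have -> : along (refl (gamma t)) (refl (nu (gamma t))) x = refl (along (gamma t) (nu (gamma t)) x).
    by rewrite /along /refl/=; congr pair; ring.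
  rewrite /refl; apply/(cd_sym hA); rewrite -surjective_pairing.
  apply: (Hd x _).1; apply/andP; split; near: x.
    exact: nbhs_right_gt.
  exact: nbhs_right_lt.
have [cq1 i1 I1] := zf _ _ bp un.
have [cq2 i2 I2] := zf _ _ bp' un'.
pose q t := normal_derivative u nu (gamma t) + normal_derivative u nu' (refl (gamma t)).
pose m t : plane R := (- (nu (gamma t)).1, - (nu (gamma t)).2).
have qlim (t : R) : 0 < t < 1 -> f (along (gamma t) (m t) x) / x @[x --> 0^'+] --> q t.
  move=> ht; have t01 : t \in `]0, 1[ by rewrite in_itv.
  have h := cvgD (cq1 t t01) (cq2 t t01).
  rewrite (_ : (fun x => f (along (gamma t) (m t) x) / x) = normal_quotient u nu (gamma t) \+ normal_quotient u nu' ((refl \o gamma) t)); first exact: h.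
  apply/funext => x; apply/esym.
  have bt := param_bdry bp ht.
  have u1 : u (gamma t) = c by exact: uc.
  have u2 : u (refl (gamma t)) = c by apply: uc; apply/bdry_refl.
  rewrite /= /normal_quotient u1 u2.
  have -> : gamma t - x *: nu (gamma t) = along (gamma t) (m t) x.
    by rewrite [LHS]surjective_pairing /along/=; congr pair; rewrite mulrN.
  have -> : refl (gamma t) - x *: nu' (refl (gamma t)) = refl (along (gamma t) (m t) x).
    rewrite /nu' reflK [LHS]surjective_pairing /along/=; congr pair; first by rewrite mulrN.
    exact: (esym (opprD _ _)).
  by rewrite /f; ring.
have qge (b t : R) : 0 < t < 1 -> (\forall x \near 0^'+, b <= f (along (gamma t) (m t) x) / x) -> b <= q t.
  move=> ht hb; have L := qlim t ht.
  rewrite -(cvg_lim _ L)//; apply: limr_ge => //.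
  by apply/cvg_ex; exists (q t).
have q0 (t : R) : 0 < t < 1 -> 0 <= q t.
  move=> ht; apply: qge => //.
  have [n1 nv [d d0 Hd]] := Hnu t ht.
  have bt := param_bdry bp ht; have [ct _] := (bdry_open hA (gamma t)).1 bt.
  have gto : gamma t <> o.
    move=> E0; have := closure_half hA ct; rewrite E0 mulr0 => h.
    by move: h; rewrite leNgt divr_gt0.
  have nE := Enear _ ct.
  have no : \forall Y \near gamma t, Y <> o.
    have k1 : {for gamma t, continuous (sqd o)} by exact: sqd_cont.
    have := near_gt k1 (sqd_o_gt0 gto).
    by apply: filterS => Y h Yo; move: h; rewrite Yo /sqd subrr expr0n/= addr0 ltxx.
  have cg : {for (0 : R), continuous (along (gamma t) (m t))} by exact: along_cont.
  have g0 : along (gamma t) (m t) 0 = gamma t by exact: along0.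
  have nn : \forall x \near (0 : R), (~ closure A (along (gamma t) (m t) x) -> E (along (gamma t) (m t) x))
     /\ along (gamma t) (m t) x <> o.
    by apply: (cg [set Y | (~ closure A Y -> E Y) /\ Y <> o]); rewrite g0; apply: filterI.
  have [e /= ee He] := nn.
  near=> x.
  have x0 : 0 < x by near: x; exact: nbhs_right_gt.
  have xd : x < d by near: x; exact: nbhs_right_lt.
  have xe : x < e by near: x; exact: nbhs_right_lt.
  rewrite divr_ge0 ?(ltW x0)//; apply: f0.
  have [|h1 h2] := He x; first by rewrite /ball_/= sub0r normrN gtr0_norm.
  split => //; apply: h1.
  have [|_] := Hd x; first by rewrite x0 xd.
  by rewrite /along /m/= !mulrN !mulNr.
pose F t := normal_derivative u nu (gamma t) * enorm (velocity gamma t) +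
  normal_derivative u nu' ((refl \o gamma) t) * enorm (velocity (refl \o gamma) t).
have FE (t : R) : 0 < t < 1 -> F t = q t * enorm (velocity gamma t).
  move=> ht; rewrite /F vE// [RHS]mulrDl; congr (_ + _ * _).
  by rewrite /enorm /dotp/= mulrNN.
have vel0 (t : R) : 0 < t < 1 -> 0 < enorm (velocity gamma t).
  move=> ht; have [_ _ _ _ gsm] := bp.
  have [|_ h] := gsm t; first by rewrite in_itv.
  by rewrite enormE sqrtr_gt0 sqd_o_gt0.
have mD : measurable (`]0, 1[%classic : set (measurableTypeR R)) by exact: measurable_itv.
have iF : lebesgue_measure.-integrable `]0, 1[ (EFin \o F).
  exact: (integrableD mD i1 i2).
have F0 : \int[lebesgue_measure]_(t in `]0, 1[) F t = 0.
  have := RintegralD mD i1 i2; rewrite I1 I2 addr0; exact.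
(* the density is positive at the parameters of a flat stretch *)
have [a [b [a0 ab b1 Hab]]] := flat_stretch bp.
apply: (@integral_zero_positive R F a b iF F0) => //.
  by move=> t ht; rewrite FE// mulr_ge0 ?q0// ltW// vel0.
move=> t hte; have [ht t1 st hl] := Hab t hte.
rewrite FE// mulr_gt0 ?vel0//.
have gE := flat_point_of st.
have [c0 [r [c00 r0 Hc]]] := flat_hopf eps0 eps1 mu1 cs0 sn0 cs_sn s2 hl UE strip hf f0 fy.
have [n1 nv [d d0 Hd]] := Hnu t ht.
have k00 : 0 < tilt (side_normal cs sn s 1) (0, 0) (m t).
  by apply: (inward_slope t1 st d0) => x /Hd[].
apply: lt_le_trans (_ : c0 * tilt (side_normal cs sn s 1) (0, 0) (m t) <= _); first exact: mulr_gt0.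
apply: qge => //; near=> x.
have x0 : 0 < x by near: x; exact: nbhs_right_gt.
have xr : x < r * tilt (side_normal cs sn s 1) (0, 0) (m t) by near: x; apply: nbhs_right_lt; exact: mulr_gt0.
rewrite ler_pdivlMr//; rewrite [X in along X]gE; apply: Hc => //.
  by rewrite /m/= !sqrrN.
by rewrite x0.
Unshelve. all: by end_near. Qed.

End Flux.

(** * The exterior of the two inclusions *)

Section ExteriorDomain.
Context {R : realType}.
Implicit Types (X Y Z P : plane R) (u : plane R -> R).
Variables (eps mu cs sn : R) (A : R -> set (plane R)).
Hypotheses (eps0 : 0 < eps) (eps1 : eps <= 1) (mu1 : 1 < mu).
Hypotheses (cs0 : 0 < cs) (sn0 : 0 < sn) (cs_sn : cs ^+ 2 + sn ^+ 2 = 1).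
Hypothesis hA : forall s, s ^+ 2 = 1 -> cone_domain eps mu cs sn s (A s).

Let o : plane R := (0, 0).

Definition outer : set (plane R) := [set X | forall s, s ^+ 2 = 1 -> ~ closure (A s) X].
Local Notation E := outer.

Lemma sqr_one : (1 : R) ^+ 2 = 1. Proof. exact: expr1n. Qed.
Lemma sqr_mone : (- 1 : R) ^+ 2 = 1. Proof. by rewrite sqrrN expr1n. Qed.

Lemma outer_alt X : ~ E X -> exists2 s, s ^+ 2 = 1 & closure (A s) X.
Proof.
move=> nE; apply: contrapT => h; apply: nE => s s2 cl; apply: h.
by exists s.
Qed.

Lemma open_outer : open E.
Proof.
have oC s : open (~` closure (A s)) by apply: closed_openC; exact: closed_closure.
suff -> : E = (~` closure (A 1)) `&` (~` closure (A (-1))) by exact: openI.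
apply/seteqP; split=> X /=; first by move=> h; split; apply: h; [exact: sqr_one|exact: sqr_mone].
by move=> [h1 h2] s /sqr1_cases[]->.
Qed.

Lemma strip_outer X : `|X.1| < eps / 2 -> E X.
Proof.
move=> h s s2 /(closure_half (hA s2)) k.
have : s * X.1 <= `|X.1|.
  by case: (sqr1_cases s2) => ->; rewrite ?mul1r ?mulN1r ?ler_norm// -normrN ler_norm.
by move=> k2; have := lt_le_trans (le_lt_trans k2 h) k; rewrite ltxx.
Qed.

Lemma origin_outer : E o.
Proof. by apply: strip_outer; rewrite normr0 divr_gt0. Qed.

Lemma wedge_outer t : t ^+ 2 = 1 -> wedge eps mu cs sn t `<=` E.
Proof.
move=> t2 X [Xmu h1 h2] s s2.
have ht := sqr1_cases t2.
case: (sqr1_cases s2) => Es; rewrite Es in s2 *.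
  exact: (side_open_exterior (hA sqr_one) ht Xmu h1).
exact: (side_open_exterior (hA sqr_mone) ht Xmu h2).
Qed.

Lemma outer_wedge t X : t ^+ 2 = 1 -> E X -> dist o X < mu -> 0 <= t * X.2 ->
  wedge eps mu cs sn t X.
Proof.
move=> t2 EX Xmu tX.
have key s : s ^+ 2 = 1 -> 0 < side_height eps cs sn s t X.
  move=> s2; rewrite ltNge; apply/negP => h; apply: (EX s s2).
  have h' : side_height eps cs sn s (- t) X <= 0.
    have : 0 <= cs * (t * X.2) by rewrite mulr_ge0// ltW.
    by move: h; rewrite !side_heightE//; lra.
  case: (sqr1_cases t2) h h' => ->; rewrite ?opprK => h h'.
    exact: (closed_cone_closure sn0 s2 (hA s2)).
  exact: (closed_cone_closure sn0 s2 (hA s2)).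
by split => //; apply: key; [exact: sqr_one|exact: sqr_mone].
Qed.

Lemma refl_outer X : E X -> E (refl X).
Proof.
case: X => x y EX s s2 /=; rewrite /refl/= => h.
by apply: (EX s s2); apply/(closure_reflect (hA s2)).
Qed.

Lemma near_outer s Z : s ^+ 2 = 1 -> closure (A s) Z ->
  \forall Y \near Z, ~ closure (A s) Y -> E Y.
Proof.
move=> s2 cZ; have h := closure_half (hA s2) cZ.
have cf : {for Z, continuous (fun Y : plane R => s * Y.1)} by case: (jetZ s (jet_fst Z)).
have sZ : 0 < s * Z.1 by apply: lt_le_trans h; rewrite divr_gt0.
have := near_gt cf sZ; apply: filterS => Y sY nY s' s2'.
have sE : s' = s \/ s' = - s.
  case: (sqr1_cases s2) => ->; case: (sqr1_cases s2') => ->; rewrite ?opprK; by [left|right].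
case: sE => -> //; have ms2 : (- s) ^+ 2 = 1 by rewrite sqrrN.
move/(closure_half (hA ms2)); rewrite mulNr => k.
by have := eps0; lra.
Qed.

End ExteriorDomain.

(** * The even part of the potential *)

Section EvenPart.
Context {R : realType}.
Implicit Types (X Y Z P : plane R) (u : plane R -> R).
Variables (eps mu cs sn : R) (A : R -> set (plane R)).
Hypotheses (eps0 : 0 < eps) (eps1 : eps <= 1) (mu1 : 1 < mu).
Hypotheses (cs0 : 0 < cs) (sn0 : 0 < sn) (cs_sn : cs ^+ 2 + sn ^+ 2 = 1).
Hypothesis hA : forall s, s ^+ 2 = 1 -> cone_domain eps mu cs sn s (A s).

Let o : plane R := (0, 0).
Local Notation E := (outer A).

(** The properties of the potential used for comparisons: [c s] is its value on the
inclusion [s] and [k] the strength of the dipole. They are preserved when the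
signs of [u], [c] and [k] are changed. *)
Record conducting (k : R) (c : R -> R) u : Prop := {
  con_harmonic : harmonic_on (E `\ o) u ;
  con_boundary : forall s, s ^+ 2 = 1 -> forall Z, bdry (A s) Z -> forall e, 0 < e ->
    \forall Y \near Z, E Y -> Y <> o -> `|u Y - c s| <= e ;
  con_const : forall s, s ^+ 2 = 1 -> forall Z, bdry (A s) Z -> u Z = c s ;
  con_flux : forall s, s ^+ 2 = 1 -> zero_flux (A s) (side_vertex eps s) u ;
  con_dipole : exists rho B : R, 0 < rho /\ forall P, 0 < sqd o P < rho ^+ 2 ->
    `|u P - k * (P.2 / sqd o P)| <= B ;
  con_decay : forall e, 0 < e -> exists r, forall X, r < dist o X -> `|u X| <= e }.

Lemma open_punctured : open (E `\ o).
Proof.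
apply: openI; first exact: open_outer.
apply: openP => X Xo; have k1 : {for X, continuous (sqd o)} by exact: sqd_cont.
have := near_gt k1 (sqd_o_gt0 Xo).
by apply: filterS => Y h Yo; move: h; rewrite /= Yo /sqd subrr expr0n/= addr0 ltxx.
Qed.

Lemma boundary_potential k c u : conducting k c u ->
  forall Z, ~ E Z -> exists2 s, s ^+ 2 = 1 & forall e, 0 < e ->
    \forall Y \near Z, E Y -> Y <> o -> `|u Y - c s| <= e.
Proof.
move=> hu Z /outer_alt[s s2 cZ]; exists s => // e e0.
have [AZ|nAZ] := pselect (A s Z); last first.
  by apply: (con_boundary hu s2) => //; apply/(bdry_open (hA s2)).
have := open_nbhs_nbhs (conj (cd_open (hA s2)) AZ).
apply: filterS => Y AY EY; case: (EY s s2); exact: subset_closure.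
Qed.

(** The singular parts of [u] and of its reflection cancel at the origin, which makes
the even part bounded there. *)
Lemma even_part_max k c u (m : R) : conducting k c u -> 0 <= m ->
  (forall s, s ^+ 2 = 1 -> 2 * c s <= m) ->
  forall X, (E `\ o) X -> u X + u (refl X) <= m.
Proof.
move=> hu m0 cm; apply: (@exterior_max_principle _ (E `\ o) (fun X => u X + u (refl X))).
- exact: open_punctured.
- by case=> _; apply.
- apply: harmonic_refl (con_harmonic hu) => X [EX Xo].
  by split; [exact: (refl_outer hA EX)|exact: refl_neq_o].
- have [rho [B [rho0 HB]]] := con_dipole hu.
  exists rho, (B + B); split => // Y [EY Yo] Yr.
  have Y0 := sqd_o_gt0 Yo.
  have := HB Y; rewrite Y0 Yr => /(_ isT) h1.
  have := HB (refl Y); rewrite sqd_refl Y0 Yr => /(_ isT).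
  rewrite /= mulNr mulrN opprK => h2.
  move: h1 h2; rewrite !ler_norml => /andP[_ h1] /andP[_ h2].
  have := lerD h1 h2; apply: le_trans; rewrite addrACA [- _ + _]addrC subrr addr0//.
- move=> e e0; have e2 : 0 < e / 2 by rewrite divr_gt0.
  have [r hr] := con_decay hu e2; exists r => Y _ Yr.
  have h1 := le_trans (ler_norm _) (hr Y Yr).
  have : r < dist o (refl Y) by rewrite /dist sqd_refl.
  move=> /hr/(le_trans (ler_norm _)) h2.
  by have := lerD h1 h2; rewrite -splitr => /le_trans; apply; rewrite lerDr.
- move=> Z nD Zo e e0; have e2 : 0 < e / 2 by rewrite divr_gt0.
  have nE : ~ E Z by move=> EZ; apply: nD.
  have [s s2 hs] := boundary_potential hu nE.
  have nE' : ~ E (refl Z) by move=> /(refl_outer hA); rewrite reflK.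
  have [s' s2' hs'] := boundary_potential hu nE'.
  have n1 := hs _ e2.
  have n2 : \forall Y \near Z, E (refl Y) -> refl Y <> o -> `|u (refl Y) - c s'| <= e / 2.
    exact: (refl_cont (hs' _ e2)).
  have [cm1 cm2] := (cm _ s2, cm _ s2').
  apply: filterS2 n1 n2 => Y h1 h2 [EY Yo].
  have := h1 EY Yo; have := h2 (refl_outer hA EY) (refl_neq_o Yo).
  rewrite !ler_norml => /andP[_ k1] /andP[_ k2]; lra.
Qed.

(** If the larger of the two values were positive, twice this value would bound the
even part, and the flux through that inclusion could not vanish. *)
Lemma potential_le0 k c u : conducting k c u -> forall s, s ^+ 2 = 1 -> c s <= 0.
Proof.
move=> hu.
have sub s : s ^+ 2 = 1 -> (forall s', s' ^+ 2 = 1 -> c s' <= c s) -> c s <= 0.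
  move=> s2 cmax; rewrite leNgt; apply/negP => cs_pos.
  have cc : 0 <= 2 * c s by rewrite mulr_ge0// ltW.
  have hle := even_part_max hu cc.
  apply: (@flux_contradiction R eps mu cs sn s (A s) eps0 eps1 mu1 cs0 sn0 cs_sn s2 (hA s2) E u (c s)).
  - exact: (con_flux hu).
  - exact: (con_const hu).
  - by move=> Z cZ; exact: (near_outer eps0 hA s2 cZ).
  - by move=> X [wX _]; exact: (wedge_outer hA sqr_one wX).
  - by move=> X; exact: (strip_outer hA).
  - by move=> X; exact: (refl_outer hA).
  - exact: (con_harmonic hu).
  - by apply: hle => s' s2'; rewrite ler_pM2l// cmax.
  - have c2 : 0 < c s / 2 by rewrite divr_gt0.
    have [r hr] := con_decay hu c2.
    pose y := Num.max r 1 + 1.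
    have [ry y1] : r < y /\ 1 < y.
      by split; rewrite ltr_pwDr// le_max lexx ?orbT.
    have y0 : 0 < y := lt_trans ltr01 y1.
    have d1 : dist o (0, y) = y by rewrite /dist /sqd/= !subr0 expr0n/= add0r sqrtr_sqr gtr0_norm.
    have d2 : dist o (0, - y) = y by rewrite /dist /sqd/= !subr0 expr0n/= add0r sqrrN sqrtr_sqr gtr0_norm.
    exists y; split => //.
    have h1 := le_trans (ler_norm _) (hr (0, y) ltac:(by rewrite d1)).
    have h2 := le_trans (ler_norm _) (hr (0, - y) ltac:(by rewrite d2)).
    have := lerD h1 h2; rewrite -splitr => /le_lt_trans; apply.
    by rewrite ltr_pMl// ltr1n.
have [h|h] := leP (c 1) (c (-1)).
  have hm : c (-1) <= 0 by apply: sub; [exact: sqr_mone|move=> s' /sqr1_cases[]->].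
  by move=> s /sqr1_cases[]-> //; exact: le_trans hm.
have hm : c 1 <= 0 by apply: sub; [exact: sqr_one|move=> s' /sqr1_cases[]->//; exact: ltW].
by move=> s /sqr1_cases[]-> //; exact: le_trans (ltW h) hm.
Qed.

End EvenPart.

(** * Domination by the free dipole *)

Section OddGrowth.
Context {R : realType}.
Implicit Types (X Y Z P : plane R) (u : plane R -> R).
Variables (eps mu cs sn : R) (A : R -> set (plane R)).
Hypotheses (eps0 : 0 < eps) (eps1 : eps <= 1) (mu1 : 1 < mu).
Hypotheses (cs0 : 0 < cs) (sn0 : 0 < sn) (cs_sn : cs ^+ 2 + sn ^+ 2 = 1).
Hypothesis hA : forall s, s ^+ 2 = 1 -> cone_domain eps mu cs sn s (A s).

Let o : plane R := (0, 0).
Local Notation E := (outer A).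

Lemma zero_fluxN B (V : plane R) u : zero_flux B V u -> zero_flux B V (fun Y => - u Y).
Proof.
move=> zf gamma nu bp un; have [c1 i1 I1] := zf gamma nu bp un.
have mD : measurable (`]0, 1[%classic : set (measurableTypeR R)) by exact: measurable_itv.
have qE X : normal_quotient (fun Y => - u Y) nu X = (fun s => - normal_quotient u nu X s).
  by apply/funext => s; rewrite /normal_quotient; ring.
have c2 t : t \in `]0, 1[ -> cvg (normal_quotient (fun Y => - u Y) nu (gamma t) s @[s --> 0^'+]).
  by move=> ht; rewrite qE; exact: is_cvgN (c1 t ht).
have nE t : t \in `]0, 1[ -> normal_derivative (fun Y => - u Y) nu (gamma t) * enorm (velocity gamma t) =
    - (normal_derivative u nu (gamma t) * enorm (velocity gamma t)).
  move=> ht; rewrite /normal_derivative qE -mulNr; congr (_ * _).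
  exact: limN (c1 t ht).
split => //.
- apply: (@eq_integrable _ _ R lebesgue_measure _ mD (EFin \o (fun t => - (normal_derivative u nu (gamma t) * enorm (velocity gamma t))))).
    by move=> t; rewrite inE/= => ht; rewrite nE.
  have := integrableN i1; exact.
- transitivity (\int[lebesgue_measure]_(t in `]0, 1[) (- 1 * (normal_derivative u nu (gamma t) * enorm (velocity gamma t)))).
    by apply: eq_Rintegral => t; rewrite inE/= => ht; rewrite nE// mulN1r.
  by have := RintegralZl (-1) mD i1; rewrite I1 mulr0.
Qed.

Lemma conductingN k c u : conducting eps A k c u ->
  conducting eps A (- k) (fun s => - c s) (fun Y => - u Y).
Proof.
move=> hu; split.
- exact: harmonicN (con_harmonic hu).
- move=> s s2 Z bZ e e0; have := con_boundary hu s2 bZ e0.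
  by apply: filterS => Y h EY Yo; rewrite -opprD normrN; exact: h.
- by move=> s s2 Z bZ; rewrite (con_const hu s2 bZ).
- by move=> s s2; exact: zero_fluxN (con_flux hu s2).
- have [rho [B [rho0 HB]]] := con_dipole hu.
  exists rho, B; split => // P /HB h; rewrite mulNr opprK.
  by rewrite -normrN opprD opprK.
- move=> e /(con_decay hu)[r hr]; exists r => X /hr; by rewrite normrN.
Qed.

Lemma conducting_odd k c u : conducting eps A k c u ->
  (forall s, s ^+ 2 = 1 -> c s = 0) /\ (forall X, (E `\ o) X -> u (refl X) = - u X).
Proof.
move=> hu; have hN := conductingN hu.
have c1 := potential_le0 eps0 eps1 mu1 cs0 sn0 cs_sn hA hu.
have c2 := potential_le0 eps0 eps1 mu1 cs0 sn0 cs_sn hA hN.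
have c0 s : s ^+ 2 = 1 -> c s = 0.
  by move=> s2; apply/eqP; rewrite eq_le c1//= -oppr_le0 c2.
split => // X EX.
have h1 := even_part_max hA hu (lexx 0) _ EX.
have h2 := even_part_max hA hN (lexx 0) _ EX.
apply/eqP; rewrite -addr_eq0 addrC eq_le h1 /=; last by move=> s s2; rewrite c0// mulr0.
by rewrite -oppr_le0 opprD h2// => s s2; rewrite c0// oppr0 mulr0.
Qed.

Lemma self_opp (x : R) : x = - x -> x = 0.
Proof. by lra. Qed.

Lemma jet_dipole X : X <> o -> exists a b, jet (fun Y => Y.2 / sqd o Y) X a b 0.
Proof.
move=> /sqd_o_gt0 X0; have Xn : sqd o X != 0 by rewrite gt_eqF.
do 2 eexists; apply: (jet_eq (jetM (jet_snd X) (jet_radial (jet2_inv Xn)))) => //.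
rewrite /=; set q := sqd o X in Xn *.
rewrite !mul0r mulr0 add0r addr0 subr0.
by field.
Qed.

(** Comparison of [u] and [- u] with the free dipole in the upper half of the exterior:
[u] vanishes on the axis by oddness and on the inclusions, where the free dipole
is nonnegative. *)
Lemma dipole_bound_upper k c u : conducting eps A k c u -> 0 <= k ->
  forall X, (E `\ o) X -> 0 < X.2 -> `|u X| <= k * (X.2 / sqd o X).
Proof.
move=> hu k0 X EX X2; have [c0 odd] := conducting_odd hu.
pose D : set (plane R) := (E `\ o) `&` [set Y | 0 < Y.2].
have oD : open D.
  apply: openI; first exact: open_punctured.
  by apply: openP => Y Y2; exact: (near_gt (@snd_cont _ Y) Y2).
have nDo : ~ D o by case=> _ /=; rewrite ltxx.
have DX : D X by [].
have axis Y : 0 < Y.2 -> 0 <= k * (Y.2 / sqd o Y).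
  by move=> Y2; rewrite mulr_ge0// divr_ge0 ?sqd_ge0// ltW.
have hk : harmonic_on D (fun Y => k * (Y.2 / sqd o Y)).
  move=> Y [[_ Yo] _]; have [a [b j]] := jet_dipole Yo.
  by do 2 eexists; apply: (jet_eq (jetZ k j)) => //; rewrite mulr0.
have hD : harmonic_on D u by move=> Y [EY _]; exact: (con_harmonic hu).
have [rho [B [rho0 HB]]] := con_dipole hu.
have small Z : ~ D Z -> Z <> o -> forall e, 0 < e -> \forall Y \near Z, D Y -> `|u Y| <= e.
  move=> nD Zo e e0.
  have [EZ|nE] := pselect (E Z); last first.
    have [s s2 hs] := boundary_potential hA hu nE.
    have := hs e e0; apply: filterS => Y h [[EY Yo] _].
    by have := h EY Yo; rewrite c0// subr0.
  have Z2 : Z.2 <= 0 by rewrite leNgt; apply/negP => h; apply: nD.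
  have [Z2n|Z2p] := ltP Z.2 0.
    have := near_lt (@snd_cont _ Z) Z2n; apply: filterS => Y h [_ /= k2].
    by have := lt_trans h k2; rewrite ltxx.
  have Z20 : Z.2 = 0 by apply/eqP; rewrite eq_le Z2.
  have rZ : refl Z = Z by rewrite /refl Z20 oppr0 -Z20 -surjective_pairing.
  have u0 : u Z = 0.
    by apply: self_opp; have := odd Z (conj EZ Zo); rewrite rZ.
  have [a [b [cu _]]] := con_harmonic hu (conj EZ Zo).
  have cn : {for Z, continuous (fun Y => `|u Y|)}.
    by apply: (@continuous_comp _ _ _ u (fun r : R => `|r|)) => //; exact: norm_continuous.
  have ue : `|u Z| < e by rewrite u0 normr0.
  by have := near_lt cn ue; apply: filterS => Y /ltW h _.
have inf_small e : 0 < e -> exists r, forall Y, D Y -> r < dist o Y -> `|u Y| <= e.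
  by move=> /(con_decay hu)[r hr]; exists r => Y _; exact: hr.
have up : u X - k * (X.2 / sqd o X) <= 0.
  apply: (@exterior_max_principle _ D (fun Y => u Y - k * (Y.2 / sqd o Y)) 0 oD nDo) => //.
  - exact: harmonicB.
  - exists rho, B; split => // Y [[_ Yo] _] Yr.
    by apply: le_trans (ler_norm _) (HB Y _); rewrite Yr sqd_o_gt0.
  - move=> e /inf_small[r hr]; exists r => Y DY Yr; rewrite add0r.
    apply: le_trans (le_trans (ler_norm _) (hr Y DY Yr)).
    by rewrite lerBlDr lerDl axis//; case: DY.
  - move=> Z nD Zo e e0; have := small Z nD Zo e e0; apply: filterS => Y h DY.
    rewrite add0r; apply: le_trans (le_trans (ler_norm _) (h DY)).
    by rewrite lerBlDr lerDl axis//; case: DY.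
have dn : - u X - k * (X.2 / sqd o X) <= 0.
  apply: (@exterior_max_principle _ D (fun Y => - u Y - k * (Y.2 / sqd o Y)) 0 oD nDo) => //.
  - by apply: harmonicB => //; exact: harmonicN.
  - exists rho, B; split => // Y [[_ Yo] Y2] Yr.
    have := HB Y; rewrite Yr sqd_o_gt0// => /(_ isT).
    rewrite ler_norml => /andP[h _]; have := axis Y Y2; lra.
  - move=> e /inf_small[r hr]; exists r => Y DY Yr; rewrite add0r.
    have h := hr Y DY Yr; rewrite -normrN in h.
    apply: le_trans (le_trans (ler_norm _) h).
    by rewrite lerBlDr lerDl axis//; case: DY.
  - move=> Z nD Zo e e0; have := small Z nD Zo e e0; apply: filterS => Y h DY.
    have {}h := h DY; rewrite -normrN in h.
    rewrite add0r; apply: le_trans (le_trans (ler_norm _) h).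
    by rewrite lerBlDr lerDl axis//; case: DY.
by rewrite ler_norml; apply/andP; split; lra.
Qed.

Lemma dipole_bound k c u : conducting eps A k c u -> 0 <= k ->
  forall X, E X -> X <> o -> `|u X| * sqd o X <= k * `|X.2|.
Proof.
move=> hu k0 X EX Xo; have [c0 odd] := conducting_odd hu.
have sX := sqd_o_gt0 Xo.
have [X2|X2|X2] := ltgtP X.2 0.
- have := dipole_bound_upper hu k0 (conj (refl_outer hA EX) (refl_neq_o Xo)).
  rewrite /= oppr_gt0 => /(_ X2); rewrite sqd_refl odd// normrN (ltr0_norm X2).
  by rewrite mulrA ler_pdivlMr.
- have := dipole_bound_upper hu k0 (conj EX Xo) X2.
  by rewrite (gtr0_norm X2) mulrA ler_pdivlMr.
- have rX : refl X = X by rewrite /refl X2 oppr0 -X2 -surjective_pairing.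
  have u0 : u X = 0.
    by apply: self_opp; have := odd X (conj EX Xo); rewrite rX.
  by rewrite u0 normr0 mul0r mulr_ge0.
Qed.

Lemma gradient_estimate k c u a b l X : conducting eps A k c u -> 0 <= k ->
  E X -> X <> o -> dist o X < 1 -> jet u X a b l ->
  Num.sqrt (a ^+ 2 + b ^+ 2) <= k * (3240 / slope mu cs sn) / sqd o X.
Proof.
move=> hu k0 EX Xo X1 ju; have [c0 _] := conducting_odd hu.
have [t t2 tX] : exists2 t : R, t ^+ 2 = 1 & 0 <= t * X.2.
  have [h|/ltW h] := leP 0 X.2; first by exists 1; [exact: sqr_one|rewrite mul1r].
  by exists (-1); [exact: sqr_mone|rewrite mulN1r oppr_ge0].
have wE Y : wedge eps mu cs sn t Y -> E Y by move=> wY; exact: (wedge_outer hA t2 wY).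
apply: (wedge_gradient eps0 eps1 mu1 cs0 sn0 cs_sn t2 k0 _ _ _ _ Xo X1 tX ju).
- by move=> Y [/wE EY Yo]; exact: (con_harmonic hu).
- by move=> Y /wE EY Yo; exact: (dipole_bound hu k0).
- move=> s s2 Z Zmu h hZ e e0.
  have bZ : bdry (A s) Z.
    by apply: (@flat_bdry R eps mu cs sn s (A s) sn0 s2 (hA s2) t) => //; exact: sqr1_cases.
  have := con_boundary hu s2 bZ e0; rewrite c0//.
  by apply: filterS => Y hY /wE EY Yo; have := hY EY Yo; rewrite subr0.
- by apply: (@outer_wedge R eps mu cs sn A cs0 sn0 hA t X t2 EX _ tX); exact: lt_trans mu1.
Qed.

End OddGrowth.

(** * Gradient bound for the dipole potential *)

Section Solution.
Context {R : realType}.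
Implicit Types (X Y Z P : plane R) (u : plane R -> R).
Variables (alpha mu eps : R) (Om1 Om2 : set (plane R)).
Hypotheses (ha : 0 < alpha < pi) (hmu : 1 < mu) (heps : 0 < eps) (heps1 : eps <= 1).
Hypothesis hinc : inclusions alpha mu eps Om1 Om2.

Let cs := cos (alpha / 2).
Let sn := sin (alpha / 2).
Let o : plane R := (0, 0).

Definition two_inclusions (s : R) : set (plane R) := if 0 < s then Om2 else Om1.
Local Notation A := two_inclusions.

Lemma two_inclusionsE : A 1 = Om2 /\ A (-1) = Om1.
Proof. by rewrite /two_inclusions ltr01 oppr_gt0 ltr10. Qed.

Lemma two_domains s : s ^+ 2 = 1 -> cone_domain eps mu cs sn s (A s).
Proof.
have [E2 E1] := two_inclusionsE.
by move=> /sqr1_cases[]->; rewrite ?E1 ?E2; [exact: (domain2 ha hmu heps heps1 hinc)|exact: (domain1 ha hmu heps heps1 hinc)].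
Qed.

Lemma exteriorE : exterior Om1 Om2 = outer A.
Proof.
have [E2 E1] := two_inclusionsE.
rewrite /exterior closureU; apply/seteqP; split=> X /=.
  by move=> h s /sqr1_cases[]->; rewrite ?E1 ?E2 => k; apply: h; [right|left].
move=> h [k|k].
  by apply: (h (-1)); [exact: sqr_mone|rewrite E1].
by apply: (h 1); [exact: sqr_one|rewrite E2].
Qed.

Lemma dipole_conducting (k : R) u :
  dipole_solution (0, 1) origin eps Om1 Om2 u ->
  (exists rho B : R, 0 < rho /\ forall P, 0 < sqd o P < rho ^+ 2 ->
    `|u P - k * (P.2 / sqd o P)| <= B) ->
  (forall X, (outer A `\ o) X -> exists a b, jet u X a b 0) ->
  exists c, conducting eps A k c u.
Proof.
move=> hu hn hh; have [E2 E1] := two_inclusionsE.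
have [c1 hc1] := sol_const1 hu; have [c2 hc2] := sol_const2 hu.
pose c (s : R) := if 0 < s then c2 else c1.
have hc s : s ^+ 2 = 1 -> forall Z, bdry (A s) Z -> u Z = c s.
  move=> /sqr1_cases[]->; rewrite /c ?ltr01 ?oppr_gt0 ?ltr10 ?E1 ?E2; [exact: hc2|exact: hc1].
exists c; split => //.
- move=> s s2 Z bZ e e0.
  set B := (exterior Om1 Om2 `|` bdry Om1 `|` bdry Om2) `\ origin.
  have BZ : B Z.
    split; last first.
      move=> Zo; have [cZ _] := (bdry_open (two_domains s2) Z).1 bZ.
      by rewrite Zo in cZ; exact: (origin_outer heps two_domains s2 cZ).
    by case: (sqr1_cases s2) bZ => ->; rewrite ?E1 ?E2; [right|left; right].
  have /subspace_continuousP/(_ Z BZ) := sol_continuous hu.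
  move=> /cvgrPdist_le /(_ e e0); rewrite near_withinE.
  apply: filterS => Y h EY Yo; rewrite -(hc s s2 Z bZ) distrC; apply: h.
  by split => //; left; left; rewrite exteriorE.
- move=> s /sqr1_cases[]->; rewrite ?E1 ?E2.
    by rewrite (_ : side_vertex eps 1 = vertex2 eps) ?/side_vertex ?mul1r//; exact: sol_flux2 hu.
  rewrite (_ : side_vertex eps (-1) = vertex1 eps); first exact: sol_flux1 hu.
  by rewrite /side_vertex /vertex1 mulN1r mulNr.
- move=> e e0; have [M [r Hr]] := sol_decay hu.
  exists (Num.max (Num.max r 1) (`|M| / e)) => X.
  rewrite !gt_max => /andP[/andP[h1 h2] h3].
  have d0 : 0 < dist o X := lt_trans ltr01 h2.
  have := Hr X; rewrite enormE => /(_ h1)/le_trans; apply.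
  rewrite ler_pdivrMr// -ler_pdivrMl// mulrC; apply: le_trans (ltW h3).
  by rewrite ler_pM2r ?invr_gt0// ler_norm.
Qed.

End Solution.

Theorem theorem5p1 (R : realType) (alpha mu eps0 : R)
    (Om1 Om2 : R -> set (plane R)) :
  0 < alpha < pi -> 1 < mu -> 0 < eps0 ->
  inclusion_family alpha mu eps0 Om1 Om2 ->
  exists C eps1 : R, [/\ 0 < C, 0 < eps1 <= eps0 &
    forall eps, 0 < eps < eps1 ->
    forall u : plane R -> R,
      dipole_solution (0, 1) origin eps (Om1 eps) (Om2 eps) u ->
      forall X, disk 1 origin X -> ~ closure (Om1 eps `|` Om2 eps) X ->
        X <> origin ->
        enorm (grad u X) <= C / enorm X ^+ 2].
Proof.
move=> ha mu1 eps00 hfam.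
have [kappa k0 Hk] := @dipole_asymptotics R.
have [cs0 [sn0 cs_sn]] := half_angle_pos ha.
set cs := cos (alpha / 2) in cs0 cs_sn; set sn := sin (alpha / 2) in sn0 cs_sn.
have sl0 := slope_gt0 mu1 cs0 sn0.
exists (kappa * (3240 / slope mu cs sn)), (Num.min eps0 1); split.
- have p0 : 0 < (3240 : R) by lra.
  exact: mulr_gt0 k0 (divr_gt0 p0 sl0).
- by rewrite lt_min eps00 ltr01 ge_min lexx.
move=> eps; rewrite lt_min => /andP[e0 /andP[ee0 /ltW eps_le1]] u hu X X1 EX Xo.
have hinc : inclusions alpha mu eps (Om1 eps) (Om2 eps).
  by apply: (fam_inclusions hfam); rewrite e0.
have hA := two_domains ha mu1 e0 eps_le1 hinc.
have EE := exteriorE (Om1 eps) (Om2 eps).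
set A := two_inclusions (Om1 eps) (Om2 eps) in hA EE.
have oE : open (outer A) by exact: open_outer.
have oP : open (outer A `\ origin) by exact: open_punctured.
have oO : outer A origin by exact: (origin_outer e0 hA).
have wd : weak_dipole (outer A) u by rewrite -EE; exact: (sol_eq hu).
have reg : Ck_on (outer A `\ origin) 2 u by rewrite -EE; exact: (sol_regular hu).
have jets Y : (outer A `\ origin) Y -> jet u Y ('D_e1 u Y) ('D_e2 u Y) 0.
  move=> hY; apply: (jet_eq (Ck_jet oP reg hY)) => //.
  by case: hY => EY Yo; exact: (weak_harmonic oE wd reg EY Yo).
have hn := Hk (outer A) u oE oO wd (fun Y EY Yo => (jets Y (conj EY Yo)).1).
have [c hc] : exists c, conducting eps A kappa c u.
  by apply: (dipole_conducting ha mu1 e0 eps_le1 hinc hu hn) => Y hY; do 2 eexists; exact: jets.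
have EX' : outer A X by rewrite -EE.
have := gradient_estimate e0 eps_le1 mu1 cs0 sn0 cs_sn hA hc (ltW k0) EX' Xo ((diskE 1 X).1 X1) (jets X (conj EX' Xo)).
by rewrite [enorm X]enormE dist_sqr /enorm /dotp -!expr2.
Qed.
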